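(* Let $G$ be a countable ICC group, let $\lambda$ be the left regular unitary representation of $G$ on $\ell^2(G)$, let $P\in\lambda(G)'$ be a projection, and let $\pi=\lambda|_P$ be the corresponding subrepresentation of $\lambda$. Then the following are equivalent: (i) $\lambda(G)'$ and $P\lambda(G)'P$ are isomorphic ($*$-isomorphic) von Neumann algebras; (ii) there exists a group representation (i.e. a unitary representation) $\sigma$ of $G$ such that $(\pi,\sigma)$ is a dual pair.
   Context: A group $G$ is ICC if the conjugacy class of every non-identity element is infinite. The left regular representation is $\lambda_g\chi_h=\chi_{gh}$ on $\ell^2(G)$, where $\{\chi_g\}_{g\in G}$ is the standard orthonormal basis. For a projection $P\in\lambda(G)'$, $\lambda|_P$ (also $\lambda_P$) is the restriction of $\lambda$ to the invariant subspace $P\ell^2(G)$, and $P\lambda(G)'P$ is regarded as a von Neumann algebra on $P\ell^2(G)$. For $\mathcal A\subseteq B(H)$, $\mathcal A'$ is the commutant and $\mathcal A''=(\mathcal A')'$. A sequence $\{x_n\}$ in a Hilbert space $H$ is a frame for $H$ if there are $A,B>0$ with $A\|x\|^2\le\sum_n|\langle x,x_n\rangle|^2\le B\|x\|^2$ for all $x\in H$, and Bessel if the right-hand inequality holds for some $B$. It is a Riesz sequence if there are $0<a\le b$ with $a\sum|c_n|^2\le\|\sum c_nx_n\|^2\le b\sum|c_n|^2$ for all finitely supported scalars $(c_n)$. For a unitary representation $\pi$ of $G$ on $H$, a vector $\xi\in H$ is a complete frame vector (resp. Bessel vector) for $\pi$ if $\{\pi(g)\xi\}_{g\in G}$, as a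 sequence indexed by $G$, is a frame for $H$ (resp. is Bessel); $\pi$ is a frame representation if it admits a complete frame vector. (Every subrepresentation of $\lambda$ is a frame representation.) For a frame representation $\pi$ of $G$ on $H$ and a representation $\sigma$ of $G$ on the same space $H$, $(\pi,\sigma)$ is a dual pair if: $\pi(G)'=\sigma(G)''$; $\pi$ has a complete frame vector which is also a Bessel vector for $\sigma$; and $\sigma$ admits a Riesz sequence, i.e. there is $\psi\in H$ such that $\{\sigma(g)\psi\}_{g\in G}$ is a Riesz sequence. *)

(* Defs.v *)
From HB Require Import structures.
From mathcomp Require Import all_boot all_order ssralg ssrnum sesquilinear.
From mathcomp Require Import complex.
From mathcomp Require Import mathcomp_extra boolp classical_sets functions.
From mathcomp Require Import cardinality fsbigop reals constructive_ereal ereal.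
From mathcomp Require Import numfun esum ring lra.

Set Implicit Arguments.
Unset Strict Implicit.
Unset Printing Implicit Defensive.

Import Order.TTheory GRing.Theory Num.Theory.
Import Normc (normc).

Local Open Scope classical_set_scope.
Local Open Scope ring_scope.

Local Notation Re := (@complex.Re _).
Local Notation Im := (@complex.Im _).

Section dotnorm.
Variables (R : realType) (V : lmodType R[i]) (f : V -> V -> R[i]).

Definition dotnorm (x : V) : R := Num.sqrt (Re (f x x)).

Definition dot_complete : Prop :=
  forall u : nat -> V,
    (forall e : R, 0 < e -> exists N : nat, forall m n,
       (N <= m)%N -> (N <= n)%N -> dotnorm (u m - u n) < e) ->
  exists l : V, forall e : R, 0 < e -> exists N : nat, forall n,
       (N <= n)%N -> dotnorm (u n - l) < e.

End dotnorm.

(** In a [{dot V for Num.conj}] the form is linear in its first argument and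
    conjugate-linear in the second one. *)
HB.mixin Record isHilbert (R : realType) V of GRing.Lmodule R[i] V := {
  hdot : {dot V for Num.conj};
  hdot_complete : dot_complete hdot }.

#[short(type="hilbertType")]
HB.structure Definition Hilbert (R : realType) :=
  {V of GRing.Lmodule R[i] V & isHilbert R V}.

HB.factory Record Lmodule_isHilbert (R : realType) V of GRing.Lmodule R[i] V := {
  inner : V -> V -> R[i];
  inner_linearl : forall z a x y, inner (a *: x + y) z = a * inner x z + inner y z;
  inner_conj : forall x y, inner x y = Num.conj (inner y x);
  inner_gt0 : forall x, x != 0 -> 0 < inner x x;
  inner_complete : dot_complete inner }.

HB.builders Context (R : realType) V of Lmodule_isHilbert R V.

Fact inner_bilinear :
  bilinear_for (GRing.Scale.Law.clone _ _ *%R _)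
    (GRing.Scale.Law.clone _ _ (Num.conj \; *%R) _) inner.
Proof.
split=> [z|z] a x y /=; first exact: inner_linearl.
by rewrite ![inner z _]inner_conj inner_linearl rmorphD rmorphM.
Qed.

Fact inner_hermitian x y : inner x y = (-1) ^+ false * Num.conj (inner y x).
Proof. by rewrite mul1r inner_conj. Qed.

HB.instance Definition _ := bilinear_isBilinear.Build _ _ _ _ _ _ inner inner_bilinear.
HB.instance Definition _ :=
  isHermitianSesquilinear.Build _ _ _ _ inner inner_hermitian.
HB.instance Definition _ := isDotProduct.Build _ _ inner inner_gt0.
HB.instance Definition _ := isHilbert.Build R V inner_complete.

HB.end.

Notation "''[' x , y ]" := (hdot x y) : ring_scope.

Definition hnorm (R : realType) (H : hilbertType R) (x : H) : R :=
  dotnorm hdot x.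

Section operators.
Variables (R : realType) (H : hilbertType R).
Implicit Types (T S : H -> H) (A : set (H -> H)).

Definition bounded_operator T : Prop :=
  linear T /\ exists M : R, forall x, hnorm (T x) <= M * hnorm x.

Definition commutant A : set (H -> H) :=
  [set T | bounded_operator T /\ forall S, A S -> T \o S = S \o T].

(** [is_adjoint T S] : S is the adjoint of T *)
Definition is_adjoint T S : Prop := forall x y, '[T x, y] = '[x, S y].

Record projection := Projection {
  proj_fun :> H -> H;
  proj_linear : linear proj_fun;
  proj_idem : forall x, proj_fun (proj_fun x) = proj_fun x;
  proj_self_adjoint : is_adjoint proj_fun proj_fun }.

End operators.

(** *-isomorphism between *-algebras of operators; preservation of adjoints is
    expressed through the relation [is_adjoint]. *)
Definition star_isomorphic (R : realType) (H K : hilbertType R)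
    (M : set (H -> H)) (N : set (K -> K)) : Prop :=
  exists Phi : (H -> H) -> (K -> K),
  [/\ set_bij M N Phi,
      forall (a : R[i]) S T, M S -> M T -> Phi (a \*: S \+ T) = a \*: Phi S \+ Phi T,
      forall S T, M S -> M T -> Phi (S \o T) = Phi S \o Phi T &
      forall S T, M S -> M T -> is_adjoint S T -> is_adjoint (Phi S) (Phi T)].

Section range.
Variables (R : realType) (H : hilbertType R) (P : projection H).

Definition ran_pred : {pred H} := fun x => x \in range P.

Record ran := Ran { ran_val :> H; ran_valP : ran_val \in ran_pred }.

HB.instance Definition _ := [isSub for ran_val].
HB.instance Definition _ := [Choice of ran by <:].

Lemma ran_predE x : (x \in ran_pred) = (P x == x).
Proof.
apply/idP/eqP => [|Px]; last by apply/mem_set; exists x.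
by move=> /set_mem[y _ <-]; rewrite proj_idem.
Qed.

Lemma ran_submod_closed : submod_closed ran_pred.
Proof.
have PL := @proj_linear _ _ P.
split=> [|a x y]; rewrite !ran_predE.
  by apply/eqP; have := PL (-1) 0 0; rewrite scaleN1r oppr0 addr0 scaleN1r addNr.
by move=> /eqP Px /eqP Py; rewrite PL Px Py.
Qed.

HB.instance Definition _ := GRing.isSubmodClosed.Build R[i] H ran_pred ran_submod_closed.
HB.instance Definition _ := [SubChoice_isSubLmodule of ran by <:].

Definition ran_dot (x y : ran) : R[i] := '[ran_val x, ran_val y].

Lemma ran_valP_linear : linear ran_val.
Proof. by []. Qed.

Lemma ran_val_inj : injective ran_val.
Proof. exact: val_inj. Qed.

Lemma proj_ran (x : ran) : P (ran_val x) = ran_val x.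
Proof. by apply/eqP; rewrite -ran_predE ran_valP. Qed.

Lemma proj_ranP x : P x \in ran_pred.
Proof. by rewrite ran_predE proj_idem. Qed.

Lemma ran_dot_linearl z a x y :
  ran_dot (a *: x + y) z = a * ran_dot x z + ran_dot y z.
Proof. by rewrite /ran_dot ran_valP_linear linearDl linearZl_LR. Qed.

Lemma ran_dot_conj x y : ran_dot x y = Num.conj (ran_dot y x).
Proof. by rewrite /ran_dot hermC /= mul1r. Qed.

Lemma ran_dot_gt0 x : x != 0 -> 0 < ran_dot x x.
Proof.
move=> x0; apply: neq0_dnorm_gt0; apply: contra x0 => /eqP x0.
by apply/eqP/ran_val_inj; rewrite x0.
Qed.

Lemma proj_contraction x : hnorm (P x) <= hnorm x.
Proof.
have P_lin := @proj_linear _ _ P.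
rewrite /hnorm /dotnorm ler_sqrt; last first.
  by have := dnorm_ge0 hdot x; rewrite lecE => /andP[].
have e : '[x, x] = '[P x, P x] + '[x - P x, x - P x].
  have o : '[x - P x, P x] = 0.
    rewrite -proj_self_adjoint (_ : P (x - P x) = 0) ?linear0l //.
    have := P_lin (-1) (P x) x.
    by rewrite !scaleN1r proj_idem addNr addrC.
  have := dnormD hdot (x - P x) (P x).
  by rewrite subrK /= o rmorph0 !addr0 addrC.
have := dnorm_ge0 hdot (x - P x); rewrite e lecE => /andP[_].
by case: '[P x, P x] '[x - P x, x - P x] => a b [c d] /= ?; rewrite lerDl.
Qed.

Lemma ran_dot_complete : dot_complete ran_dot.
Proof.
move=> u cu; have [l ul] := @hdot_complete _ H (ran_val \o u) cu.
exists (Ran (proj_ranP l)) => e /ul[N uN]; exists N => n /uN; apply: le_lt_trans.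
have -> : dotnorm ran_dot (u n - Ran (proj_ranP l)) = hnorm (P (ran_val (u n) - l)).
  rewrite /hnorm /dotnorm /ran_dot.
  have -> : ran_val (u n - Ran (proj_ranP l)) = P (ran_val (u n) - l); last by [].
  have := @proj_linear _ _ P (-1) l (ran_val (u n)).
  by rewrite !scaleN1r [_ - l]addrC => ->; rewrite proj_ran addrC.
exact: proj_contraction.
Qed.

HB.instance Definition _ := Lmodule_isHilbert.Build R ran
  ran_dot_linearl ran_dot_conj ran_dot_gt0 ran_dot_complete.

End range.

Section sums.
Variables (R : realType) (T : choiceType).
Implicit Types (u v : T -> R) (h k : T -> R[i]).

(** Unordered sum: sum of the positive parts minus sum of the negative parts.
    It is meaningful only for absolutely summable families ([fine] sends an
    infinite value to 0), and is only used for those. *)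
Definition rsum u : R :=
  fine (\esum_(x in [set: T]) (Num.max (u x) 0)%:E)
  - fine (\esum_(x in [set: T]) (Num.max (- u x) 0)%:E).

Definition csum h : R[i] := Complex (rsum (Re \o h)) (rsum (Im \o h)).

Definition sqsum h : \bar R := (\esum_(x in [set: T]) (normc (h x) ^+ 2)%:E)%R.

Definition rsummable u : Prop := summable [set: T] (EFin \o u).

Let esum_fin u : rsummable u -> (forall x, 0 <= u x) ->
  (\esum_(x in [set: T]) (u x)%:E \is a fin_num)%E.
Proof.
rewrite /rsummable summableE => us u0; rewrite (eq_esum (b := fun x => `|(u x)%:E|%E)) //.
by move=> x _; rewrite /= ger0_norm.
Qed.

Lemma rsum_ge0E u : rsummable u -> (forall x, 0 <= u x) ->
  (rsum u)%:E = \esum_(x in [set: T]) (u x)%:E.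
Proof.
move=> us u0; rewrite /rsum [X in _ - fine X]esum1 ?subr0; last first.
  by move=> x _; congr EFin; apply/max_idPr; rewrite oppr_le0.
rewrite (eq_esum (b := fun x => (u x)%:E)) ?fineK ?esum_fin // => x _.
by congr EFin; apply/max_idPl.
Qed.

Lemma rsum_sub u v : rsummable u -> rsummable v ->
  (forall x, 0 <= u x) -> (forall x, 0 <= v x) ->
  rsum (fun x => u x - v x) = rsum u - rsum v.
Proof.
move=> us vs u0 v0; apply: EFin_inj; rewrite [in RHS]EFinB (rsum_ge0E us) // (rsum_ge0E vs) //.
rewrite -(esumB us vs); try by move=> x _; rewrite lee_fin.
have /= wpos := summable_funepos (summableB us vs).
have /= wneg := summable_funeneg (summableB us vs).
rewrite /rsum EFinB.
have e1 : (\esum_(x in [set: T]) (Num.max (u x - v x) 0)%:E)%E =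
   (\esum_(x in [set: T]) ((EFin \o u) \- (EFin \o v))%E^\+ x)%E.
  by apply: eq_esum => x _; rewrite funeposE EFin_max.
have e2 : (\esum_(x in [set: T]) (Num.max (- (u x - v x)) 0)%:E)%E =
   (\esum_(x in [set: T]) ((EFin \o u) \- (EFin \o v))%E^\- x)%E.
  by apply: eq_esum => x _; rewrite funenegE EFin_max.
rewrite e1 e2; rewrite !fineK //.
- move: wneg; rewrite summableE; congr (_ \is a fin_num).
  by apply: eq_esum => x _; rewrite gee0_abs.
- move: wpos; rewrite summableE; congr (_ \is a fin_num).
  by apply: eq_esum => x _; rewrite gee0_abs.
Qed.

Lemma rsummable_le u v : (\esum_(x in [set: T]) (v x)%:E < +oo)%E ->
  (forall x, `|u x| <= v x) -> rsummable u.
Proof.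
by move=> sv uv; apply: le_lt_trans sv; apply: le_esum => x _; rewrite lee_fin.
Qed.

Lemma rsummableD u v : rsummable u -> rsummable v -> rsummable (fun x => u x + v x).
Proof. exact: summableD. Qed.

Lemma rsummableN u : rsummable u -> rsummable (fun x => - u x).
Proof. by rewrite /rsummable summableN. Qed.

Lemma ge0_esumZ (a : R) u : 0 <= a -> (forall x, 0 <= u x) ->
  \esum_(x in [set: T]) (a * u x)%:E = (a%:E * \esum_(x in [set: T]) (u x)%:E)%E.
Proof.
move=> a0 u0; rewrite /esum -ereal_supZl //; last first.
  apply/set0P; exists (\sum_(x \in set0) (u x)%:E)%E.
  by exists set0 => //; exact: fsets_set0.
rewrite image_comp; congr ereal_sup; apply: eq_imagel => A [fA _] /=.
rewrite ge0_mule_fsumr //.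
Qed.

Lemma rsummableZ (a : R) u : rsummable u -> rsummable (fun x => a * u x).
Proof.
move=> su; apply: (@rsummable_le _ (fun x => `|a| * `|u x|)); last first.
  by move=> x; rewrite normrM.
rewrite ge0_esumZ //; move: su; rewrite /rsummable summableE => /fineK /= <-.
by rewrite -EFinM ltry.
Qed.

Lemma rsumD u v : rsummable u -> rsummable v ->
  rsum (fun x => u x + v x) = rsum u + rsum v.
Proof.
move=> su sv.
pose up x := Num.max (u x) 0; pose un x := Num.max (- u x) 0.
pose vp x := Num.max (v x) 0; pose vn x := Num.max (- v x) 0.
have maxle (x : R) : `|Num.max x 0| <= `|x|.
  by case: (leP x 0) => _ //; rewrite normr0.
have sup : rsummable up by apply: le_lt_trans su; apply: le_esum => x _; rewrite lee_fin; exact: maxle.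
have svp : rsummable vp by apply: le_lt_trans sv; apply: le_esum => x _; rewrite lee_fin; exact: maxle.
have sun : rsummable un.
  apply: le_lt_trans su; apply: le_esum => x _; rewrite lee_fin.
  by apply: le_trans (maxle _) _; rewrite normrN.
have svn : rsummable vn.
  apply: le_lt_trans sv; apply: le_esum => x _; rewrite lee_fin.
  by apply: le_trans (maxle _) _; rewrite normrN.
have max0 (x : R) : 0 <= Num.max x 0 by rewrite le_max lexx orbT.
have decomp (x : R) : x = Num.max x 0 - Num.max (- x) 0.
  case: (leP x 0) => x0; first by rewrite max_l ?oppr_ge0 // sub0r opprK.
  by rewrite max_r ?subr0 // oppr_le0 ltW.
have ge0D w z : rsummable w -> rsummable z -> (forall x, 0 <= w x) ->
    (forall x, 0 <= z x) -> rsum (fun x => w x + z x) = rsum w + rsum z.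
  move=> sw sz w0 z0; apply: EFin_inj; rewrite [in RHS]EFinD (rsum_ge0E sw) // (rsum_ge0E sz) //.
  rewrite rsum_ge0E; [|exact: rsummableD|by move=> x; exact: addr_ge0].
  by rewrite -esumD // => x _; rewrite lee_fin.
have eu : rsum u = rsum up - rsum un.
  rewrite -(rsum_sub sup sun (fun=> max0 _) (fun=> max0 _)).
  by congr rsum; apply/funext => x; exact: decomp.
have ev : rsum v = rsum vp - rsum vn.
  rewrite -(rsum_sub svp svn (fun=> max0 _) (fun=> max0 _)).
  by congr rsum; apply/funext => x; exact: decomp.
have max0D (f g : T -> R) x : 0 <= Num.max (f x) 0 + Num.max (g x) 0.
  exact: addr_ge0.
rewrite eu ev addrACA -opprD -(ge0D _ _ sup svp (fun=> max0 _) (fun=> max0 _)).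
rewrite -(ge0D _ _ sun svn (fun=> max0 _) (fun=> max0 _)).
rewrite -(rsum_sub (rsummableD sup svp) (rsummableD sun svn)
  (max0D _ _) (max0D (\- u) (\- v))).
by congr rsum; apply/funext => x; rewrite opprD addrACA -!decomp.
Qed.

Lemma rsumN u : rsum (fun x => - u x) = - rsum u.
Proof.
rewrite /rsum opprB; congr (_ - fine _).
by apply: eq_esum => x _; rewrite opprK.
Qed.

Lemma rsumZ (a : R) u : rsummable u -> rsum (fun x => a * u x) = a * rsum u.
Proof.
wlog a0 : a / 0 <= a => [th|] su.
  case: (leP 0 a) => [/th|/ltW a0]; first exact.
  rewrite -[a]opprK mulNr -th ?oppr_ge0 // -rsumN; congr rsum.
  by apply/funext => x; rewrite mulNr.
have pos (w : T -> R) : rsummable w ->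
    fine (\esum_(x in [set: T]) (Num.max (a * w x) 0)%:E) =
    a * fine (\esum_(x in [set: T]) (Num.max (w x) 0)%:E).
  move=> sw; rewrite (eq_esum (b := fun x => (a * Num.max (w x) 0)%:E)); last first.
    by move=> x _; rewrite maxr_pMr // mulr0.
  rewrite ge0_esumZ //; last by move=> x; rewrite le_max lexx orbT.
  have : rsummable (fun x => Num.max (w x) 0).
    apply: le_lt_trans sw; apply: le_esum => x _; rewrite lee_fin.
    by case: (leP (w x) 0) => _ //; rewrite normr0.
  move=> /esum_fin /(_ _)/fineK <- //.
  by move=> x; rewrite le_max lexx orbT.
rewrite /rsum mulrBr -!pos //; last exact: rsummableN.
congr (_ - fine _).
by apply: eq_esum => x _; rewrite mulrN.
Qed.

Lemma rsum_reindex (e : T -> T) u : set_bij setT setT e -> rsum (u \o e) = rsum u.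
Proof.
move=> be; rewrite /rsum [X in _ = fine X - _](reindex_esum setT setT e) //.
by rewrite [X in _ = _ - fine X](reindex_esum setT setT e).
Qed.

Definition csummable h : Prop := rsummable (Re \o h) /\ rsummable (Im \o h).

Lemma csumD h k : csummable h -> csummable k ->
  csum (fun x => h x + k x) = csum h + csum k.
Proof.
move=> [rh ih] [rk ik]; rewrite /csum.
have -> : Re \o (fun x => h x + k x) = (fun x => (Re \o h) x + (Re \o k) x).
  by apply/funext => x /=; case: (h x) (k x) => ? ? [].
have -> : Im \o (fun x => h x + k x) = (fun x => (Im \o h) x + (Im \o k) x).
  by apply/funext => x /=; case: (h x) (k x) => ? ? [].
by rewrite !rsumD.
Qed.

Lemma csummableD h k : csummable h -> csummable k -> csummable (fun x => h x + k x).
Proof.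
move=> [rh ih] [rk ik]; split.
  have -> : Re \o (fun x => h x + k x) = (fun x => (Re \o h) x + (Re \o k) x).
    by apply/funext => x /=; case: (h x) (k x) => ? ? [].
  exact: rsummableD.
have -> : Im \o (fun x => h x + k x) = (fun x => (Im \o h) x + (Im \o k) x).
  by apply/funext => x /=; case: (h x) (k x) => ? ? [].
exact: rsummableD.
Qed.

Lemma csumZ (a : R[i]) h : csummable h -> csum (fun x => a * h x) = a * csum h.
Proof.
move=> [rh ih]; rewrite /csum.
have -> : Re \o (fun x => a * h x) =
    (fun x => Re a * (Re \o h) x + - (Im a * (Im \o h) x)).
  by apply/funext => x /=; case: a (h x) => ? ? [].
have -> : Im \o (fun x => a * h x) =
    (fun x => Re a * (Im \o h) x + Im a * (Re \o h) x).
  by apply/funext => x /=; case: a (h x) => ? ? [].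
rewrite !rsumD ?rsumN ?rsumZ //; do ?by [exact: rsummableZ|apply/rsummableN/rsummableZ].
by case: a => a b; rewrite -[RHS]/(Complex _ _).
Qed.

Lemma csum_conj h : csum (fun x => Num.conj (h x)) = Num.conj (csum h).
Proof.
rewrite /csum -[RHS]/(Complex _ _) -rsumN; congr (Complex (rsum _) (rsum _)).
  by apply/funext => x /=; case: (h x).
by apply/funext => x /=; case: (h x).
Qed.

Lemma csum_reindex (e : T -> T) h : set_bij setT setT e -> csum (h \o e) = csum h.
Proof.
by move=> be; rewrite /csum -(rsum_reindex (Re \o h) be) -(rsum_reindex (Im \o h) be).
Qed.

End sums.

Lemma sqr_normc (R : realType) (z : R[i]) : normc z ^+ 2 = Re z ^+ 2 + Im z ^+ 2.
Proof. by case: z => a b; rewrite /= sqr_sqrtr // addr_ge0 // sqr_ge0. Qed.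

Lemma sqr_normcM (R : realType) (z w : R[i]) :
  normc (z * w) ^+ 2 = normc z ^+ 2 * normc w ^+ 2.
Proof. by rewrite Normc.normcM exprMn. Qed.

Lemma sqr_normcD (R : realType) (z w : R[i]) :
  normc (z + w) ^+ 2 <= 2 * normc z ^+ 2 + 2 * normc w ^+ 2.
Proof.
rewrite !sqr_normc; case: z w => a b [c d] /=.
have key (s t : R) : (s + t) ^+ 2 <= 2 * s ^+ 2 + 2 * t ^+ 2.
  rewrite -subr_ge0 (_ : _ - _ = (s - t) ^+ 2) ?sqr_ge0 //.
  by ring.
by rewrite !mulrDr addrACA lerD.
Qed.

Lemma real_cauchy (R : realType) (a : nat -> R) :
  (forall e, 0 < e -> exists N, forall m n, (N <= m)%N -> (N <= n)%N ->
     `|a m - a n| < e) ->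
  exists l, forall e, 0 < e -> exists N, forall n, (N <= n)%N -> `|a n - l| < e.
Proof.
move=> ca; pose E := [set x : R | exists N, forall n, (N <= n)%N -> x <= a n].
have close e N : (forall m n, (N <= m)%N -> (N <= n)%N -> `|a m - a n| < e) ->
    E (a N - e) /\ ubound E (a N + e).
  move=> aN; split.
    exists N => n Nn; have := aN _ _ Nn (leqnn N).
    by rewrite ltr_distl => /andP[/ltW].
  move=> x [M xM]; apply: le_trans (xM _ (leq_maxr N M)) _.
  by have := aN _ _ (leq_maxl N M) (leqnn N); rewrite ltr_distl => /andP[_ /ltW].
have supE : has_sup E.
  by have [N /close[EN UN]] := ca _ ltr01; split; eexists; [exact: EN|exact: UN].
exists (sup E) => e e0.
have [N aN] := ca (e / 2) (divr_gt0 e0 (ltr0Sn _ 1)).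
have [EN UN] := close _ _ aN; exists N => n Nn.
have lo : a N - e / 2 <= sup E by exact: sup_upper_bound.
have hi : sup E <= a N + e / 2 by apply: ge_sup => //; exact: supE.1.
have := aN _ _ Nn (leqnn N); rewrite !ltr_distl => /andP[h1 h2].
by apply/andP; split; lra.
Qed.

Section sqsum.
Variables (R : realType) (T : choiceType).
Implicit Types (h k : T -> R[i]).

Lemma sqsum_leP h (c : R) : (sqsum h <= c%:E)%E <->
  forall s : seq T, uniq s -> \sum_(x <- s) normc (h x) ^+ 2 <= c.
Proof.
split=> [hc s us|hc].
  rewrite -lee_fin -sumEFin; apply: le_trans hc; apply: ereal_sup_ubound.
  exists [set` s]; last by rewrite -fsbig_seq.
  by split; [exact: finite_seq|].
apply: ge_ereal_sup => _ [A [fA _] <-].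
by rewrite fsbig_finite // sumEFin lee_fin hc.
Qed.

Lemma sqsum_ge0 h : (0 <= sqsum h)%E.
Proof. by apply: esum_ge0 => x _; rewrite lee_fin sqr_ge0. Qed.

Lemma sqsum_pinfty h : (sqsum h < +oo)%E -> exists2 c : R, 0 <= c & sqsum h = c%:E.
Proof.
move: (sqsum_ge0 h); case: (sqsum h) => [c c0 _|_|]; last by [].
  by exists c.
by rewrite ltxx.
Qed.

Lemma sqsum_reindex (e : T -> T) h : set_bij setT setT e -> sqsum (h \o e) = sqsum h.
Proof. by move=> be; rewrite /sqsum [RHS](reindex_esum setT setT e). Qed.

Definition l2_pred : {pred T -> R[i]} := fun h => `[< (sqsum h < +oo)%E >].

Lemma l2_submod_closed : submod_closed l2_pred.
Proof.
split=> [|a h k].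
  apply/asboolP; rewrite /sqsum esum1 ?ltry // => x _.
  by rewrite Normc.normc0 expr0n.
move=> /asboolP/sqsum_pinfty[c c0 hc] /asboolP/sqsum_pinfty[d d0 kd]; apply/asboolP.
apply: (@le_lt_trans _ _ (2 * (normc a ^+ 2 * c) + 2 * d)%:E); last exact: ltry.
apply/sqsum_leP => s us.
have /sqsum_leP/(_ s us) {}hc : (sqsum h <= c%:E)%E by rewrite hc.
have /sqsum_leP/(_ s us) {}kd : (sqsum k <= d%:E)%E by rewrite kd.
have -> : \sum_(x <- s) normc ((a *: h + k) x) ^+ 2 =
          \sum_(x <- s) normc (a * h x + k x) ^+ 2 by [].
apply: le_trans (ler_sum _ (fun x _ => sqr_normcD _ _)) _.
rewrite big_split /= -!mulr_sumr lerD ?ler_pM2l //.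
under eq_bigr do rewrite sqr_normcM.
by rewrite -mulr_sumr ler_wpM2l ?sqr_ge0.
Qed.

HB.instance Definition _ :=
  GRing.isSubmodClosed.Build R[i] (T -> R[i]) l2_pred l2_submod_closed.

Record l2 := L2 { l2_fun :> T -> R[i]; l2_funP : l2_fun \in l2_pred }.

HB.instance Definition _ := [isSub for l2_fun].
HB.instance Definition _ := [Choice of l2 by <:].
HB.instance Definition _ := [SubChoice_isSubLmodule of l2 by <:].

Implicit Types f g : l2.

Lemma l2_fun_linear : linear l2_fun.
Proof. by []. Qed.

Lemma l2P f g : l2_fun f =1 l2_fun g -> f = g.
Proof. by move=> fg; apply: val_inj; apply/funext. Qed.

Lemma l2_sqsum f : (sqsum f < +oo)%E.
Proof. exact/asboolP/l2_funP. Qed.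

Definition l2_dot f g : R[i] := csum (fun x => f x * Num.conj (g x)).

Lemma l2_dot_summable f g : csummable (fun x => f x * Num.conj (g x)).
Proof.
have [c c0 fc] := sqsum_pinfty (l2_sqsum f).
have [d d0 gd] := sqsum_pinfty (l2_sqsum g).
pose v x := normc (f x) ^+ 2 + normc (g x) ^+ 2.
have sv : (\esum_(x in [set: T]) (v x)%:E < +oo)%E.
  rewrite (eq_esum (b := fun x => (normc (f x) ^+ 2)%:E + (normc (g x) ^+ 2)%:E)%E) //.
  rewrite esumD; try by move=> x _; rewrite lee_fin sqr_ge0.
  by rewrite -!/(sqsum _) fc gd -EFinD ltry.
have key (z w : R[i]) : `|Re (z * Num.conj w)| <= normc z ^+ 2 + normc w ^+ 2 /\
    `|Im (z * Num.conj w)| <= normc z ^+ 2 + normc w ^+ 2.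
  suff le1 (t : R[i]) : `|Re t| <= normc t /\ `|Im t| <= normc t.
    have le2 : normc (z * Num.conj w) <= normc z ^+ 2 + normc w ^+ 2.
      rewrite Normc.normcM.
      have -> : normc (Num.conj w) = normc w by case: w => ? ? /=; rewrite sqrrN.
      have n0 (t : R[i]) : 0 <= normc t by case: t => ? ? /=; exact: sqrtr_ge0.
      case: (leP (normc z) (normc w)) => [zw|/ltW wz].
        apply: le_trans (_ : normc w ^+ 2 <= _); last by rewrite lerDr sqr_ge0.
        by rewrite expr2 ler_wpM2r.
      apply: le_trans (_ : normc z ^+ 2 <= _); last by rewrite lerDl sqr_ge0.
      by rewrite expr2 ler_wpM2l.
    by have [l1 l2] := le1 (z * Num.conj w); split; apply: le_trans le2.
  case: t => a b /=; rewrite -!sqrtr_sqr !ler_sqrt; rewrite ?addr_ge0 ?sqr_ge0 //.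
  by rewrite lerDl lerDr !sqr_ge0.
by split; apply: rsummable_le sv _ => x; [exact: (key _ _).1|exact: (key _ _).2].
Qed.

Lemma l2_dot_linearl q a f g : l2_dot (a *: f + g) q = a * l2_dot f q + l2_dot g q.
Proof.
have sf := l2_dot_summable f q; have sg := l2_dot_summable g q.
have saf := l2_dot_summable (a *: f) q.
rewrite /l2_dot -csumZ // -csumD //.
  by congr csum; apply/funext => x; rewrite mulrA -mulrDl.
suff -> : (fun x => a * (f x * Num.conj (q x))) =
          (fun x => (a *: f) x * Num.conj (q x)) by [].
by apply/funext => x; exact: mulrA.
Qed.

Lemma l2_dot_conj f g : l2_dot f g = Num.conj (l2_dot g f).
Proof.
rewrite /l2_dot -csum_conj; congr csum; apply/funext => x.
case: (f x) (g x) => a b [c d]; apply/eqP; rewrite eq_complex /=.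
by apply/andP; split; apply/eqP; ring.
Qed.

Lemma l2_dotE f (c : R) : sqsum f = c%:E -> l2_dot f f = c%:C%C.
Proof.
move=> fc; rewrite /l2_dot /csum.
have [sr _] := l2_dot_summable f f.
have e : Re \o (fun x => f x * Num.conj (f x)) = (fun x => normc (f x) ^+ 2).
  apply/funext => x /=; rewrite sqr_normc; case: (f x) => a b /=.
  by rewrite mulrN opprK -!expr2.
have -> : Im \o (fun x => f x * Num.conj (f x)) = (fun x => 0).
  apply/funext => x /=; case: (f x) => a b /=.
  by rewrite mulrN [b * a]mulrC addNr.
rewrite e in sr *; congr Complex; last by rewrite /rsum oppr0 subrr.
by apply: EFin_inj; rewrite -fc rsum_ge0E // => x; exact: sqr_ge0.
Qed.

Lemma l2_dot_gt0 f : f != 0 -> 0 < l2_dot f f.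
Proof.
have [c c0 fc] := sqsum_pinfty (l2_sqsum f).
rewrite (l2_dotE fc) => f0; rewrite ltcR lt_def c0 andbT.
apply: contra f0 => /eqP c00; apply/eqP/l2P => x.
have /sqsum_leP/(_ [:: x] isT) : (sqsum f <= c%:E)%E by rewrite fc.
rewrite big_seq1 c00 => fx; apply: Normc.eq0_normc.
by apply/eqP; rewrite -sqrf_eq0 eq_le fx sqr_ge0.
Qed.

Lemma l2_dotnorm_lt f (e : R) : 0 < e -> dotnorm l2_dot f < e ->
  forall s : seq T, uniq s -> \sum_(x <- s) normc (f x) ^+ 2 <= e ^+ 2.
Proof.
move=> e0 fe; apply/sqsum_leP; have [c c0 fc] := sqsum_pinfty (l2_sqsum f).
move: fe; rewrite /dotnorm (l2_dotE fc) /= fc lee_fin => ce.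
by rewrite -(sqr_sqrtr c0) ler_sqr ?nnegrE ?sqrtr_ge0 ?ltW.
Qed.

Lemma l2_dotnorm_le f (e : R) : 0 <= e ->
  (forall s : seq T, uniq s -> \sum_(x <- s) normc (f x) ^+ 2 <= e ^+ 2) ->
  dotnorm l2_dot f <= e.
Proof.
move=> e0 /sqsum_leP; have [c c0 fc] := sqsum_pinfty (l2_sqsum f).
rewrite /dotnorm (l2_dotE fc) /= fc lee_fin => ce.
by rewrite -[e](ger0_norm e0) -sqrtr_sqr ler_sqrt ?sqr_ge0.
Qed.

Lemma l2_dot_complete : dot_complete l2_dot.
Proof.
move=> u cu.
have cu2 e : 0 < e -> exists N : nat, forall m n, (N <= m)%N -> (N <= n)%N ->
    forall s : seq T, uniq s -> \sum_(x <- s) normc (u m x - u n x) ^+ 2 <= e ^+ 2.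
  by move=> e0; have [N uN] := cu _ e0; exists N => m n Nm Nn; exact: l2_dotnorm_lt (uN _ _ Nm Nn).
have pt (x : T) e : 0 < e -> exists N : nat, forall m n, (N <= m)%N -> (N <= n)%N ->
    `|Re (u m x) - Re (u n x)| < e /\ `|Im (u m x) - Im (u n x)| < e.
  move=> e0; have [N uN] := cu2 _ (divr_gt0 e0 (ltr0Sn _ 1)); exists N => m n Nm Nn.
  have := uN _ _ Nm Nn [:: x] isT; rewrite big_seq1 sqr_normc.
  case: (u m x) (u n x) => a b [c d] /=.
  have key (p q : R) : p ^+ 2 + q ^+ 2 <= (e / 2) ^+ 2 -> `|p| < e.
    move=> pq; apply: (@le_lt_trans _ _ (e / 2)); last by lra.
    have e2 : 0 <= e / 2 by lra.
    rewrite -ler_sqr ?nnegrE // real_normK ?num_real //.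
    by apply: le_trans pq; rewrite lerDl sqr_ge0.
  by move=> h; split; [exact: key h|rewrite addrC in h; exact: key h].
have pl (x : T) : exists l : R[i], forall e : R, 0 < e -> exists N : nat, forall n, (N <= n)%N ->
    normc (u n x - l) ^+ 2 < e.
  have [a ha] := @real_cauchy _ (fun n => Re (u n x)) (fun e e0 =>
    let: ex_intro N h := pt x e e0 in ex_intro _ N (fun m n Nm Nn => (h m n Nm Nn).1)).
  have [b hb] := @real_cauchy _ (fun n => Im (u n x)) (fun e e0 =>
    let: ex_intro N h := pt x e e0 in ex_intro _ N (fun m n Nm Nn => (h m n Nm Nn).2)).
  exists (Complex a b) => e e0.
  have se0 : 0 < Num.sqrt (e / 2) by rewrite sqrtr_gt0 divr_gt0.
  have [N hN] := ha _ se0; have [M hM] := hb _ se0; exists (maxn N M) => n.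
  rewrite geq_max => /andP[/hN + /hM]; rewrite sqr_normc; case: (u n x) => c d /=.
  have sq (p : R) : `|p| < Num.sqrt (e / 2) -> p ^+ 2 < e / 2.
    move=> h; rewrite -[p ^+ 2]real_normK ?num_real //.
    have e2 : 0 <= e / 2 by lra.
    by rewrite -(sqr_sqrtr e2) ltr_sqr ?nnegrE ?normr_ge0 // sqrtr_ge0.
  by move=> /sq h1 /sq h2; lra.
have [l ul] := choice pl.
have fin (s : seq T) (e : R) : 0 < e -> exists N : nat, forall n, (N <= n)%N ->
    \sum_(x <- s) normc (u n x - l x) ^+ 2 < e.
  elim: s e => [|x s IH] e e0; first by exists 0%N => n _; rewrite big_nil.
  have e2 : 0 < e / 2 by rewrite divr_gt0.
  have [N hN] := IH _ e2; have [M hM] := ul x _ e2; exists (maxn N M) => n.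
  rewrite geq_max => /andP[/hN h1 /hM h2]; rewrite big_cons; lra.
have unif e : 0 < e -> exists N : nat, forall n, (N <= n)%N -> forall s : seq T, uniq s ->
    \sum_(x <- s) normc (u n x - l x) ^+ 2 <= (e / 2) ^+ 2.
  move=> e0; have e4 : 0 < e / 4 by rewrite divr_gt0.
  have [N hN] := cu2 _ e4; exists N => n Nn s us.
  have [M hM] := fin s _ (exprn_gt0 2 e4).
  have h1 := hN _ (maxn N M) Nn (leq_maxl _ _) s us.
  have h2 := ltW (hM _ (leq_maxr N M)).
  have -> : \sum_(x <- s) normc (u n x - l x) ^+ 2 =
      \sum_(x <- s) normc (u n x - u (maxn N M) x + (u (maxn N M) x - l x)) ^+ 2.
    by apply: eq_bigr => x _; rewrite addrA subrK.
  apply: le_trans (ler_sum _ (fun x _ => sqr_normcD _ _)) _.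
  rewrite big_split /= -!mulr_sumr.
  have -> : (e / 2) ^+ 2 = 2 * (e / 4) ^+ 2 + 2 * (e / 4) ^+ 2 by field.
  by rewrite lerD // ler_pM2l.
have l_l2 : l \in l2_pred.
  have [N hN] := unif _ ltr01.
  have d_l2 : (fun x => u N x - l x) \in l2_pred.
    apply/asboolP; apply: (@le_lt_trans _ _ ((1 / 2) ^+ 2)%:E); last exact: ltry.
    by apply/sqsum_leP; exact: hN.
  suff -> : l = l2_fun (u N) - (fun x => u N x - l x).
    exact: rpredB (l2_funP (u N)) d_l2.
  by apply/funext => x; exact/esym/subKr.
exists (L2 l_l2) => e e0; have [N hN] := unif e e0; exists N => n Nn.
apply: (@le_lt_trans _ _ (e / 2)); last by lra.
have e2 : 0 <= e / 2 by lra.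
by apply: l2_dotnorm_le e2 _ => s us; exact: hN.
Qed.

HB.instance Definition _ := Lmodule_isHilbert.Build R l2
  l2_dot_linearl l2_dot_conj l2_dot_gt0 l2_dot_complete.

End sqsum.

Section frames.
Variables (R : realType) (H : hilbertType R) (I : choiceType).
Implicit Type x : I -> H.

Definition is_frame x : Prop :=
  exists A B : R, [/\ 0 < A, 0 < B & forall y : H,
    ((A * hnorm y ^+ 2)%:E <= \esum_(i in [set: I]) (normc '[y, x i] ^+ 2)%:E
       <= (B * hnorm y ^+ 2)%:E)%E].

Definition is_bessel x : Prop :=
  exists2 B : R, 0 < B & forall y : H,
    (\esum_(i in [set: I]) (normc '[y, x i] ^+ 2)%:E <= (B * hnorm y ^+ 2)%:E)%E.

Definition is_riesz x : Prop :=
  exists a b : R, [/\ 0 < a, a <= b &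
    forall c : I -> R[i], finite_set [set i | c i != 0] ->
      a * (\sum_(i \in [set: I]) normc (c i) ^+ 2)
        <= hnorm (\sum_(i \in [set: I]) c i *: x i) ^+ 2
        <= b * (\sum_(i \in [set: I]) normc (c i) ^+ 2)].

End frames.

(** Unitary representations. An isometric homomorphism is unitary, the inverse
    of the operator at g being the operator at g^-1. *)

Record unirep (R : realType) (G : groupType) (H : hilbertType R) := Unirep {
  rep_fun :> G -> H -> H;
  rep_linear : forall g, linear (rep_fun g);
  rep_isometry : forall g x y, '[rep_fun g x, rep_fun g y] = '[x, y];
  rep1 : rep_fun 1%g = id;
  repM : forall g h, rep_fun (g * h)%g = rep_fun g \o rep_fun h }.

Section representations.
Variables (R : realType) (G : groupType) (H : hilbertType R).
Implicit Types (pi sigma : unirep G H) (xi psi : H).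

Definition complete_frame_vector pi xi : Prop := is_frame (fun g => pi g xi).

Definition bessel_vector pi xi : Prop := is_bessel (fun g => pi g xi).

Definition frame_representation pi : Prop :=
  exists xi, complete_frame_vector pi xi.

Definition dual_pair pi sigma : Prop :=
  [/\ frame_representation pi,
      commutant (range pi) = commutant (commutant (range sigma)),
      exists xi, complete_frame_vector pi xi /\ bessel_vector sigma xi &
      exists psi, is_riesz (fun g => sigma g psi)].

End representations.

Section subrep.
Variables (R : realType) (G : groupType) (H : hilbertType R).
Variables (pi : unirep G H) (P : projection H).
Hypothesis piP : commutant (range pi) P.

Fact subrep_ran g (x : ran P) : pi g (ran_val x) \in ran_pred P.
Proof.
rewrite ran_predE; apply/eqP.
have /(congr1 (@^~ (ran_val x))) /= -> := piP.2 (pi g) (imageT pi g).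
by rewrite proj_ran.
Qed.

Definition subrep_fun g (x : ran P) : ran P := Ran (subrep_ran g x).

Fact subrep_linear g : linear (subrep_fun g).
Proof. by move=> a x y; apply: ran_val_inj; rewrite /= rep_linear. Qed.

Fact subrep_isometry g x y :
  '[subrep_fun g x, subrep_fun g y] = '[x, y].
Proof. exact: (rep_isometry pi g (ran_val x) (ran_val y)). Qed.

Fact subrep1 : subrep_fun 1%g = id.
Proof. by apply/funext => x; apply: ran_val_inj; rewrite /= rep1. Qed.

Fact subrepM g h : subrep_fun (g * h)%g = subrep_fun g \o subrep_fun h.
Proof. by apply/funext => x; apply: ran_val_inj; rewrite /= repM. Qed.

Definition subrep : unirep G (ran P) :=
  Unirep subrep_linear subrep_isometry subrep1 subrepM.

End subrep.

(** [corner P M] : the algebra P M P, acting on the range of P. *)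
Definition corner (R : realType) (H : hilbertType R) (P : projection H)
    (M : set (H -> H)) : set (ran P -> ran P) :=
  [set S | exists2 T, M T &
     forall x : ran P, ran_val (S x) = P (T (P (ran_val x)))].
Arguments corner {R H} P M.

Section left_regular.
Variables (R : realType) (G : groupType).
Implicit Types (f : l2 R G) (g h x : G).

Fact chi_l2 h : (fun x => (x == h)%:R) \in @l2_pred R G.
Proof.
apply/asboolP; apply: (@le_lt_trans _ _ 1%:E); last exact: ltry.
apply/sqsum_leP => s us.
rewrite (eq_bigr (fun x => if x == h then 1 else 0)); last first.
  by move=> x _; case: (x == h); rewrite ?Normc.normc1 ?Normc.normc0 ?expr1n ?expr0n.
rewrite -big_mkcond big_const_seq iter_addr addr0 lern1.
by rewrite (count_uniq_mem h us) leq_b1.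
Qed.

Definition chi h : l2 R G := L2 (chi_l2 h).

Lemma mulg_bij g : set_bij [set: G] [set: G] (fun x => g^-1 * x)%g.
Proof.
split=> [//|x y _ _|x _]; first exact: mulgI.
by exists (g * x)%g => //; rewrite mulKg.
Qed.

Fact lreg_l2 g f : (fun x => f (g^-1 * x)%g) \in @l2_pred R G.
Proof.
by apply/asboolP; rewrite (sqsum_reindex _ (mulg_bij g)); exact: l2_sqsum.
Qed.

Definition lreg_fun g f : l2 R G := L2 (lreg_l2 g f).

Lemma lreg_chi g h : lreg_fun g (chi h) = chi (g * h)%g.
Proof.
apply: l2P => x /=; congr (_%:R); congr nat_of_bool.
by apply/eqP/eqP => [<-|->]; rewrite ?mulVKg ?mulKg.
Qed.

Fact lreg_linear g : linear (lreg_fun g).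
Proof. by move=> a f1 f2; apply: l2P => x; exact: erefl. Qed.

Fact lreg_isometry g f1 f2 : '[lreg_fun g f1, lreg_fun g f2] = '[f1, f2].
Proof.
exact: (csum_reindex (fun x => f1 x * Num.conj (f2 x)) (mulg_bij g)).
Qed.

Fact lreg1 : lreg_fun 1%g = id.
Proof. by apply/funext => f; apply: l2P => x /=; rewrite invg1 mul1g. Qed.

Fact lregM g h : lreg_fun (g * h)%g = lreg_fun g \o lreg_fun h.
Proof. by apply/funext => f; apply: l2P => x /=; rewrite invgM mulgA. Qed.

Definition lreg : unirep G (l2 R G) :=
  Unirep lreg_linear lreg_isometry lreg1 lregM.

End left_regular.

Definition icc (G : groupType) : Prop :=
  forall g : G, g != 1%g -> infinite_set [set (g ^ h)%g | h in [set: G]].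

(* Main.v *)
(** Write [M = lambda(G)'], [K = P l2(G)] and [N = pi(G)']; compressing and
    extending operators shows that [N] is the corner [P M P].

    (i) => (ii). Given [Phi : M -> N], put [sigma g = Phi (rho g)], where [rho] is
    the right regular representation, and [xi = P chi_1]. A *-isomorphism
    preserves the order (a self-adjoint [X] is positive iff [X + t] is invertible
    for all [t > 0]), hence it is normal. Averaging over conjugates and ICC then
    show that the trace [<Phi(.) xi, xi>] is a multiple of the canonical trace of
    [M]. So the vectors [sigma g xi] are orthogonal of constant norm, and [xi] is
    at once the frame vector, the Bessel vector and the Riesz vector.

    (ii) => (i). If [(sigma g psi)_g] is a Riesz sequence, its synthesis operator
    [V : l2(G) -> K] intertwines [rho] and [sigma] and is bounded below. Each [T] in
    [M] extends to the unique operator [x] of [sigma(G)''] with [x y V = y V T] for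
    all [y] in [sigma(G)']: it is well defined and bounded because [V^* y'^* y V]
    commutes with [rho], hence with [T], and defined on a total set because the
    two-sided regular representation of an ICC group is irreducible. *)
Require Import Defs.
From mathcomp Require Import all_boot all_order ssralg ssrnum archimedean complex sesquilinear.
From mathcomp Require Import boolp classical_sets functions cardinality.
From mathcomp Require Import fsbigop reals constructive_ereal esum.
From mathcomp Require Import finmap.
From mathcomp Require Import ring lra.

Set Implicit Arguments.
Unset Strict Implicit.
Unset Printing Implicit Defensive.

Import Order.TTheory GRing.Theory Num.Theory.
Import Normc (normc).

Local Open Scope classical_set_scope.
Local Open Scope ring_scope.

Local Notation Re := (@complex.Re _).

(** * Hilbert space geometry *)

(** In (i) => (ii) the isomorphism is purely algebraic, so every analytic fact about [Phi] is drawn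
    from the order alone, without functional calculus. Normality is used in the contradictory form
    [iso_normal]: positive contractions [B n] of trace at most [2^-n] cannot have images bounded
    away from [0] at [xi]. The partial sums of the [B n] need not be uniformly bounded, so a sum [S]
    is replaced by the contraction [1 - (1 + S)^-1], which is monotone in [S]. Beyond orthogonality,
    the trace identity gives [V (Y chi1) = Phi Y xi] for the synthesis operator [V] of the orbit of
    [xi]; this carries the commutation theorem of [l2(G)] over to [K] and yields
    [pi(G)' = sigma(G)''].

    In (ii) => (i) the obstacle is the norm estimate on finite sums of terms [y (V f)], which have
    many expressions. All that is available is that [T] may be moved across an inner product of two
    such sums; the bound is therefore extracted from the growth of the iterates of [T^* T], not from
    a square root of [t^2 - T^* T]. *)

Section inner_product.
Variables (R : realType) (H : hilbertType R).
Implicit Types (x y z u v : H) (a b : R[i]) (r s : R).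

(** Inequalities are handled over the ordered field [R], where [lra] and [nra] apply; [hdotE]
    recovers the complex form from its real part. *)
Definition rdot x y : R := Re '[x, y].

Lemma hdotC x y : '[x, y] = Num.conj '[y, x].
Proof. by rewrite hermC /= mul1r. Qed.

Lemma hdotDl x y z : '[x + y, z] = '[x, z] + '[y, z].
Proof. exact: linearDl. Qed.
Lemma hdotZl a x z : '[a *: x, z] = a * '[x, z].
Proof. exact: linearZl_LR. Qed.
Lemma hdotDr x y z : '[z, x + y] = '[z, x] + '[z, y].
Proof. exact: linearDr. Qed.
Lemma hdotZr a x z : '[z, a *: x] = Num.conj a * '[z, x].
Proof. exact: linearZr_LR. Qed.
Lemma hdotNl x z : '[- x, z] = - '[x, z].
Proof. exact: linearNl. Qed.
Lemma hdotNr x z : '[z, - x] = - '[z, x].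
Proof. exact: linearNr. Qed.
Lemma hdot0l z : '[0, z] = 0 :> R[i].
Proof. exact: linear0l. Qed.
Lemma hdot0r z : '[z, 0] = 0 :> R[i].
Proof. exact: linear0r. Qed.
Lemma hdotBl x y z : '[x - y, z] = '[x, z] - '[y, z].
Proof. exact: linearBl. Qed.
Lemma hdotBr x y z : '[z, x - y] = '[z, x] - '[z, y].
Proof. exact: linearBr. Qed.

Lemma ReD a b : Re (a + b) = Re a + Re b.
Proof. by case: a b => ? ? []. Qed.
Lemma ReN a : Re (- a) = - Re a.
Proof. by case: a. Qed.
Lemma ReZ r a : Re (r%:C%C * a) = r * Re a.
Proof. by case: a => ? ? /=; rewrite mul0r subr0. Qed.

Lemma rdotC x y : rdot x y = rdot y x.
Proof. by rewrite /rdot hdotC; case: '[y, x]. Qed.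
Lemma rdotDl x y z : rdot (x + y) z = rdot x z + rdot y z.
Proof. by rewrite /rdot hdotDl ReD. Qed.
Lemma rdotDr x y z : rdot z (x + y) = rdot z x + rdot z y.
Proof. by rewrite /rdot hdotDr ReD. Qed.
Lemma rdotNl x z : rdot (- x) z = - rdot x z.
Proof. by rewrite /rdot hdotNl ReN. Qed.
Lemma rdotNr x z : rdot z (- x) = - rdot z x.
Proof. by rewrite /rdot hdotNr ReN. Qed.
Lemma rdotBl x y z : rdot (x - y) z = rdot x z - rdot y z.
Proof. by rewrite rdotDl rdotNl. Qed.
Lemma rdotBr x y z : rdot z (x - y) = rdot z x - rdot z y.
Proof. by rewrite rdotDr rdotNr. Qed.
Lemma rdotZl r x z : rdot (r%:C%C *: x) z = r * rdot x z.
Proof. by rewrite /rdot hdotZl ReZ. Qed.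
Lemma rdotZr r x z : rdot z (r%:C%C *: x) = r * rdot z x.
Proof. by rewrite rdotC rdotZl rdotC. Qed.
Lemma rdot0l z : rdot 0 z = 0.
Proof. by rewrite /rdot hdot0l. Qed.
Lemma rdot0r z : rdot z 0 = 0.
Proof. by rewrite /rdot hdot0r. Qed.

Lemma hdotE x y : '[x, y] = Complex (rdot x y) (rdot x ('i%C *: y)).
Proof.
rewrite /rdot hdotZr; case: '[x, y] => c d.
by apply/eqP; rewrite eq_complex /=; apply/andP; split; apply/eqP; ring.
Qed.

Lemma hdotxx x : '[x, x] = (rdot x x)%:C%C.
Proof.
have := dnorm_ge0 (@hdot R H) x; rewrite /rdot lecE; case: '[x, x] => c d /=.
by move=> /andP[/eqP -> _].
Qed.

Lemma rdotxx_ge0 x : 0 <= rdot x x.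
Proof. by have := dnorm_ge0 (@hdot R H) x; rewrite hdotxx ler0c. Qed.

Lemma rdotxx_eq0 x : rdot x x = 0 -> x = 0.
Proof.
move=> x0; apply/eqP; rewrite -(dnorm_eq0 (@hdot R H)) hdotxx x0.
exact/eqP.
Qed.

Lemma sqr_hnorm x : hnorm x ^+ 2 = rdot x x.
Proof. by rewrite /hnorm /dotnorm sqr_sqrtr // rdotxx_ge0. Qed.

Lemma hnorm_ge0 x : 0 <= hnorm x.
Proof. exact: sqrtr_ge0. Qed.

Lemma hnorm0 : hnorm (0 : H) = 0.
Proof. by rewrite /hnorm /dotnorm hdot0l sqrtr0. Qed.

Lemma hnorm_eq0 x : hnorm x = 0 -> x = 0.
Proof. by move=> x0; apply: rdotxx_eq0; rewrite -sqr_hnorm x0 expr0n. Qed.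

Lemma hnorm_le0 x : hnorm x <= 0 -> x = 0.
Proof. by move=> x0; apply/hnorm_eq0/eqP; rewrite eq_le x0 hnorm_ge0. Qed.

Lemma hnorm_le x r : 0 <= r -> rdot x x <= r ^+ 2 -> hnorm x <= r.
Proof. by move=> r0; rewrite -sqr_hnorm ler_sqr ?nnegrE ?hnorm_ge0. Qed.

Lemma hnorm_lt x r : 0 < r -> rdot x x < r ^+ 2 -> hnorm x < r.
Proof. by move=> r0; rewrite -sqr_hnorm ltr_sqr ?nnegrE ?hnorm_ge0 ?ltW. Qed.

Lemma hnormN x : hnorm (- x) = hnorm x.
Proof. by rewrite /hnorm /dotnorm hdotNl hdotNr opprK. Qed.

Lemma hnormBC x y : hnorm (x - y) = hnorm (y - x).
Proof. by rewrite -hnormN opprB. Qed.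

Lemma rdot_le x y : rdot x y <= hnorm x * hnorm y.
Proof.
have [->|y0] := eqVneq y 0; first by rewrite rdot0r hnorm0 mulr0.
have ny : 0 < rdot y y.
  by rewrite lt_def rdotxx_ge0 andbT; apply: contra y0 => /eqP/rdotxx_eq0/eqP.
have [xy0|xy0] := leP (rdot x y) 0.
  by apply: le_trans xy0 _; rewrite mulr_ge0 ?hnorm_ge0.
rewrite -(ger0_norm (ltW xy0)) -[_ * _]ger0_norm ?mulr_ge0 ?hnorm_ge0 //.
rewrite -ler_sqr ?nnegrE ?normr_ge0 // !real_normK ?num_real // exprMn !sqr_hnorm.
have := rdotxx_ge0 (x - (rdot x y / rdot y y)%:C%C *: y).
rewrite !(rdotBl, rdotBr, rdotZl, rdotZr) (rdotC y x) => h.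
have := mulr_ge0 h (ltW ny); rewrite -subr_ge0.
by congr (0 <= _); field; rewrite gt_eqF.
Qed.

Lemma normr_rdot_le x y : `|rdot x y| <= hnorm x * hnorm y.
Proof.
by rewrite ler_norml rdot_le lerNl -rdotNl -[hnorm x]hnormN rdot_le.
Qed.

Lemma hnormD_sq x y :
  rdot (x + y) (x + y) = rdot x x + 2 * rdot x y + rdot y y.
Proof. by rewrite !(rdotDl, rdotDr) (rdotC y x); ring. Qed.

Lemma hnormB_sq x y :
  rdot (x - y) (x - y) = rdot x x - 2 * rdot x y + rdot y y.
Proof. by rewrite !(rdotBl, rdotBr) (rdotC y x); ring. Qed.

Lemma ler_hnormD x y : hnorm (x + y) <= hnorm x + hnorm y.
Proof.
apply: hnorm_le; first by rewrite addr_ge0 ?hnorm_ge0.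
rewrite hnormD_sq -!sqr_hnorm; have := rdot_le x y.
nra.
Qed.

Lemma ler_hnormB x y : hnorm (x - y) <= hnorm x + hnorm y.
Proof. by rewrite -(hnormN y) ler_hnormD. Qed.

Lemma ler_hdist z x y : hnorm (x - y) <= hnorm (x - z) + hnorm (y - z).
Proof. by rewrite (hnormBC y) -[x - y](subrKA z) ler_hnormD. Qed.

Lemma hnormZ a x : hnorm (a *: x) = normc a * hnorm x.
Proof.
have n0 : 0 <= normc a by case: (a) => ? ?; exact: sqrtr_ge0.
apply/eqP; rewrite -(eqrXn2 (ltn0Sn 1)) ?mulr_ge0 ?hnorm_ge0 //.
rewrite exprMn !sqr_hnorm Defs.sqr_normc /rdot hdotZl hdotZr hdotxx.
by case: a {n0} => c d /=; apply/eqP; ring.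
Qed.

Lemma hnormZr r x : 0 <= r -> hnorm (r%:C%C *: x) = r * hnorm x.
Proof. by move=> r0; rewrite hnormZ /= expr0n addr0 sqrtr_sqr ger0_norm. Qed.

Lemma rdot_inj x y : (forall z, rdot x z = rdot y z) -> x = y.
Proof.
move=> xy; apply/eqP; rewrite -subr_eq0; apply/eqP/rdotxx_eq0.
by rewrite rdotBl xy subrr.
Qed.

Lemma hdot_inj x y : (forall z, '[x, z] = '[y, z]) -> x = y.
Proof. by move=> xy; apply: rdot_inj => z; rewrite /rdot xy. Qed.

(** Rotating [x] by a unimodular scalar makes the inner product real and nonnegative, which reduces
    the claim to [rdot_le]. *)
Lemma normc_hdot_le x y : normc '[x, y] <= hnorm x * hnorm y.
Proof.
have [c c1 <-] : exists2 c : R[i], normc c = 1 & rdot (c *: x) y = normc '[x, y].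
  have [z0|z0] := eqVneq '[x, y] 0.
    by exists 1; rewrite ?Normc.normc1 // /rdot hdotZl z0 mulr0 Normc.normc0.
  have n0 : normc '[x, y] != 0 by apply: contra z0 => /eqP/Normc.eq0_normc/eqP.
  have ncj (z : R[i]) : normc (Num.conj z) = normc z by case: z => ? ? /=; rewrite sqrrN.
  exists (Num.conj '[x, y] / (normc '[x, y])%:C%C).
    rewrite Normc.normcM Normc.normcV ncj [normc _%:C%C]/= expr0n addr0 sqrtr_sqr.
    rewrite ger0_norm ?divff //; case: '[x, y] => ? ?; exact: sqrtr_ge0.
  rewrite /rdot hdotZl mulrAC mulrC -fmorphV ReZ.
  have -> : Re (Num.conj '[x, y] * '[x, y]) = normc '[x, y] ^+ 2.
    by rewrite Defs.sqr_normc; case: '[x, y] => ? ? /=; ring.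
  by rewrite expr2 mulKf.
by apply: le_trans (rdot_le _ _) _; rewrite hnormZ c1 mul1r.
Qed.

Lemma parallelogram x y :
  rdot (x - y) (x - y) = 2 * rdot x x + 2 * rdot y y - rdot (x + y) (x + y).
Proof. by rewrite hnormB_sq hnormD_sq; ring. Qed.

End inner_product.

Lemma hdot_rdot (R : realType) (H K : hilbertType R) (x y : H) (u v : K) :
  rdot x y = rdot u v -> rdot x ('i%C *: y) = rdot u ('i%C *: v) ->
  '[x, y] = '[u, v].
Proof. by rewrite !hdotE => -> ->. Qed.

(** * Norm limits, nearest points and orthogonal projection *)

Section convergence.
Variables (R : realType) (H : hilbertType R).
Implicit Types (u v : nat -> H) (x y : H).

Definition hcvg u x : Prop := forall e : R, 0 < e ->
  exists N : nat, forall n, (N <= n)%N -> hnorm (u n - x) < e.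

Lemma hcvg_unique u x y : hcvg u x -> hcvg u y -> x = y.
Proof.
move=> ux uy; apply/eqP; rewrite -subr_eq0; apply/eqP/hnorm_le0.
rewrite leNgt; apply/negP => xy0.
have [N uN] := ux _ (divr_gt0 xy0 (ltr0Sn _ 1)).
have [M uM] := uy _ (divr_gt0 xy0 (ltr0Sn _ 1)).
have := ler_hdist (u (maxn N M)) x y.
rewrite ![hnorm (_ - u _)]hnormBC.
have := uN _ (leq_maxl N M); have := uM _ (leq_maxr N M); lra.
Qed.

Lemma hcvg_cst x : hcvg (fun=> x) x.
Proof. by move=> e e0; exists 0%N => n _; rewrite subrr hnorm0. Qed.

Lemma hcvg_lin (a : R[i]) u v x y : hcvg u x -> hcvg v y ->
  hcvg (fun n => a *: u n + v n) (a *: x + y).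
Proof.
move=> ux vy e e0.
have n0 : 0 <= normc a by case: (a) => ? ?; exact: sqrtr_ge0.
have e1 : 0 < e / 2 by rewrite divr_gt0.
have e2 : 0 < e / 2 / (normc a + 1) by rewrite divr_gt0 // ltr_wpDl.
have [N uN] := ux _ e2; have [M vM] := vy _ e1.
exists (maxn N M) => n; rewrite geq_max => /andP[/uN un /vM vn].
rewrite opprD addrACA -scalerBr; apply: le_lt_trans (ler_hnormD _ _) _.
rewrite hnormZ; rewrite ltr_pdivlMr ?ltr_wpDl // in un.
have := hnorm_ge0 (u n - x); nra.
Qed.

Lemma hcvg_ext u v x : u =1 v -> hcvg u x -> hcvg v x.
Proof. by move=> /funext ->. Qed.

Lemma hcvg_dist_le u x y (r : R) : hcvg u x ->
  (exists N : nat, forall n, (N <= n)%N -> hnorm (u n - y) <= r) -> hnorm (x - y) <= r.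
Proof.
move=> ux [M uM]; apply/ler_addgt0Pl => e /ux[N uN].
have := uN _ (leq_maxl N M); have := uM _ (leq_maxr N M).
by have := ler_hdist (u (maxn N M)) x y; rewrite ![hnorm (_ - u _)]hnormBC; lra.
Qed.

Lemma hcvg_norm_le u x (r : R) : hcvg u x -> (forall n, hnorm (u n) <= r) ->
  hnorm x <= r.
Proof.
move=> ux ur; rewrite -(subr0 x); apply: (hcvg_dist_le ux).
by exists 0%N => n _; rewrite subr0.
Qed.

Lemma hcvg_rdot_le u x y (r : R) : hcvg u x -> (forall n, rdot (u n) y <= r) ->
  rdot x y <= r.
Proof.
move=> ux ur; apply/ler_addgt0Pl => e e0.
have y1 : 0 < hnorm y + 1 by rewrite ltr_wpDl ?hnorm_ge0.
have [N /(_ _ (leqnn N))] := ux _ (divr_gt0 e0 y1).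
rewrite ltr_pdivlMr // hnormBC => xN.
have := rdot_le (x - u N) y; rewrite rdotBl; have := ur N.
have := hnorm_ge0 (x - u N); nra.
Qed.

Lemma hcvg_rdot_ge u x y (r : R) : hcvg u x -> (forall n, r <= rdot (u n) y) ->
  r <= rdot x y.
Proof.
move=> ux ur; rewrite -lerN2 -rdotNr.
by apply: (hcvg_rdot_le ux) => n; rewrite rdotNr lerN2.
Qed.

Lemma hcvg_rdot u v x y z w : hcvg u x -> hcvg v y ->
  (forall n, rdot (u n) z = rdot (v n) w) -> rdot x z = rdot y w.
Proof.
move=> ux vy uv; apply/eqP; rewrite -subr_eq0 -normr_le0.
apply/ler_addgt0Pl => e e0; rewrite addr0.
have z1 : 0 < hnorm z + 1 by rewrite ltr_wpDl ?hnorm_ge0.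
have w1 : 0 < hnorm w + 1 by rewrite ltr_wpDl ?hnorm_ge0.
have e2 : 0 < e / 2 by rewrite divr_gt0.
have [N uN] := ux _ (divr_gt0 e2 z1); have [M vM] := vy _ (divr_gt0 e2 w1).
have := uN _ (leq_maxl N M); have := vM _ (leq_maxr N M).
rewrite !ltr_pdivlMr //; set n := maxn N M => h1 h2.
have -> : rdot x z - rdot y w = rdot (v n - y) w - rdot (u n - x) z.
  by rewrite !rdotBl uv; ring.
apply: le_trans (ler_normB _ _) _.
have := normr_rdot_le (v n - y) w; have := normr_rdot_le (u n - x) z.
have := hnorm_ge0 (u n - x); have := hnorm_ge0 (v n - y); lra.
Qed.

Lemma hcvg_cauchy u : (forall e : R, 0 < e -> exists N : nat, forall m n,
    (N <= m)%N -> (N <= n)%N -> hnorm (u m - u n) < e) ->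
  exists x, hcvg u x.
Proof. by move=> /hdot_complete. Qed.

Lemma small_inv (e : R) : 0 < e -> exists N : nat, forall n, (N <= n)%N -> n.+1%:R^-1 < e.
Proof.
move=> e0; have [N Ne] := ltr_add_invr (y := 0) (x := e) e0; rewrite add0r in Ne.
exists N => n Nn; apply: le_lt_trans Ne.
by rewrite lef_pV2 ?posrE ?ltr0Sn // ler_nat.
Qed.

Lemma hcvg_inv u x : (forall n, hnorm (u n - x) <= n.+1%:R^-1) -> hcvg u x.
Proof. by move=> ux e /small_inv[N Ne]; exists N => n /Ne; apply: le_lt_trans. Qed.

Definition hcl (C : set H) : set H :=
  [set x | forall e : R, 0 < e -> exists2 z, C z & hnorm (z - x) < e].

Lemma hcl_seq (C : set H) x : hcl C x ->
  exists2 u : nat -> H, (forall n, C (u n)) & hcvg u x.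
Proof.
move=> Cx; have /choice[u uP] : forall n : nat, exists z, C z /\ hnorm (z - x) < n.+1%:R^-1.
  by move=> n; have [|z] := Cx n.+1%:R^-1; [rewrite invr_gt0 ltr0Sn|exists z].
exists u => [n|]; first by have [] := uP n.
by apply: hcvg_inv => n; apply/ltW; have [] := uP n.
Qed.

Lemma hcvg_hcl (C : set H) u x : (forall n, C (u n)) -> hcvg u x -> hcl C x.
Proof. by move=> Cu ux e /ux[N /(_ _ (leqnn N)) uN]; exists (u N). Qed.

Lemma hcl_hnorm_ge (C : set H) x y : (forall z, C z -> hnorm x <= hnorm z) ->
  hcl C y -> hnorm x <= hnorm y.
Proof.
move=> xC yC; apply/ler_addgt0Pl => e /yC[z Cz zy].
have := xC _ Cz; have := ler_hnormD (z - y) y; rewrite subrK; lra.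
Qed.

Section convex.
Variable C : set H.
Hypothesis C_mid : forall x y, C x -> C y -> C ((2^-1)%:C%C *: (x + y)).

(** By the parallelogram law a minimising sequence is Cauchy. Only midpoints enter, and [C] is not
    closed, so the minimiser is found in its closure. *)
Lemma convex_min : C !=set0 ->
  exists2 x, hcl C x & forall z, C z -> hnorm x <= hnorm z.
Proof.
move=> [c0 Cc0].
pose E := [set rdot z z | z in C]; pose d := inf E.
have iE : has_inf E.
  split; first by exists (rdot c0 c0), c0.
  by exists 0 => _ [z _ <-]; exact: rdotxx_ge0.
have dle z : C z -> d <= rdot z z by move=> Cz; apply: (ge_inf iE.2); exists z.
have close y z (e : R) : C y -> C z -> rdot y y < d + e -> rdot z z < d + e ->
    rdot (y - z) (y - z) < 4 * e.
  move=> Cy Cz ye ze; rewrite parallelogram.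
  have := dle _ (C_mid Cy Cz); rewrite rdotZl rdotZr; lra.
have /choice[u uP] : forall n : nat, exists z, C z /\ rdot z z < d + n.+1%:R^-1.
  move=> n; have [|_ [z Cz <-] zd] := @inf_adherent _ E n.+1%:R^-1 _ iE.
    by rewrite invr_gt0 ltr0Sn.
  by exists z.
have uC n : C (u n) by have [] := uP n.
have umin e : 0 < e -> exists N : nat, forall n, (N <= n)%N -> rdot (u n) (u n) < d + e.
  move=> /small_inv[N Ne]; exists N => n /Ne ne.
  by have [_ un] := uP n; apply: lt_trans un _; rewrite ltrD2l.
have [x ux] : exists x, hcvg u x.
  apply: hcvg_cauchy => e e0.
  have e4 : 0 < e ^+ 2 / 4 by rewrite divr_gt0 // exprn_gt0.
  have [N uN] := umin _ e4; exists N => m n Nm Nn; apply: hnorm_lt => //.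
  have := close _ _ _ (uC m) (uC n) (uN _ Nm) (uN _ Nn); lra.
exists x; first exact: hcvg_hcl ux.
move=> z Cz; apply/ler_addgt0Pl => e e0.
have e2 : 0 < e / 2 by rewrite divr_gt0.
have [N uN] := umin _ (exprn_gt0 2 e2); have [M uM] := ux _ e2.
have := uN _ (leq_maxl N M); have := uM _ (leq_maxr N M); set y := u _ => h1 h2.
have h3 : hnorm y <= hnorm z + e / 2.
  apply: hnorm_le; first by rewrite addr_ge0 ?hnorm_ge0 ?ltW.
  have := dle _ Cz; rewrite -(sqr_hnorm z) => h3.
  have := mulr_ge0 (hnorm_ge0 z) (ltW e2); rewrite sqrrD; lra.
have := ler_hnormB y (y - x); rewrite subKr; lra.
Qed.

(** The midpoint of two minimisers is no shorter than either, so the parallelogram law leaves no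
    room for their difference. *)
Lemma convex_min_unique x y : hcl C x -> hcl C y ->
  (forall z, C z -> hnorm x <= hnorm z) -> (forall z, C z -> hnorm y <= hnorm z) ->
  x = y.
Proof.
move=> Cx Cy xC yC.
have xy : hnorm x = hnorm y by apply/eqP; rewrite eq_le !(@hcl_hnorm_ge C).
pose h : R[i] := (2^-1)%:C%C.
have Cm : hcl C (h *: (x + y)).
  move=> e e0; have [z Cz zx] := Cx _ e0; have [w Cw wy] := Cy _ e0.
  exists (h *: (z + w)); first exact: C_mid.
  rewrite -scalerBr hnormZr ?invr_ge0 // opprD addrACA.
  have := ler_hnormD (z - x) (w - y); lra.
have := hcl_hnorm_ge xC Cm; rewrite hnormZr ?invr_ge0 // => xm.
apply/eqP; rewrite -subr_eq0; apply/eqP/rdotxx_eq0/eqP.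
rewrite eq_le rdotxx_ge0 parallelogram -!sqr_hnorm -xy andbT.
have := hnorm_ge0 x; nra.
Qed.

End convex.

Section projection_theorem.
Variable C : set H.
Hypothesis C_lin : forall a x y, C x -> C y -> C (a *: x + y).

Lemma hcl_lin (a : R[i]) x y : hcl C x -> hcl C y -> hcl C (a *: x + y).
Proof.
move=> /hcl_seq[u uC ux] /hcl_seq[v vC vy].
by apply: hcvg_hcl (hcvg_lin a ux vy) => n; exact: C_lin.
Qed.

(** The shortest vector [w] of the closure of [x - C] cannot be shortened by subtracting a multiple
    of [z]; the multiple [<w, z> / <z, z>] then forces [<w, z> = 0]. *)
Lemma hcl_proj x : C 0 -> exists2 p, hcl C p & forall z, C z -> '[x - p, z] = 0.
Proof.
move=> C0; pose D := [set x - z | z in C].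
have D_mid y z : D y -> D z -> D ((2^-1)%:C%C *: (y + z)).
  move=> [c Cc <-] [d Cd <-]; exists ((2^-1)%:C%C *: (c + d)).
    rewrite scalerDr; apply: C_lin => //; rewrite -[_ *: d]addr0; exact: C_lin.
  rewrite addrACA -opprD scalerBr; congr (_ - _).
  rewrite scalerDr -scalerDl -[LHS]scale1r; congr (_ *: _).
  by apply/eqP; rewrite eq_complex /=; apply/andP; split; apply/eqP; field.
have [|w Dw wmin] := convex_min D_mid; first by exists (x - 0), 0.
have ort r z : C z -> hnorm w <= hnorm (w - r *: z).
  move=> Cz; apply: hcl_hnorm_ge wmin _ => e /Dw[_ [c Cc <-]] cw.
  exists (x - (r *: z + c)); first by exists (r *: z + c) => //; exact: C_lin.
  rewrite (_ : _ - _ = x - c - w) //.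
  by rewrite opprB opprD !addrA (addrAC x) addrNK.
have ort0 z : C z -> rdot w z = 0.
  move=> Cz; have [->|z0] := eqVneq z 0; first by rewrite rdot0r.
  have zz : 0 < rdot z z.
    by rewrite lt_def rdotxx_ge0 andbT; apply: contra z0 => /eqP/rdotxx_eq0/eqP.
  have := ort (rdot w z / rdot z z)%:C%C _ Cz.
  rewrite -ler_sqr ?nnegrE ?hnorm_ge0 // !sqr_hnorm hnormB_sq !(rdotZl, rdotZr).
  have -> : rdot w w - 2 * (rdot w z / rdot z z * rdot w z) + rdot w z / rdot z z *
     (rdot w z / rdot z z * rdot z z) = rdot w w - rdot w z ^+ 2 / rdot z z.
    by field; rewrite gt_eqF.
  rewrite lerDl oppr_ge0 pmulr_lle0 ?invr_gt0 // => h.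
  by apply/eqP; rewrite -sqrf_eq0 eq_le h sqr_ge0.
exists (x - w).
  by move=> e /Dw[_ [c Cc <-]] cw; exists c => //; rewrite hnormBC addrAC.
move=> z Cz; rewrite subKr hdotE !ort0 //.
by rewrite -[_ *: _]addr0; exact: C_lin.
Qed.

Lemma hcl_dense : C 0 -> (forall x, (forall z, C z -> '[x, z] = 0) -> x = 0) ->
  forall x, hcl C x.
Proof.
move=> C0 Cort x; have [p Cp px] := hcl_proj x C0.
by have /eqP := Cort _ px; rewrite subr_eq0 => /eqP ->.
Qed.

End projection_theorem.

End convergence.

(** * Bounded maps and adjoints *)

Section linear.
Variables (R : realType) (H K : hilbertType R) (T : H -> K).
Hypothesis T_lin : linear T.

Lemma lin0 : T 0 = 0.
Proof. by have := T_lin (-1) 0 0; rewrite !scaleN1r oppr0 addr0 addNr. Qed.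
Lemma linD x y : T (x + y) = T x + T y.
Proof. by have := T_lin 1 x y; rewrite !scale1r. Qed.
Lemma linZ a x : T (a *: x) = a *: T x.
Proof. by have := T_lin a x 0; rewrite lin0 !addr0. Qed.
Lemma linN x : T (- x) = - T x.
Proof. by rewrite -[- x]scaleN1r linZ scaleN1r. Qed.
Lemma linB x y : T (x - y) = T x - T y.
Proof. by rewrite linD linN. Qed.
Lemma lin_sum (I : Type) (s : seq I) (F : I -> H) :
  T (\sum_(i <- s) F i) = \sum_(i <- s) T (F i).
Proof. by elim/big_rec2: _ => [|i y z _ <-]; rewrite ?lin0 ?linD. Qed.
End linear.

Section linear_maps.
Variables (R : realType) (H K : hilbertType R).
Implicit Types (T : H -> K) (S : K -> H).

Definition bounded_map T : Prop :=
  linear T /\ exists M : R, forall x, hnorm (T x) <= M * hnorm x.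

Definition adjoint_pair T S : Prop := forall x y, '[T x, y] = '[x, S y].

Lemma bounded_mapP T : bounded_map T ->
  exists2 M : R, 0 < M & forall x, hnorm (T x) <= M * hnorm x.
Proof.
move=> [_ [M TM]]; exists (`|M| + 1); first by rewrite ltr_wpDl.
move=> x; apply: le_trans (TM x) _; rewrite ler_wpM2r ?hnorm_ge0 //.
by rewrite (le_trans (ler_norm M)) // lerDl.
Qed.

Lemma bounded_map_cvg T u x : bounded_map T -> hcvg u x -> hcvg (T \o u) (T x).
Proof.
move=> bT ux e e0; have [M M0 TM] := bounded_mapP bT.
have [N uN] := ux _ (divr_gt0 e0 M0); exists N => n /uN.
rewrite ltr_pdivlMr // /= -linB; last exact: bT.1.
by rewrite mulrC; apply: le_lt_trans.
Qed.

Lemma adjoint_pair_rdot T S : linear S ->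
  (forall x y, rdot (T x) y = rdot x (S y)) -> adjoint_pair T S.
Proof. by move=> lS TS x y; apply: hdot_rdot; rewrite TS ?(linZ lS). Qed.

Lemma rdot_adjoint T S : adjoint_pair T S -> forall x y, rdot (T x) y = rdot x (S y).
Proof. by rewrite /rdot => TS x y; rewrite TS. Qed.

Lemma hnorm_bound (M : R) (x : H) (y : K) : 0 <= M -> rdot x x <= M * (hnorm x * hnorm y) ->
  hnorm x <= M * hnorm y.
Proof.
move=> M0; have [->|x0] := eqVneq x 0.
  rewrite rdot0l hnorm0 mul0r mulr0 => _.
  by rewrite mulr_ge0 ?hnorm_ge0.
have nx : 0 < hnorm x by rewrite lt_def hnorm_ge0 andbT; apply: contra x0 => /eqP/hnorm_eq0/eqP.
by rewrite -sqr_hnorm mulrCA expr2 ler_pM2l.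
Qed.

End linear_maps.

Lemma bounded_map_comp (R : realType) (H K L : hilbertType R) (S : K -> L) (T : H -> K) :
  bounded_map S -> bounded_map T -> bounded_map (S \o T).
Proof.
move=> bS bT; split; first by move=> a x y /=; rewrite bT.1 bS.1.
have [c c0 Sc] := bounded_mapP bS; have [d _ Td] := bounded_mapP bT.
exists (c * d) => x; apply: le_trans (Sc _) _; by rewrite -mulrA ler_pM2l.
Qed.

Section riesz.
Variables (R : realType) (H : hilbertType R).

Lemma riesz_representation (l : H -> R[i]) :
  (forall a x y, l (a *: x + y) = a * l x + l y) ->
  (exists M : R, forall x, normc (l x) <= M * hnorm x) ->
  exists z, forall x, l x = '[x, z].
Proof.
move=> l_lin [M lM].
have l0 : l 0 = 0.
  by have := l_lin (-1) 0 0; rewrite scaler0 addr0 mulN1r addNr.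
have lZ a x : l (a *: x) = a * l x by rewrite -[_ *: _]addr0 l_lin l0 addr0.
have [lz|/existsNP[v /eqP lv]] := pselect (forall x, l x = 0).
  by exists 0 => x; rewrite lz hdot0r.
pose C := [set x | l x = 0].
have C_lin a x y : C x -> C y -> C (a *: x + y).
  by rewrite /C /= l_lin => -> ->; rewrite mulr0 addr0.
have [p Cp vp] := hcl_proj C_lin v l0.
(* The projection lies only in the closure of the kernel; boundedness of [l] puts it in the
   kernel. *)
have lp : l p = 0.
  apply/Normc.eq0_normc/eqP; rewrite eq_le; apply/andP; split; last first.
    by case: (l p) => ? ?; exact: sqrtr_ge0.
  apply/ler_addgt0Pl => e e0; rewrite addr0.
  have M1 : 0 < `|M| + 1 by rewrite ltr_wpDl.
  have [z Cz zp] := Cp _ (divr_gt0 e0 M1).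
  have -> : l p = l (-1 *: z + p) by rewrite l_lin Cz mulr0 add0r.
  apply: le_trans (lM _) _; rewrite scaleN1r addrC hnormBC.
  rewrite ltr_pdivlMr // in zp; have := ler_norm M; have := hnorm_ge0 (z - p); nra.
pose w := v - p.
have lw : l w = l v by rewrite /w addrC -scaleN1r l_lin lp mulr0 add0r.
have w0 : '[w, w] != 0 :> R[i].
  by apply/negP => /eqP; rewrite hdotxx => /complexI/rdotxx_eq0 ww; rewrite -lw ww l0 eqxx in lv.
exists (Num.conj (l v / '[w, w]) *: w) => x; rewrite hdotZr conjCK.
have : '[w, - (l x / l v) *: w + x] = 0.
  by apply: vp; rewrite /C /= l_lin lw mulNr mulfVK // addNr.
rewrite hdotC => /(congr1 Num.conj); rewrite conjCK rmorph0.
rewrite hdotDl hdotZl mulNr => /eqP; rewrite addrC subr_eq0 => /eqP ->.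
by field; rewrite lv w0.
Qed.

End riesz.

Section adjoint.
Variables (R : realType) (H K : hilbertType R).

Lemma adjoint_exists (T : H -> K) : bounded_map T ->
  exists2 S, bounded_map S & adjoint_pair T S.
Proof.
move=> bT; have [M M0 TM] := bounded_mapP bT; have lT := bT.1.
have /choice[S TS] : forall y, exists z, forall x, '[T x, y] = '[x, z].
  move=> y; apply: riesz_representation => [a x x'|].
    by rewrite lT hdotDl hdotZl.
  exists (M * hnorm y) => x; apply: le_trans (normc_hdot_le _ _) _.
  by rewrite mulrAC ler_wpM2r ?hnorm_ge0.
have aTS : adjoint_pair T S by move=> x y; rewrite TS.
exists S => //; split=> [a y y'|].
  apply: hdot_inj => x; rewrite hdotC [RHS]hdotC; congr Num.conj.
  by rewrite -TS hdotDr hdotZr !TS -hdotZr -hdotDr.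
exists M => y; apply: hnorm_bound (ltW M0) _.
rewrite -(rdot_adjoint aTS); apply: le_trans (rdot_le _ _) _.
by rewrite mulrA ler_wpM2r ?hnorm_ge0.
Qed.

Lemma adjoint_pair_sym (T : H -> K) S : adjoint_pair T S -> adjoint_pair S T.
Proof. by move=> TS x y; rewrite hdotC -TS -hdotC. Qed.

Lemma adjoint_unique (T : H -> K) S S' : adjoint_pair T S -> adjoint_pair T S' -> S = S'.
Proof.
move=> TS TS'; apply/funext => y; apply: hdot_inj => x.
by rewrite hdotC -TS TS' -hdotC.
Qed.

(** The difference of the two adjoints takes values orthogonal to [C]. *)
Lemma total_ext (C : set H) (S T : H -> K) :
  (forall v, (forall z, C z -> '[v, z] = 0) -> v = 0) ->
  bounded_map S -> bounded_map T -> (forall z, C z -> S z = T z) -> S = T.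
Proof.
move=> Ctot bS bT ST.
have [S' _ SS'] := adjoint_exists bS; have [T' _ TT'] := adjoint_exists bT.
apply/funext => x; apply: hdot_inj => y; rewrite SS' TT'; congr '[x, _].
apply/eqP; rewrite -subr_eq0; apply/eqP/Ctot => z Cz.
by rewrite hdotC hdotBr -SS' -TT' ST // subrr rmorph0.
Qed.

(** The operator is given as a relation because a vector may have several expressions as a finite
    sum. Linearity and the bound together make the closure of the relation single-valued. *)
Lemma graph_extension (Gr : H -> K -> Prop) (c : R) : 0 <= c ->
  (forall a x y x' y', Gr x y -> Gr x' y' -> Gr (a *: x + x') (a *: y + y')) ->
  (forall x y, Gr x y -> hnorm y <= c * hnorm x) ->
  (forall x, hcl [set z | exists y, Gr z y] x) ->
  exists2 T, bounded_map T & forall x y, Gr x y -> T x = y.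
Proof.
move=> c0 Gl Gb Gd.
pose lim x y := exists u v, [/\ forall n : nat, Gr (u n) (v n), hcvg u x & hcvg v y].
have lim_lin a x y x' y' : lim x y -> lim x' y' -> lim (a *: x + x') (a *: y + y').
  move=> [u [v [Guv ux vy]]] [u' [v' [Guv' ux' vy']]].
  exists (fun n => a *: u n + u' n), (fun n => a *: v n + v' n).
  by split; [move=> n; exact: Gl|exact: hcvg_lin|exact: hcvg_lin].
have lim_le x y : lim x y -> hnorm y <= c * hnorm x.
  move=> [u [v [Guv ux vy]]]; apply/ler_addgt0Pl => e e0.
  have e2 : 0 < e / 2 by rewrite divr_gt0.
  have c1 : 0 < c + 1 by rewrite ltr_wpDl.
  have [N uN] := ux _ (divr_gt0 e2 c1); have [M vM] := vy _ e2.
  have := uN _ (leq_maxl N M); have := vM _ (leq_maxr N M); set n := maxn N M.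
  rewrite !ltr_pdivlMr //; have := Gb _ _ (Guv n).
  have := ler_hnormB (v n) (v n - y); have := ler_wpM2l c0 (ler_hnormD (u n - x) x).
  rewrite subKr subrK mulrDr; have := hnorm_ge0 (u n - x); lra.
have /choice[T limT] : forall x, exists y, lim x y.
  move=> x; have [u Gu ux] := hcl_seq (Gd x).
  have [v Gv] := choice Gu.
  have [y vy] : exists y, hcvg v y.
    apply: hcvg_cauchy => e e0; have c1 : 0 < 2 * (c + 1) by rewrite mulr_gt0 // ltr_wpDl.
    have [N uN] := ux _ (divr_gt0 e0 c1); exists N => m n /uN um /uN un.
    have := Gb _ _ (Gl (-1) _ _ _ _ (Gv n) (Gv m)).
    rewrite !scaleN1r ![- _ + _]addrC.
    rewrite !ltr_pdivlMr // in um un; have := ler_wpM2l c0 (ler_hdist x (u m) (u n)).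
    rewrite mulrDr; have := hnorm_ge0 (u m - x); have := hnorm_ge0 (u n - x); lra.
  by exists y, u, v.
have lim_fun x y y' : lim x y -> lim x y' -> y = y'.
  move=> xy xy'; have := lim_le _ _ (lim_lin (-1) _ _ _ _ xy xy').
  rewrite !scaleN1r addNr hnorm0 mulr0 => /hnorm_le0/eqP.
  by rewrite addrC subr_eq0 => /eqP.
exists T => [|x y Gxy].
  split; last by exists c => x; exact: lim_le.
  by move=> a x y; apply: lim_fun (limT _) _; exact: lim_lin.
apply: lim_fun (limT _) _; exists (fun=> x), (fun=> y).
by split => //; exact: hcvg_cst.
Qed.

End adjoint.

(** * Positive operators: inverses and monotone limits *)

Section self_adjoint.
Variables (R : realType) (H : hilbertType R).
Implicit Types (X Y Z : H -> H).

Definition psd X := forall x, 0 <= rdot (X x) x.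

(** This is [X^2 <= m X], obtained without a square root from positivity at [x - m^-1 X x] and the
    upper bound at [X x]. *)
Lemma psd_norm_le X (m : R) : 0 < m -> linear X -> is_adjoint X X -> psd X ->
  (forall x, rdot (X x) x <= m * rdot x x) ->
  forall x, rdot (X x) (X x) <= m * rdot (X x) x.
Proof.
move=> m0 lX aX pX Xm x.
have := pX (x - (m^-1)%:C%C *: X x).
rewrite linB // linZ // !(rdotBl, rdotBr, rdotZl, rdotZr).
rewrite (rdot_adjoint aX (X x) x) => h.
have := Xm (X x); set p := rdot (X (X x)) (X x) in h *.
set q := rdot (X x) (X x) in h * => pq.
have : 0 <= rdot (X x) x - m^-1 * q.
  apply: le_trans h _; rewrite -subr_ge0.
  have -> : rdot (X x) x - m^-1 * q -
    (rdot (X x) x - m^-1 * q - (m^-1 * q - m^-1 * (m^-1 * p))) =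
    m^-1 * m^-1 * (m * q - p) by field; rewrite gt_eqF.
  by rewrite mulr_ge0 ?subr_ge0 // mulr_ge0 ?invr_ge0 ?ltW.
by rewrite subr_ge0 ler_pdivrMl.
Qed.

(** Coercivity makes [X] bounded below, so its range is closed; a vector [z] orthogonal to the range
    satisfies [<X z, z> = 0], hence vanishes. *)
Lemma self_adjoint_inverse X (t : R) : 0 < t -> bounded_operator X -> is_adjoint X X ->
  (forall x, t * rdot x x <= rdot (X x) x) ->
  exists Y, [/\ bounded_operator Y, X \o Y = id & Y \o X = id].
Proof.
move=> t0 bX aX Xt; have lX := bX.1.
have Xge x : t * hnorm x <= hnorm (X x).
  have := le_trans (Xt x) (rdot_le (X x) x); rewrite -sqr_hnorm.
  have [->|x0] := eqVneq x 0; first by rewrite hnorm0 !mulr0 => _; exact: hnorm_ge0.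
  have nx : 0 < hnorm x.
    by rewrite lt_def hnorm_ge0 andbT; apply: contra x0 => /eqP/hnorm_eq0/eqP.
  by rewrite expr2 mulrA ler_pM2r.
have Xinj x y : X x = X y -> x = y.
  move=> xy; apply/eqP; rewrite -subr_eq0; apply/eqP/hnorm_le0.
  by have := Xge (x - y); rewrite linB // xy subrr hnorm0 pmulr_rle0.
have Xsurj y : exists x, X x = y.
  pose C := range X.
  have C_lin a z w : C z -> C w -> C (a *: z + w).
    by move=> [x _ <-] [x' _ <-]; exists (a *: x + x'); rewrite // lX.
  have C0 : C 0 by exists 0 => //; exact: lin0.
  have /(_ y)/hcl_seq[u Cu uy] : forall y, hcl C y.
    apply: hcl_dense => // z zC; apply/rdotxx_eq0/eqP; rewrite eq_le rdotxx_ge0 andbT.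
    have := Xt z; rewrite [rdot (X z) z]rdotC {2}/rdot zC; last by exists z.
    by rewrite pmulr_rle0.
  have /choice[v vu] n : exists x, X x = u n by have [x _ <-] := Cu n; exists x.
  have [x vx] : exists x, hcvg v x.
    apply: hcvg_cauchy => e e0.
    have [N uN] := uy _ (mulr_gt0 (divr_gt0 e0 (ltr0Sn _ 1)) t0).
    exists N => m n /uN um /uN un; have := Xge (v m - v n).
    rewrite linB // !vu -(ltr_pM2l t0); have := ler_hdist y (u m) (u n); lra.
  exists x; apply: hcvg_unique uy; rewrite -(_ : X \o v = u); last exact/funext.
  exact: bounded_map_cvg.
have [Y YX] := choice Xsurj; exists Y; split; [split| |].
- by move=> a x y; apply: Xinj; rewrite lX !YX.
- by exists t^-1 => x; rewrite -(ler_pM2l t0) mulVKf ?gt_eqF // -[in leRHS](YX x).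
- by apply/funext => x /=; rewrite YX.
- by apply/funext => x /=; apply: Xinj; rewrite YX.
Qed.

(** By [psd_norm_le] for the differences, [|X p x - X n x|^2] is at most [m] times the increment of
    the bounded increasing sequence [<X n x, x>]. *)
Lemma monotone_limit (X : nat -> H -> H) (m : R) : 0 < m ->
  (forall n, bounded_operator (X n)) -> (forall n, is_adjoint (X n) (X n)) ->
  (forall n, psd (X n)) -> (forall n x, rdot (X n x) x <= rdot (X n.+1 x) x) ->
  (forall n x, rdot (X n x) x <= m * rdot x x) ->
  exists Y, [/\ bounded_operator Y, is_adjoint Y Y & forall x, hcvg (X^~ x) (Y x)].
Proof.
move=> m0 bX aX pX Xincr Xm.
have Xmono n k x : rdot (X n x) x <= rdot (X (n + k)%N x) x.
  by elim: k => [|k IH]; rewrite ?addn0 // addnS (le_trans IH).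
have Xdist n k x : rdot (X (n + k)%N x - X n x) (X (n + k)%N x - X n x) <=
    m * (rdot (X (n + k)%N x) x - rdot (X n x) x).
  pose D x := X (n + k)%N x - X n x.
  have lX i := (bX i).1.
  rewrite -rdotBl -/(D x); apply: psd_norm_le => //.
  - by move=> a y z; rewrite /D !lX scalerBr opprD addrACA.
  - by move=> y z; rewrite /D hdotBl hdotBr !aX.
  - by move=> y; rewrite /D rdotBl subr_ge0.
  - by move=> y; rewrite /D rdotBl; have := pX n y; have := Xm (n + k)%N y; lra.
have /choice[Y XY] : forall x, exists y, hcvg (X^~ x) y.
  move=> x; apply: hcvg_cauchy => e e0.
  pose E := range (fun n => rdot (X n x) x).
  have sE : has_sup E.
    by split; [exists (rdot (X 0 x) x), 0%N|exists (m * rdot x x) => _ [n _ <-]].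
  have e1 : 0 < (e / 2) ^+ 2 / m by rewrite divr_gt0 // exprn_gt0 // divr_gt0.
  have [_ [N _ <-] EN] := sup_adherent e1 sE.
  have key n : (N <= n)%N -> hnorm (X n x - X N x) < e / 2.
    move=> /subnKC <-; apply: hnorm_lt; first by rewrite divr_gt0.
    apply: le_lt_trans (Xdist _ _ _) _; rewrite mulrC -ltr_pdivlMr //.
    have : rdot (X (N + (n - N))%N x) x <= sup E by apply: (ub_le_sup sE.2); exists (N + (n - N))%N.
    by move: EN; lra.
  exists N => p q /key hp /key hq; have := ler_hdist (X N x) (X p x) (X q x); lra.
have lY : linear Y.
  move=> a x y; apply: hcvg_unique (XY _) _.
  apply: hcvg_ext (hcvg_lin a (XY x) (XY y)) => n.
  by rewrite -(bX n).1.
exists Y; split=> //.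
  split=> //; exists m => x; apply: hcvg_norm_le (XY x) _ => n.
  apply: hnorm_le; first by rewrite mulr_ge0 ?hnorm_ge0 ?ltW.
  apply: (le_trans (psd_norm_le m0 (bX n).1 (aX n) (pX n) (Xm n) x)).
  by rewrite exprMn sqr_hnorm expr2 -mulrA ler_pM2l.
apply: adjoint_pair_rdot => // x y; rewrite [RHS]rdotC.
by apply: hcvg_rdot (XY x) (XY y) _ => n; rewrite (rdot_adjoint (aX n)) rdotC.
Qed.

End self_adjoint.

(** * Commutants and resolvents *)

Lemma conj_real (R : realType) (t : R) : Num.conj t%:C%C = t%:C%C.
Proof. exact: conjc_real. Qed.

Section commutant.
Variables (R : realType) (H : hilbertType R) (A : set (H -> H)).
Hypothesis A_bounded : forall S, A S -> bounded_operator S.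
Implicit Types (X Y Z S T : H -> H).

Let M := commutant A.

Lemma commutantE S T : M T -> A S -> forall x, T (S x) = S (T x).
Proof. by move=> MT AS x; have /(congr1 (@^~ x)) := MT.2 S AS. Qed.

Lemma commutant_id : M id.
Proof. by split=> //; split=> //; exists 1 => x; rewrite mul1r. Qed.

Lemma commutant_comp S T : M S -> M T -> M (S \o T).
Proof.
move=> MS MT; split; last first.
  by move=> U AU; apply/funext => x /=; rewrite (commutantE MT AU) (commutantE MS AU).
exact: bounded_map_comp MS.1 MT.1.
Qed.

Lemma commutant_lin a S T : M S -> M T -> M (a \*: S \+ T).
Proof.
move=> MS MT; split; last first.
  move=> U AU; apply/funext => x /=.
  by rewrite (A_bounded AU).1 (commutantE MT AU) (commutantE MS AU).
split.
  move=> b x y /=; rewrite MT.1.1 MS.1.1 !scalerDr !scalerA (mulrC a).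
  by rewrite addrACA.
have [c c0 Sc] := bounded_mapP MS.1; have [d _ Td] := bounded_mapP MT.1.
exists (normc a * c + d) => x; apply: le_trans (ler_hnormD _ _) _.
rewrite hnormZ mulrDl lerD // -mulrA ler_wpM2l //.
by case: (a) => ? ?; exact: sqrtr_ge0.
Qed.

Lemma commutant_limit (X : nat -> H -> H) Y : (forall n, M (X n)) ->
  bounded_operator Y -> (forall x, hcvg (X^~ x) (Y x)) -> M Y.
Proof.
move=> MX bY XY; split=> // S AS; apply/funext => x /=.
apply: hcvg_unique (XY (S x)) _.
apply: hcvg_ext (bounded_map_cvg (A_bounded AS) (XY x)) => n /=.
by rewrite (commutantE (MX n) AS).
Qed.

Lemma commutant_inverse X Y : M X -> bounded_operator Y ->
  X \o Y = id -> Y \o X = id -> M Y.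
Proof.
move=> MX bY XY YX; split=> // S AS; apply/funext => x /=.
have XYE z : X (Y z) = z by have /(congr1 (@^~ z)) := XY.
have YXE z : Y (X z) = z by have /(congr1 (@^~ z)) := YX.
by rewrite -[in LHS](XYE x) -(commutantE MX AS) YXE.
Qed.

Lemma commutant_adjoint S T : (forall U, A U -> exists2 V, A V & is_adjoint U V) ->
  M S -> bounded_operator T -> is_adjoint S T -> M T.
Proof.
move=> Aadj MS bT ST; split=> // U AU; apply/funext => x /=.
have [V AV UV] := Aadj U AU; have TS := adjoint_pair_sym ST.
apply: hdot_inj => z.
by rewrite TS UV -(commutantE MS AV) -TS -UV.
Qed.

(** The right-hand side speaks only of the algebra, so an isomorphism transports it. For the
    converse, let [l < 0] be the infimum of the numerical range: [D = X - l] is positive and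
    invertible, hence dominates a positive multiple of the identity, and [l] is not the infimum. *)
Lemma psd_invertible X : M X -> is_adjoint X X ->
  psd X <-> forall t : R, 0 < t -> exists Y, [/\ M Y,
     (t%:C%C \*: id \+ X) \o Y = id & Y \o (t%:C%C \*: id \+ X) = id].
Proof.
move=> MX aX; have lX := MX.1.1; split=> [pX t t0|inv].
  pose Xt := t%:C%C \*: id \+ X.
  have MXt : M Xt by apply: commutant_lin => //; exact: commutant_id.
  have aXt : is_adjoint Xt Xt.
    by move=> x y; rewrite /Xt /= hdotDl hdotDr hdotZl hdotZr conj_real aX.
  have [x|Y [bY XY YX]] := self_adjoint_inverse t0 MXt.1 aXt.
    by rewrite /Xt /= rdotDl rdotZl lerDl.
  by exists Y; split=> //; exact: commutant_inverse XY YX.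
apply: contrapT => /existsNP[x0 /negP]; rewrite -ltNge => Xx0.
have x00 : 0 < hnorm x0.
  rewrite lt_def hnorm_ge0 andbT; apply: contraTN Xx0 => /eqP/hnorm_eq0 ->.
  by rewrite rdot0r ltxx.
pose E := [set rdot (X x) x | x in [set x | rdot x x = 1]].
have normalize x : 0 < hnorm x -> let y := (hnorm x)^-1%:C%C *: x in
    rdot y y = 1 /\ rdot (X y) y * hnorm x ^+ 2 = rdot (X x) x.
  move=> x1 y; rewrite /y (linZ lX) !(rdotZl, rdotZr) -sqr_hnorm.
  by split; field; rewrite gt_eqF.
have [y0 X0] := normalize _ x00.
have [m m0 Xm] := bounded_mapP MX.1.
have Xle x : `|rdot (X x) x| <= m * rdot x x.
  rewrite -sqr_hnorm expr2 mulrA; apply: le_trans (normr_rdot_le _ _) _.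
  by rewrite ler_wpM2r ?hnorm_ge0.
have iE : has_inf E.
  split; first by eexists; exists ((hnorm x0)^-1%:C%C *: x0).
  exists (- m) => _ [x x1 <-]; have := Xle x; rewrite x1 mulr1.
  by rewrite ler_norml => /andP[].
pose l := inf E.
have l0 : l < 0.
  apply: (@le_lt_trans _ _ (rdot (X ((hnorm x0)^-1%:C%C *: x0)) ((hnorm x0)^-1%:C%C *: x0))).
    by apply: (ge_inf iE.2); exists ((hnorm x0)^-1%:C%C *: x0).
  by rewrite -(pmulr_llt0 _ (exprn_gt0 2 x00)) X0.
have lX' x : l * rdot x x <= rdot (X x) x.
  have [->|x1] := eqVneq x 0; first by rewrite !rdot0r mulr0.
  have {}x1 : 0 < hnorm x.
    by rewrite lt_def hnorm_ge0 andbT; apply: contra x1 => /eqP/hnorm_eq0/eqP.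
  have [h1 <-] := normalize _ x1; rewrite -sqr_hnorm ler_pM2r ?exprn_gt0 //.
  by apply: (ge_inf iE.2); exists ((hnorm x)^-1%:C%C *: x).
have nl0 : 0 < - l by rewrite oppr_gt0.
have [Y [MY _ YX]] := inv _ nl0; set D := _ \+ _ in YX.
have MD : M D by apply: commutant_lin => //; exact: commutant_id.
have DE x : rdot (D x) x = rdot (X x) x - l * rdot x x.
  by rewrite /D /= rdotDl rdotZl mulNr addrC.
have [b b0 Yb] := bounded_mapP MY.1.
have mD : 0 < m - l by lra.
have D2 x : rdot (D x) (D x) <= (m - l) * rdot (D x) x.
  apply: psd_norm_le => // [|y z|z|z]; first exact: MD.1.1.
  - by rewrite /D /= hdotDl hdotDr hdotZl hdotZr conj_real aX.
  - by rewrite DE subr_ge0.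
  - by rewrite DE; have := Xle z; rewrite ler_norml => /andP[_]; lra.
(* From [|x| <= b |D x|] and [|D x|^2 <= (m - l) <D x, x>]. *)
pose k := (b ^+ 2 * (m - l))^-1.
have k0 : 0 < k by rewrite invr_gt0 mulr_gt0 // exprn_gt0.
have : l + k <= l.
  apply: lb_le_inf iE.1 _ => _ [x x1 <-].
  suff : k * rdot x x <= rdot (D x) x by rewrite DE x1; lra.
  rewrite /k mulrC ler_pdivrMr ?mulr_gt0 ?exprn_gt0 //.
  have := Yb (D x); have -> : Y (D x) = x by have /(congr1 (@^~ x)) := YX.
  move=> h; have {}h : hnorm x ^+ 2 <= (b * hnorm (D x)) ^+ 2.
    by rewrite ler_sqr ?nnegrE ?mulr_ge0 ?hnorm_ge0 ?(ltW b0).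
  rewrite exprMn !sqr_hnorm in h; apply: le_trans h _.
  by rewrite mulrCA ler_pM2l ?exprn_gt0 // mulrC D2.
by rewrite gerDl leNgt k0.
Qed.

End commutant.

Section resolvent.
Variables (R : realType) (H : hilbertType R).
Implicit Types (S T Q : H -> H).

Definition le_op S T := forall x, rdot (S x) x <= rdot (T x) x.

(** [Q] stands for [(1 + S)^-1]. The defect [1 - Q], which is [S (1 + S)^-1], serves as a bounded
    substitute for [S]. *)
Definition resolvent S Q := forall x, Q x + S (Q x) = x.

Lemma resolvent_psd S Q : psd S -> resolvent S Q -> psd Q.
Proof.
move=> pS SQ x; rewrite -[x in rdot _ x]SQ rdotDr addr_ge0 ?rdotxx_ge0 //.
by rewrite rdotC; exact: pS.
Qed.

Lemma resolvent_le1 S Q : psd S -> resolvent S Q -> le_op Q id.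
Proof.
move=> pS SQ x; rewrite -subr_ge0 -rdotBl /=.
have -> : x - Q x = S (Q x) by rewrite -{1}(SQ x) addrC addKr.
have -> : rdot (S (Q x)) x = rdot (S (Q x)) (Q x) + rdot (S (Q x)) (S (Q x)).
  by rewrite -rdotDr SQ.
by rewrite addr_ge0 ?rdotxx_ge0 //; exact: pS.
Qed.

(** Expand [<(1 + S)(u - v), u - v> >= 0] with [u = Q' x] and [v = Q x]: the cross terms are
    [<x, u>], and [S <= T] bounds [<(1 + S) u, u>] by [<x, u>]. *)
Lemma resolvent_anti S T Q Q' : linear S -> psd S -> is_adjoint S S -> le_op S T ->
  resolvent S Q -> resolvent T Q' -> le_op Q' Q.
Proof.
move=> lS pS aS ST SQ TQ x; set u := Q' x; set v := Q x.
have := addr_ge0 (rdotxx_ge0 (u - v)) (pS (u - v)).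
have := ST u; have ux : rdot x u = rdot u u + rdot (T u) u by rewrite -{1}(TQ x) rdotDl.
have vx : rdot u x = rdot u v + rdot (S u) v.
  by rewrite -{1}(SQ x) rdotDr (rdot_adjoint aS).
have vvx : rdot v x = rdot v v + rdot (S v) v by rewrite -{1}(SQ x) rdotDr rdotC (rdotC (S v)).
rewrite (linB lS) !(rdotBl, rdotBr) (rdotC v u) (rdot_adjoint aS v u) (rdotC v (S u)).
by move: ux vx vvx; rewrite (rdotC x u); lra.
Qed.

(** The operator form of [s / (1 + s) <= s]. *)
Lemma resolvent_defect_le S Q : linear S -> psd S -> is_adjoint S S -> resolvent S Q ->
  forall x, rdot x x - rdot (Q x) x <= rdot (S x) x.
Proof.
move=> lS pS aS SQ x; have xE := SQ x; set u := Q x in xE *.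
rewrite -xE (linD lS) !(rdotDl, rdotDr) (rdot_adjoint aS (S u) u).
by have := rdotxx_ge0 (S u); have := pS (S u); rewrite (rdotC u (S u)); lra.
Qed.

(** The operator form of [s / 2 <= s / (1 + s)] for [0 <= s <= 1]. *)
Lemma resolvent_defect_ge S Q : linear S -> psd S -> is_adjoint S S -> le_op S id ->
  resolvent S Q -> forall x, 2^-1 * rdot (S x) x <= rdot x x - rdot (Q x) x.
Proof.
move=> lS pS aS S1 SQ x; have xE := SQ x; set u := Q x in xE *.
have := psd_norm_le ltr01 lS aS pS _ u; rewrite mul1r.
move=> /(_ (fun y => le_trans (S1 y) _)); rewrite -xE (linD lS) !(rdotDl, rdotDr).
rewrite (rdot_adjoint aS (S u) u) (rdotC u (S u)) => h.
have {}h : rdot (S u) (S u) <= rdot (S u) u by apply: h => y; rewrite mul1r.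
by have := S1 (S u); have := pS (S u); rewrite /=; lra.
Qed.

End resolvent.

(** * Normality of *-isomorphisms *)

Section star_isomorphism_order.
Variables (R : realType) (H K : hilbertType R) (A : set (H -> H)) (A' : set (K -> K)).
Hypothesis A_bounded : forall S, A S -> bounded_operator S.
Hypothesis A'_bounded : forall S, A' S -> bounded_operator S.
Hypothesis A_adjoint : forall U, A U -> exists2 V, A V & is_adjoint U V.
Let M := commutant A.
Let N := commutant A'.
Variable Phi : (H -> H) -> (K -> K).
Hypothesis Phi_bij : set_bij M N Phi.
Hypothesis Phi_lin : forall (a : R[i]) S T, M S -> M T ->
  Phi (a \*: S \+ T) = a \*: Phi S \+ Phi T.
Hypothesis Phi_mul : forall S T, M S -> M T -> Phi (S \o T) = Phi S \o Phi T.
Hypothesis Phi_adj : forall S T, M S -> M T -> is_adjoint S T ->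
  is_adjoint (Phi S) (Phi T).

Lemma iso_fun S : M S -> N (Phi S).
Proof. by case: Phi_bij => h _ _; exact: h. Qed.

Lemma iso_inj S T : M S -> M T -> Phi S = Phi T -> S = T.
Proof. by case: Phi_bij => _ h _ MS MT; apply: h => //; exact: mem_set. Qed.

Lemma iso_surj Y : N Y -> exists2 S, M S & Phi S = Y.
Proof. by case: Phi_bij => _ _ h; exact: h. Qed.

Lemma iso_id : Phi id = id.
Proof.
have [E ME PE] := iso_surj (commutant_id A').
have := Phi_mul (commutant_id A) ME.
by rewrite (_ : id \o E = E) // PE => /esym.
Qed.

Lemma iso_psd X : M X -> is_adjoint X X -> psd X <-> psd (Phi X).
Proof.
move=> MX aX; rewrite (psd_invertible A_bounded MX aX).
rewrite (psd_invertible A'_bounded (iso_fun MX) (Phi_adj MX MX aX)).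
have shift t : Phi (t%:C%C \*: id \+ X) = t%:C%C \*: id \+ Phi X.
  by rewrite (Phi_lin _ (commutant_id A) MX) iso_id.
have Mshift t : M (t%:C%C \*: id \+ X).
  by apply: commutant_lin => //; exact: commutant_id.
split=> inv t /inv[Y [MY XY YX]].
  exists (Phi Y); split; first exact: iso_fun.
  - by rewrite -shift -Phi_mul // XY iso_id.
  - by rewrite -shift -Phi_mul // YX iso_id.
have [Z MZ ZY] := iso_surj MY; exists Z; split=> //.
- apply: iso_inj; [exact: commutant_comp (Mshift t) MZ|exact: commutant_id|].
  by rewrite Phi_mul // shift ZY iso_id.
- apply: iso_inj; [exact: commutant_comp MZ (Mshift t)|exact: commutant_id|].
  by rewrite Phi_mul // shift ZY iso_id.
Qed.

Lemma iso_le_op X Y : M X -> M Y -> is_adjoint X X -> is_adjoint Y Y ->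
  le_op X Y <-> le_op (Phi X) (Phi Y).
Proof.
move=> MX MY aX aY.
have MD : M (-1 \*: X \+ Y) by exact: commutant_lin.
have aD : is_adjoint (-1 \*: X \+ Y) (-1 \*: X \+ Y).
  by move=> x y /=; rewrite !scaleN1r hdotDl hdotDr hdotNl hdotNr aX aY.
have := iso_psd MD aD; rewrite Phi_lin // => -[h1 h2]; split=> le x.
  have /h1/(_ x) : psd (-1 \*: X \+ Y).
    by move=> y /=; rewrite scaleN1r addrC rdotBl subr_ge0.
  by rewrite /= scaleN1r addrC rdotBl subr_ge0.
have /h2/(_ x) : psd (-1 \*: Phi X \+ Phi Y).
  by move=> y /=; rewrite scaleN1r addrC rdotBl subr_ge0.
by rewrite /= scaleN1r addrC rdotBl subr_ge0.
Qed.

(** The adjoint of the preimage has the same image, so injectivity identifies it with the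
    preimage. *)
Lemma iso_self_adjoint Y : N Y -> is_adjoint Y Y ->
  exists X, [/\ M X, is_adjoint X X & Phi X = Y].
Proof.
move=> NY aY; have [X MX XY] := iso_surj NY; exists X; split=> //.
have [Z bZ XZ] := adjoint_exists MX.1.
have MZ := commutant_adjoint A_adjoint MX bZ XZ.
have eXZ : X = Z.
  by apply: iso_inj => //; apply: adjoint_unique (Phi_adj MX MZ XZ); rewrite XY.
by move: XZ; rewrite -eXZ.
Qed.

Lemma commutant_opB X Y : M X -> M Y -> M (fun x => X x - Y x).
Proof.
move=> MX MY; have := commutant_lin A_bounded (-1) MY MX.
by congr (M _); apply/funext => x /=; rewrite scaleN1r addrC.
Qed.

Lemma iso_opB X Y : M X -> M Y -> Phi (fun x => X x - Y x) = fun y => Phi X y - Phi Y y.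
Proof.
move=> MX MY; have <- : -1 \*: Y \+ X = fun x => X x - Y x.
  by apply/funext => x /=; rewrite scaleN1r addrC.
by rewrite Phi_lin //; apply/funext => y /=; rewrite scaleN1r addrC.
Qed.

Lemma small_exp2 (e : R) : 0 < e -> exists n : nat, 2 * 2^-1 ^+ n < e.
Proof.
move=> e0; have [k ke] := small_inv (divr_gt0 e0 (ltr0Sn _ 1)).
exists k; rewrite mulrC -ltr_pdivlMr //; apply: le_lt_trans (ke k (leqnn k)).
rewrite exprVn lef_pV2 ?posrE ?exprn_gt0 ?ltr0Sn //.
by rewrite -natrX ler_nat; exact: ltn_expl.
Qed.

Section normality.
Variable chi : H.
Hypothesis chi_separating : forall D, M D -> D chi = 0 -> forall x, D x = 0.
Variables (B : nat -> H -> H) (xi : K) (e : R).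
Hypothesis e0 : 0 < e.
Hypothesis MB : forall n, M (B n).
Hypothesis aB : forall n, is_adjoint (B n) (B n).
Hypothesis pB : forall n, psd (B n).
Hypothesis B1 : forall n, le_op (B n) id.
Hypothesis Bsmall : forall n, rdot (B n chi) chi <= 2^-1 ^+ n.
Hypothesis Bbig : forall n, e <= rdot (Phi (B n) xi) xi.

Let S k n (x : H) : H := \sum_(i < n) B (k + i)%N x.

Let MS k n : M (S k n).
Proof.
elim: n => [|n IH].
  have := commutant_opB (commutant_id A) (commutant_id A).
  by congr (M _); apply/funext => x; rewrite /S big_ord0 subrr.
have := commutant_lin A_bounded 1 (MB (k + n)%N) IH.
congr (M _); apply/funext => x.
by rewrite /S big_ord_recr /= scale1r addrC.
Qed.

Let rS k n x y : rdot (S k n x) y = \sum_(i < n) rdot (B (k + i)%N x) y.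
Proof.
rewrite /S; elim/big_rec2: _ => [|i a b _ <-]; first exact: rdot0l.
by rewrite rdotDl.
Qed.

Let aS k n : is_adjoint (S k n) (S k n).
Proof.
apply: adjoint_pair_rdot; first exact: (MS k n).1.1.
move=> x y; rewrite [RHS]rdotC !rS; apply: eq_bigr => i _.
by rewrite (rdot_adjoint (aB _)) rdotC.
Qed.

Let pS k n : psd (S k n).
Proof. by move=> x; rewrite rS; apply: sumr_ge0 => i _; exact: pB. Qed.

Let S_chi k n : rdot (S k n chi) chi <= 2 * 2^-1 ^+ k.
Proof.
(* The induction needs the exact value of the geometric sum, not just its upper bound. *)
apply: (@le_trans _ _ (2 * 2^-1 ^+ k - 2 * 2^-1 ^+ (k + n))); last first.
  by rewrite gerBl mulr_ge0 // exprn_ge0 // invr_ge0.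
rewrite rS; elim: n => [|n IH]; first by rewrite big_ord0 addn0 subrr.
rewrite big_ord_recr /= addnS exprS.
have := Bsmall (k + n); lra.
Qed.

Let resolvent_exists k n :
  exists Q, [/\ M Q, is_adjoint Q Q & resolvent (S k n) Q].
Proof.
have MT : M (1 \*: id \+ S k n).
  exact (commutant_lin A_bounded _ (commutant_id A) (MS k n)).
have aT : is_adjoint (1 \*: id \+ S k n) (1 \*: id \+ S k n).
  by move=> x y /=; rewrite !scale1r hdotDl hdotDr aS.
have [x|Q [bQ TQ QT]] := self_adjoint_inverse ltr01 MT.1 aT.
  by rewrite /= scale1r rdotDl mul1r lerDl pS.
have SQ : resolvent (S k n) Q.
  by move=> x; have /(congr1 (@^~ x)) /= := TQ; rewrite scale1r.
exists Q; split=> //; first exact: (commutant_inverse MT bQ TQ QT).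
move=> x y; rewrite -{2}(SQ x) -{1}(SQ y) hdotDl hdotDr.
by rewrite aS.
Qed.

(** [T k] is the limit in [n] of [1 - (1 + B k + ... + B (k + n - 1))^-1]; it
    dominates a multiple of [B k], and it decreases to [0] as [k] grows because
    its trace does. *)
Let tail_exists : exists T : nat -> H -> H, forall k,
  [/\ M (T k), is_adjoint (T k) (T k), psd (T k), le_op (T k) id &
   [/\ le_op (T k.+1) (T k), rdot (T k chi) chi <= 2 * 2^-1 ^+ k &
       forall x, 2^-1 * rdot (B k x) x <= rdot (T k x) x]].
Proof.
have /choice[Q' Q'P] : forall p : nat * nat,
    exists Q, [/\ M Q, is_adjoint Q Q & resolvent (S p.1 p.2) Q].
  by move=> [k n]; exact: resolvent_exists.
pose Q k n := Q' (k, n).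
have MQ k n : M (Q k n) by case: (Q'P (k, n)).
have aQ k n : is_adjoint (Q k n) (Q k n) by case: (Q'P (k, n)).
have SQ k n : resolvent (S k n) (Q k n) by case: (Q'P (k, n)).
have lS k n := (MS k n).1.1.
pose D k n x := x - Q k n x.
have DE k n x : rdot (D k n x) x = rdot x x - rdot (Q k n x) x by rewrite rdotBl.
have MD k n : M (D k n) by apply: commutant_opB => //; exact: commutant_id.
have aD k n : is_adjoint (D k n) (D k n) by move=> x y; rewrite hdotBl hdotBr aQ.
have pD k n : psd (D k n).
  by move=> x; rewrite DE subr_ge0; exact: resolvent_le1 (SQ k n) _.
have D1 k n : le_op (D k n) id.
  move=> x; rewrite DE gerBl; exact: resolvent_psd (SQ k n) x.
have Dincr k n x : rdot (D k n x) x <= rdot (D k n.+1 x) x.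
  rewrite !DE lerD2l lerN2.
  apply: (resolvent_anti (lS k n) _ _ _ (SQ k n) (SQ k n.+1)) => // y.
  by rewrite !rS big_ord_recr lerDl pB.
(* [S k n.+1] is [B k] plus [S k.+1 n], whence the shift in the second index. *)
have Ddecr k n x : rdot (D k.+1 n x) x <= rdot (D k n.+1 x) x.
  rewrite !DE lerD2l lerN2.
  apply: (resolvent_anti (lS k.+1 n) _ _ _ (SQ k.+1 n) (SQ k n.+1)) => // y.
  rewrite !rS big_ord_recl -[leLHS]add0r lerD ?pB //.
  by apply: ler_sum => i _; rewrite /= /bump /= addSnnS.
have lim k : exists Y, [/\ bounded_operator Y, is_adjoint Y Y & forall x, hcvg (D k ^~ x) (Y x)].
  apply: (@monotone_limit _ _ (D k) 1) => // [n|n x]; first exact: (MD k n).1.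
  by rewrite mul1r; exact: D1.
have [T TP] := choice lim; exists T => k.
have [bT aT DT] := TP k.
have le_T n x : rdot (D k n x) x <= rdot (T k x) x.
  have Dm m : rdot (D k n x) x <= rdot (D k (n + m)%N x) x.
    by elim: m => [|m IH]; rewrite ?addn0 // addnS (le_trans IH).
  have shifted : hcvg (fun m => D k (n + m)%N x) (T k x).
    move=> r /(DT x)[n0 Dn]; exists n0 => m n0m; apply: Dn.
    exact: leq_trans n0m (leq_addl _ _).
  exact: hcvg_rdot_ge shifted _.
split=> //; first exact: (commutant_limit A_bounded (MD k) bT DT).
- by move=> x; apply: le_trans (le_T 0%N x); exact: pD.
- by move=> x; apply: hcvg_rdot_le (DT x) _ => n; exact: D1.
split.
- move=> x; have [_ _ DT'] := TP k.+1.
  by apply: hcvg_rdot_le (DT' x) _ => n; apply: le_trans (Ddecr k n x) (le_T _ x).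
- apply: hcvg_rdot_le (DT chi) _ => n; apply: le_trans (S_chi k n).
  by rewrite DE; exact: resolvent_defect_le (SQ k n) _.
(* Already the one-term sum, which is [B k] itself, gives the bound. *)
move=> x; apply: le_trans (le_T 1%N x); rewrite DE.
have -> : B k = S k 1 by apply/funext => y; rewrite /S big_ord1 addn0.
apply: resolvent_defect_ge (SQ k 1%N) _ => // y.
by rewrite /S big_ord1 addn0; exact: B1.
Qed.

(** An order isomorphism preserves suprema. The operators [1 - T k] increase to the identity,
    whereas their images stay below the identity at [xi] by at least [e / 2], because [T k]
    dominates half of [B k]. *)
Lemma iso_normal : False.
Proof.
have [T TP] := tail_exists.
have MT k : M (T k) by case: (TP k).
have aT k : is_adjoint (T k) (T k) by case: (TP k).
have Mid := commutant_id A.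
pose Q k x := x - T k x.
have MQ k : M (Q k) by exact: commutant_opB.
have QE k x : rdot (Q k x) x = rdot x x - rdot (T k x) x by rewrite rdotBl.
have aQ k : is_adjoint (Q k) (Q k) by move=> x y; rewrite hdotBl hdotBr aT.
have pQ k : psd (Q k) by move=> x; rewrite QE subr_ge0; case: (TP k) => _ _ _ + _; exact.
have Q1 k : le_op (Q k) id.
  by move=> x; rewrite QE gerBl; case: (TP k) => _ _ + _ _; exact.
have Qincr k : le_op (Q k) (Q k.+1).
  by move=> x; rewrite !QE lerD2l lerN2; case: (TP k) => _ _ _ _ [+ _ _]; exact.
have [W [bW aW QW]] : exists Y,
    [/\ bounded_operator Y, is_adjoint Y Y & forall x, hcvg (Q ^~ x) (Y x)].
  apply: (@monotone_limit _ _ Q 1) => // [k|k x]; first exact: (MQ k).1.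
  by rewrite mul1r; exact: Q1.
have MW : M W by exact: (commutant_limit A_bounded MQ bW QW).
(* [1 - W] is positive and its trace is below [2 * 2^-k] for every [k], so it kills the separating
   vector. *)
have Wid x : W x = x.
  pose D x := x - W x.
  have MD : M D by exact: commutant_opB.
  suff : D chi = 0.
    by move=> /(chi_separating MD)/(_ x)/eqP; rewrite subr_eq0 => /eqP.
  have DE y : rdot (D y) y = rdot y y - rdot (W y) y by rewrite rdotBl.
  apply/rdotxx_eq0/eqP; rewrite eq_le rdotxx_ge0 andbT.
  have aD : is_adjoint D D by move=> y z; rewrite hdotBl hdotBr aW.
  have pD : psd D.
    by move=> y; rewrite DE subr_ge0; apply: hcvg_rdot_le (QW y) _ => k; exact: Q1.
  have D1 y : rdot (D y) y <= 1 * rdot y y.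
    rewrite mul1r DE gerBl.
    by apply: hcvg_rdot_ge (QW y) _ => k; exact: pQ.
  have := psd_norm_le ltr01 MD.1.1 aD pD D1 chi; rewrite mul1r => /le_trans; apply.
  apply/ler_addgt0Pl => r r0; rewrite addr0.
  have [k kr] := small_exp2 r0; apply: ltW; apply: le_lt_trans kr.
  case: (TP k) => _ _ _ _ [_ + _]; apply: le_trans.
  suff : rdot (Q k chi) chi <= rdot (W chi) chi by rewrite QE DE; lra.
  have shifted : hcvg (fun m => Q (k + m)%N chi) (W chi).
    move=> s /(QW chi)[n Qn]; exists n => m nm; apply: Qn.
    exact: leq_trans nm (leq_addl _ _).
  apply: hcvg_rdot_ge shifted _ => m.
  by elim: m => [|m IH]; rewrite ?addn0 // addnS (le_trans IH) //; exact: Qincr.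
pose Y k := Phi (Q k).
have [V [bV aV YV]] : exists Z,
    [/\ bounded_operator Z, is_adjoint Z Z & forall x, hcvg (Y ^~ x) (Z x)].
  apply: (@monotone_limit _ _ Y 1) => // [k|k|k|k x|k x].
  - exact: (iso_fun (MQ k)).1.
  - exact: Phi_adj.
  - exact/iso_psd.
  - by move: x; apply/iso_le_op.
  - rewrite mul1r -[rdot x x]/(rdot (id x) x) -iso_id; move: x; apply/iso_le_op => //.
have NV : N V by apply: (commutant_limit A'_bounded _ bV YV) => k; exact: iso_fun.
(* [Phi] is not known to commute with limits, so the limit of the images is pulled back and compared
   with the identity inside [M]. *)
have [X [MX aX XV]] := iso_self_adjoint NV aV.
have QX k : le_op (Q k) X.
  apply/iso_le_op => // x; rewrite XV.
  have shifted : hcvg (fun m => Y (k + m)%N x) (V x).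
    move=> s /(YV x)[n Yn]; exists n => m nm; apply: Yn.
    exact: leq_trans nm (leq_addl _ _).
  apply: hcvg_rdot_ge shifted _ => m.
  elim: m => [|m IH]; rewrite ?addn0 // addnS (le_trans IH) //.
  by move: (x); apply/iso_le_op.
have : le_op id X.
  by move=> x; rewrite -{1}(Wid x); apply: hcvg_rdot_le (QW x) _ => k; exact: QX.
move=> /(iso_le_op Mid MX (fun _ _ => erefl) aX)/(_ xi); rewrite iso_id XV /=.
suff : rdot (V xi) xi <= rdot xi xi - 2^-1 * e.
  by move=> h1 /le_trans/(_ h1); rewrite leNgt gtrBl mulr_gt0 ?invr_gt0.
apply: hcvg_rdot_le (YV xi) _ => k.
(* [B k <= 2 T k] is transported by the order, with [2 T k] written as [T k + T k] to fit
   [Phi_lin]. *)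
have : rdot (Phi (B k) xi) xi <= rdot ((2%:C%C \*: Phi (T k)) xi) xi.
  pose T2 := 1 \*: T k \+ T k.
  have MT2 : M T2 := commutant_lin A_bounded _ (MT k) (MT k).
  have -> : 2%:C%C \*: Phi (T k) = Phi T2.
    rewrite (Phi_lin _ (MT k) (MT k)); apply/funext => y /=.
    rewrite -[X in _ + X]scale1r -scalerDl; congr (_ *: _).
    by apply/eqP; rewrite eq_complex /=; apply/andP; split; apply/eqP; ring.
  move: (xi); apply/iso_le_op => //.
    by move=> x y; rewrite /T2 /= !scale1r hdotDl hdotDr aT.
  move=> x; rewrite /T2 /= scale1r rdotDl.
  by case: (TP k) => _ _ _ _ [_ _ /(_ x)]; lra.
rewrite /= rdotZl /Y iso_opB // iso_id rdotBl; have := Bbig k; lra.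
Qed.

End normality.
End star_isomorphism_order.

(** * Regular representations on l2(G) *)

Section unitary_representations.
Variables (R : realType) (G : groupType) (H : hilbertType R) (pi : unirep G H).

Lemma rep_hnorm g x : hnorm (pi g x) = hnorm x.
Proof. by rewrite /hnorm /dotnorm rep_isometry. Qed.

Lemma repMx g h x : pi (g * h)%g x = pi g (pi h x).
Proof. by rewrite repM. Qed.

Lemma repK g x : pi g^-1%g (pi g x) = x.
Proof. by rewrite -repMx mulVg rep1. Qed.

Lemma repVK g x : pi g (pi g^-1%g x) = x.
Proof. by rewrite -repMx mulgV rep1. Qed.

Lemma rep_adjoint g : is_adjoint (pi g) (pi g^-1%g).
Proof. by move=> x y; rewrite -{1}(repVK g y) rep_isometry. Qed.

Lemma rep_bounded S : range pi S -> bounded_operator S.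
Proof.
move=> [g _ <-]; split; first exact: rep_linear.
by exists 1 => x; rewrite rep_hnorm mul1r.
Qed.

Lemma rep_range_adjoint S : range pi S -> exists2 T, range pi T & is_adjoint S T.
Proof. by move=> [g _ <-]; exists (pi g^-1%g); [exists g^-1%g|exact: rep_adjoint]. Qed.

Lemma rep_commutantE T g x : commutant (range pi) T -> T (pi g x) = pi g (T x).
Proof. by move=> MT; apply: (commutantE MT); exists g. Qed.

Lemma rep_commutantP T : bounded_operator T -> (forall g x, T (pi g x) = pi g (T x)) ->
  commutant (range pi) T.
Proof. by move=> bT Tpi; split=> // _ [g _ <-]; apply/funext => x /=. Qed.

Lemma rep_commutant_adjoint S : commutant (range pi) S ->
  exists2 T, commutant (range pi) T & is_adjoint S T.
Proof.
move=> MS; have [T bT ST] := adjoint_exists MS.1; exists T => //.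
exact: commutant_adjoint rep_range_adjoint MS bT ST.
Qed.

End unitary_representations.

Lemma hcl_orthogonal (R : realType) (H : hilbertType R) (C : set H) p w :
  hcl C p -> (forall z, C z -> '[z, w] = 0) -> '[p, w] = 0.
Proof.
move=> Cp Cw; apply/Normc.eq0_normc/eqP; rewrite eq_le; apply/andP; split; last first.
  by case: '[p, w] => ? ?; exact: sqrtr_ge0.
apply/ler_addgt0Pl => e e0; rewrite addr0.
have w1 : 0 < hnorm w + 1 by rewrite ltr_wpDl ?hnorm_ge0.
have [z Cz] := Cp _ (divr_gt0 e0 w1); rewrite hnormBC ltr_pdivlMr // => zp.
have := normc_hdot_le (p - z) w; rewrite hdotBl (Cw z Cz) subr0 => h.
apply: le_trans h _; apply: le_trans (ltW zp).
by rewrite ler_wpM2l ?hnorm_ge0 // lerDl.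
Qed.

Section l2_space.
Variables (R : realType) (G : groupType).
Local Notation l2G := (l2 R G).
Implicit Types (f : l2G) (g h x : G).

Lemma rsum_pred1 (u : G -> R) h : (forall x, x != h -> u x = 0) -> rsum u = u h.
Proof.
move=> uh; have pos (v : G -> R) : (forall x, x != h -> v x = 0) ->
    fine (\esum_(x in [set: G]) (Num.max (v x) 0)%:E) = Num.max (v h) 0.
  move=> vh; rewrite -[RHS]/(fine (Num.max (v h) 0)%:E); congr fine.
  rewrite -(@esum_set1 _ _ h (fun x => (Num.max (v x) 0)%:E)); last first.
    by rewrite lee_fin le_max lexx orbT.
  rewrite [RHS]esum_mkcond; apply: eq_esum => x _.
  case: ifPn => [//|]; rewrite notin_setE /= => /eqP xh.
  by rewrite vh // maxxx.
rewrite /rsum pos // pos => [|x xh]; last by rewrite uh // oppr0.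
case: (leP (u h) 0) => h0; first by rewrite max_l ?oppr_ge0 // sub0r opprK.
by rewrite max_r ?subr0 // oppr_le0 ltW.
Qed.

Lemma csum_pred1 (u : G -> R[i]) h : (forall x, x != h -> u x = 0) -> csum u = u h.
Proof.
move=> uh; rewrite /csum !(@rsum_pred1 _ h) /=; first by case: (u h).
  by move=> x /uh ->.
by move=> x /uh ->.
Qed.

Lemma l2_hdotE f1 f2 : '[f1, f2] = csum (fun x => f1 x * Num.conj (f2 x)).
Proof. by []. Qed.

Lemma hdot_chi f h : '[f, chi R h] = f h.
Proof.
rewrite l2_hdotE (@csum_pred1 _ h) /= => [|x /negPf ->]; last first.
  by rewrite rmorph0 mulr0.
by rewrite eqxx rmorph1 mulr1.
Qed.

Lemma sqsum_hnorm f : sqsum f = (hnorm f ^+ 2)%:E.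
Proof.
have [c c0 fc] := sqsum_pinfty (l2_sqsum f).
by rewrite fc sqr_hnorm /rdot -[hdot f f]/(l2_dot f f) (l2_dotE fc).
Qed.

Lemma l2_orthogonal_chi f : (forall h, '[chi R h, f] = 0) -> f = 0.
Proof.
move=> fchi; apply: l2P => h; rewrite -hdot_chi hdotC fchi.
by rewrite rmorph0.
Qed.

Lemma l2_ext (K : hilbertType R) (S T : l2G -> K) : bounded_map S -> bounded_map T ->
  (forall h, S (chi R h) = T (chi R h)) -> forall f, S f = T f.
Proof.
move=> bS bT ST f; suff -> : S = T by [].
apply: (@total_ext _ _ _ (range (chi R (G := G)))) => // [x xchi|_ [h _ <-] //].
by apply: l2_orthogonal_chi => h; rewrite hdotC xchi ?rmorph0 //; exists h.
Qed.

Fact rreg_bij g : set_bij [set: G] [set: G] (fun x => x * g)%g.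
Proof.
split=> [//|x y _ _|x _]; first exact: mulIg.
by exists (x * g^-1)%g => //; rewrite mulgVK.
Qed.

Fact rreg_l2 g f : (fun x => f (x * g)%g) \in @l2_pred R G.
Proof. by apply/asboolP; rewrite (sqsum_reindex _ (rreg_bij g)); exact: l2_sqsum. Qed.

Definition rreg_fun g f : l2G := L2 (rreg_l2 g f).

Fact rreg_linear g : linear (rreg_fun g).
Proof. by move=> a f1 f2; apply: l2P => x; exact: erefl. Qed.

Fact rreg_isometry g f1 f2 : '[rreg_fun g f1, rreg_fun g f2] = '[f1, f2].
Proof. exact: (csum_reindex (fun x => f1 x * Num.conj (f2 x)) (rreg_bij g)). Qed.

Fact rreg1 : rreg_fun 1%g = id.
Proof. by apply/funext => f; apply: l2P => x /=; rewrite mulg1. Qed.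

Fact rregM g h : rreg_fun (g * h)%g = rreg_fun g \o rreg_fun h.
Proof. by apply/funext => f; apply: l2P => x /=; rewrite mulgA. Qed.

Definition rreg : unirep G l2G := Unirep rreg_linear rreg_isometry rreg1 rregM.

Lemma lreg_chiE g h : lreg R G g (chi R h) = chi R (g * h)%g.
Proof. exact: lreg_chi. Qed.

Lemma rreg_chi g h : rreg g (chi R h) = chi R (h * g^-1)%g.
Proof.
apply: l2P => x /=; congr (_%:R); congr nat_of_bool.
by apply/eqP/eqP => [<-|->]; rewrite ?mulgK ?mulgVK.
Qed.

Lemma lreg_rreg g h f : lreg R G g (rreg h f) = rreg h (lreg R G g f).
Proof. by apply: l2P => x /=; rewrite mulgA. Qed.

Lemma chi_lreg g : chi R g = lreg R G g (chi R 1%g).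
Proof. by rewrite lreg_chiE mulg1. Qed.

Lemma chi_rreg g : chi R g = rreg g^-1%g (chi R 1%g).
Proof. by rewrite rreg_chi invgK mul1g. Qed.

Lemma rreg_commutant g : commutant (range (lreg R G)) (rreg g).
Proof.
apply: rep_commutantP => [|h f]; last by rewrite lreg_rreg.
by apply: (rep_bounded (pi := rreg)); exists g.
Qed.

Lemma lreg_commutant g : commutant (range rreg) (lreg R G g).
Proof.
apply: rep_commutantP => [|h f]; last by rewrite lreg_rreg.
by apply: (rep_bounded (pi := lreg R G)); exists g.
Qed.

Local Notation M := (commutant (range (lreg R G))).
Local Notation M' := (commutant (range rreg)).
Local Notation chi1 := (chi R (1%g : G)).

Lemma commutant_chi T h : M T -> T (chi R h) = lreg R G h (T chi1).
Proof. by move=> MT; rewrite chi_lreg rep_commutantE. Qed.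

(** [chi1] is cyclic for [lam], hence separating for its commutant. *)
Lemma commutant_separating T : M T -> T chi1 = 0 -> forall f, T f = 0.
Proof.
move=> MT T1; apply: l2_ext (MT.1) _ _ => [|h].
  by split=> [a x y|]; [rewrite scaler0 addr0|exists 0 => x; rewrite hnorm0 mul0r].
by rewrite commutant_chi // T1 (lin0 (rep_linear (lreg R G) h)).
Qed.

Lemma adjoint_chi T S h : M T -> is_adjoint T S ->
  S chi1 h = Num.conj (T chi1 h^-1%g).
Proof.
move=> MT TS; rewrite -(hdot_chi (S chi1)) hdotC -TS commutant_chi // hdot_chi.
by rewrite /= mulg1.
Qed.

Lemma rreg_adjoint_chi B C h : M' B -> is_adjoint B C ->
  C chi1 h = Num.conj (B chi1 h^-1%g).
Proof.
move=> MB BC; rewrite -(hdot_chi (C chi1)) hdotC -BC chi_rreg rep_commutantE //.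
by rewrite hdot_chi /= mul1g.
Qed.

(** By [adjoint_chi] both sides are the same sum of products of coefficients, up to inversion of the
    index. *)
Lemma l2_trace S T : M S -> M T -> '[S (T chi1), chi1] = '[T (S chi1), chi1].
Proof.
move=> MS MT; have [S' _ SS'] := rep_commutant_adjoint MS.
have [T' _ TT'] := rep_commutant_adjoint MT.
rewrite SS' [RHS]TT' !l2_hdotE.
have inv_bij : set_bij [set: G] [set: G] (fun x => x^-1)%g.
  by split=> [//|x y _ _|x _]; [exact: invg_inj|exists x^-1%g; rewrite // invgK].
rewrite -[LHS](csum_reindex _ inv_bij); congr csum; apply/funext => x /=.
by rewrite (adjoint_chi _ MS SS') (adjoint_chi _ MT TT') !conjCK invgK mulrC.
Qed.

(** Both sides have matrix coefficients given by the same convolution of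
    [T chi1] and [B chi1]. *)
Lemma commutation T B : M T -> M' B -> forall f, T (B f) = B (T f).
Proof.
move=> MT MB.
have [T' MT' TT'] := rep_commutant_adjoint MT.
have [B' MB' BB'] := rep_commutant_adjoint MB.
apply: (@l2_ext _ (T \o B) (B \o T)) => [||g].
- exact: bounded_map_comp MT.1 MB.1.
- exact: bounded_map_comp MB.1 MT.1.
apply: l2P => h; rewrite /= -hdot_chi -[RHS]hdot_chi TT' [RHS]BB'.
rewrite (commutant_chi h MT') (commutant_chi g MT) (chi_rreg g) (chi_rreg h).
rewrite (rep_commutantE _ _ MB) (rep_commutantE _ _ MB') !l2_hdotE.
have sig_bij : set_bij [set: G] [set: G] (fun x => g * x^-1 * h)%g.
  split=> [//|x y _ _ /mulIg/mulgI/invg_inj //|x _].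
  by exists (h * x^-1 * g)%g => //; rewrite !invgM invgK !mulgA mulgV mul1g mulgVK.
rewrite -[RHS](csum_reindex _ sig_bij); congr csum; apply/funext => x /=.
rewrite (adjoint_chi _ MT TT') (rreg_adjoint_chi _ MB BB') !conjCK mulrC.
by congr (_ * _); congr (l2_fun _ _);
  rewrite !invgM ?invgK !mulgA ?mulVg ?mulgV ?mul1g ?mulgK ?mulgVK.
Qed.

End l2_space.

(** * Consequences of the ICC condition *)

Section icc_groups.
Variables (R : realType) (G : groupType).
Hypothesis iccG : icc G.
Local Notation l2G := (l2 R G).
Local Notation lam := (lreg R G).
Local Notation rho := (rreg R G).
Local Notation M := (commutant (range lam)).
Local Notation chi1 := (chi R (1%g : G)).
Implicit Types (f : l2G) (g h x : G).

(** Such an [f] is constant on conjugacy classes; a nonzero value on an infinite class contradicts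
    square summability. *)
Lemma conj_invariant_eq f : (forall g, lam g (rho g f) = f) -> f = f 1%g *: chi1.
Proof.
move=> fJ; have fconj g x : f (x ^ g)%g = f x.
  by rewrite -[in RHS](fJ g) /conjg /= mulgA.
suff f0 x : x != 1%g -> f x = 0.
  apply: l2P => x; have [->|x1] := eqVneq x 1%g.
    by rewrite -[RHS]/(f 1%g * (1%g == 1%g :> G)%:R) eqxx mulr1.
  by rewrite -[RHS]/(f 1%g * (x == 1%g)%:R) (negPf x1) mulr0 f0.
move=> x1; apply: contrapT => /eqP fx.
pose c := normc (f x) ^+ 2.
have c0 : 0 < c.
  rewrite lt_def sqr_ge0 andbT sqrf_eq0.
  by apply: contra fx => /eqP/Normc.eq0_normc ->.
have [d d0 fd] := sqsum_pinfty (l2_sqsum f).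
have /sqsum_leP fle : (sqsum f <= d%:E)%E by rewrite fd.
(* More than [d / c] points of the class, each contributing [c] to sums bounded by [d]. *)
have [B Bx nB] := infinite_set_fset (Num.bound (d / c)) (iccG x1).
have := fle (enum_fset B) (fset_uniq B).
rewrite (eq_big_seq (fun=> c)); last first.
  by move=> y yB; have [g _ <-] : [set (x ^ h)%g | h in [set: G]] y; [exact: Bx|rewrite fconj].
rewrite big_const_seq iter_addr addr0 count_predT -mulr_natl leNgt => /negP; apply.
rewrite -ltr_pdivrMr //; apply: lt_le_trans (archi_boundP _) _.
  by rewrite divr_ge0 // ltW.
by rewrite ler_nat.
Qed.

(** The vectors whose two-sided orbit is orthogonal to [d] form a two-sided invariant subspace
    containing [v]. The projection of [chi1] to its closure is invariant under conjugation, hence a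
    multiple of [chi1]. If it is zero, [chi1] is orthogonal to the subspace and [v = 0]; otherwise
    [chi1] is in the closure and [d = 0]. *)
Lemma regular_irreducible (v d : l2G) :
  (forall g h, '[lam g (rho h v), d] = 0) -> v = 0 \/ d = 0.
Proof.
move=> vd; pose C : set l2G := [set w | forall g h, '[lam g (rho h w), d] = 0].
have C_lin a w z : C w -> C z -> C (a *: w + z).
  move=> Cw Cz g h; rewrite (rep_linear rho) (rep_linear (lam)).
  by rewrite hdotDl hdotZl Cw Cz mulr0 addr0.
have C0 : C 0.
  by move=> g h; rewrite (lin0 (rep_linear rho h)) (lin0 (rep_linear (lam) g)) hdot0l.
have CG g h w : C w -> C (lam g (rho h w)).
  by move=> Cw g' h'; rewrite -lreg_rreg -!repMx.
have [p Cp pC] := hcl_proj C_lin chi1 C0.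
have pd g h : '[lam g (rho h p), d] = 0.
  rewrite rep_adjoint rep_adjoint; apply: hcl_orthogonal Cp _ => z Cz.
  by rewrite -rep_adjoint -rep_adjoint.
have pE : p = p 1%g *: chi1.
  apply: conj_invariant_eq => g; pose U w := lam g (rho g w).
  have lU : linear U by move=> a x y; rewrite /U (rep_linear rho) (rep_linear (lam)).
  have Uchi : U chi1 = chi1 by rewrite /U rreg_chi lreg_chiE mul1g mulgV.
  have Up : hcl C (U p).
    move=> e /Cp[z Cz zp]; exists (U z); first exact: CG.
    by rewrite -(linB lU) /U !rep_hnorm.
  have ort z : C z -> '[U p - p, z] = 0.
    move=> Cz; have -> : U p - p = (chi1 - p) - U (chi1 - p).
      by rewrite (linB lU) Uchi opprB [RHS]addrC subrKA.
    rewrite hdotBl pC // /U rep_adjoint rep_adjoint pC ?subr0 //.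
    by rewrite -lreg_rreg; exact: CG.
  apply/eqP; rewrite -subr_eq0; apply/eqP; rewrite -/(U p).
  have hC : hcl C (U p - p).
    by rewrite addrC -scaleN1r; apply: hcl_lin.
  apply: rdotxx_eq0; rewrite /rdot.
  by rewrite (hcl_orthogonal hC) // => z Cz; rewrite hdotC ort // rmorph0.
have [p1|p1] := eqVneq (p 1%g) 0.
  left; apply: l2P => g; have Cv : C v by [].
  have := pC _ (CG g^-1%g 1%g v Cv); rewrite pE p1 scale0r subr0 (rep1 rho) hdotC hdot_chi.
  by rewrite /= invgK mulg1 => /(congr1 Num.conj); rewrite conjCK rmorph0.
right; apply: l2_orthogonal_chi => h; have := pd h 1%g.
rewrite (rep1 rho) pE (linZ (rep_linear lam h)) hdotZl -chi_lreg => /eqP.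
by rewrite mulf_eq0 (negPf p1) => /eqP.
Qed.

End icc_groups.

Section averaging.
Variables (R : realType) (G : groupType).
Hypothesis iccG : icc G.
Local Notation l2G := (l2 R G).
Local Notation lam := (lreg R G).
Local Notation rho := (rreg R G).
Local Notation M := (commutant (range lam)).
Local Notation chi1 := (chi R (1%g : G)).
Local Notation half := ((2^-1 : R)%:C%C : R[i]).

(** Closing under midpoints alone suits [convex_min], and each invariant of the averages follows by
    a two-case induction. *)
Inductive conj_hull (T : l2G -> l2G) : (l2G -> l2G) -> Prop :=
| conj_hull_conj g : conj_hull T (fun f => rho g (T (rho g^-1%g f)))
| conj_hull_mid A B : conj_hull T A -> conj_hull T B ->
    conj_hull T (fun f => half *: A f + half *: B f).

Variable T : l2G -> l2G.
Hypothesis MT : M T.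

Lemma commutant_comb (a b : R[i]) A B : M A -> M B -> M (fun f => a *: A f + b *: B f).
Proof.
move=> MA MB; have bl := rep_bounded (pi := lam).
have M0 : M (fun=> 0).
  by have := commutant_opB bl MA MA; congr (M _); apply/funext => f; rewrite subrr.
have := commutant_lin bl a MA (commutant_lin bl b MB M0).
by congr (M _); apply/funext => f /=; rewrite addr0.
Qed.

Lemma conj_hull_commutant A : conj_hull T A -> M A.
Proof.
elim=> [g|A1 A2 _ MA1 _ MA2]; last exact: commutant_comb.
have := commutant_comp (rreg_commutant R g) (commutant_comp MT (rreg_commutant R g^-1)).
by congr (M _).
Qed.

Lemma normc_half : normc half = 2^-1.
Proof. by rewrite /= expr0n addr0 sqrtr_sqr ger0_norm // invr_ge0. Qed.

Lemma conj_hull_bound (m : R) A : (forall f, hnorm (T f) <= m * hnorm f) ->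
  conj_hull T A -> forall f, hnorm (A f) <= m * hnorm f.
Proof.
move=> Tm; elim=> [g f|A1 A2 _ b1 _ b2 f].
  by rewrite rep_hnorm; apply: le_trans (Tm _) _; rewrite rep_hnorm.
apply: le_trans (ler_hnormD _ _) _; rewrite !hnormZ normc_half.
have := b1 f; have := b2 f; lra.
Qed.

Lemma half_plus_half (a : R[i]) : half * a + half * a = a.
Proof.
rewrite -mulrDl -[RHS]mul1r; congr (_ * _).
by apply/eqP; rewrite eq_complex /=; apply/andP; split; apply/eqP; field.
Qed.

Lemma conj_hull_coef A : conj_hull T A -> A chi1 1%g = T chi1 1%g.
Proof.
elim=> [g|A1 A2 _ e1 _ e2].
  by rewrite rreg_chi invgK mul1g commutant_chi //= mul1g mulVg.
by rewrite -[LHS]/(half * A1 chi1 1%g + half * A2 chi1 1%g) e1 e2 half_plus_half.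
Qed.

Lemma conj_hull_conjugate h A : conj_hull T A ->
  conj_hull T (fun f => rho h (A (rho h^-1%g f))).
Proof.
elim=> [g|A1 A2 _ h1 _ h2].
  have := conj_hull_conj T (h * g); congr (conj_hull T _); apply/funext => f.
  by rewrite invgM !repMx.
have := conj_hull_mid h1 h2; congr (conj_hull T _); apply/funext => f.
by rewrite (linD (rep_linear rho h)) !(linZ (rep_linear rho h)).
Qed.

(** The nearest point to [0] of the hull of the conjugates of [T chi1] is unique,
    hence invariant under conjugation, hence a multiple of [chi1]. *)
Lemma averaging (e : R) : 0 < e ->
  exists2 A, conj_hull T A & hnorm (A chi1 - T chi1 1%g *: chi1) < e.
Proof.
move=> e0; pose C : set l2G := [set A chi1 | A in [set A | conj_hull T A]].
have C_mid x y : C x -> C y -> C (half *: (x + y)).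
  move=> [A hA <-] [B hB <-]; exists (fun f => half *: A f + half *: B f) => /=.
    exact: conj_hull_mid.
  by rewrite scalerDr.
have C0 : C !=set0.
  by eexists; exists (fun f => rho 1%g (T (rho 1^-1%g f))) => //; exact: conj_hull_conj.
have [p Cp pmin] := convex_min C_mid C0.
have CG g x : C x -> C (lam g (rho g x)).
  move=> [A hA <-]; exists (fun f => rho g (A (rho g^-1%g f))); first exact: conj_hull_conjugate.
  rewrite rreg_chi invgK mul1g commutant_chi; last exact: conj_hull_commutant.
  by rewrite lreg_rreg.
have pE : p = p 1%g *: chi1.
  apply: conj_invariant_eq => // g; apply: (convex_min_unique C_mid) => // [r r0|z Cz].
    have [z Cz zp] := Cp _ r0; exists (lam g (rho g z)); first exact: CG.
    by rewrite -(linB (rep_linear lam g)) -(linB (rep_linear rho g)) !rep_hnorm.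
  by rewrite !rep_hnorm; exact: pmin.
have p1 : p 1%g = T chi1 1%g.
  apply/eqP; rewrite -subr_eq0; apply/eqP.
  have -> : p 1%g - T chi1 1%g = '[p - T chi1 1%g *: chi1, chi1].
    by rewrite hdotBl hdotZl !hdot_chi /= eqxx mulr1.
  have : hcl [set x - T chi1 1%g *: chi1 | x in C] (p - T chi1 1%g *: chi1).
    move=> r /Cp[z Cz zp]; exists (z - T chi1 1%g *: chi1); first by exists z.
    by rewrite opprB addrA subrK.
  move=> /hcl_orthogonal; apply => _ [_ [A hA <-] <-].
  by rewrite hdotBl hdotZl !hdot_chi conj_hull_coef //= eqxx mulr1 subrr.
have [_ [A hA <-] Ap] := Cp _ e0; exists A => //.
by rewrite -p1 -pE.
Qed.

End averaging.

(** * Synthesis operators of Bessel and Riesz sequences *)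

Section synthesis.
Variables (R : realType) (G : groupType) (K : hilbertType R) (e : G -> K).
Local Notation l2G := (l2 R G).

(** The analysis operator [W] is read off the Bessel bound, and [V] is defined as its adjoint, so no
    infinite sum of vectors is formed. *)
Lemma bessel_synthesis : is_bessel e ->
  exists (V : l2G -> K) (W : K -> l2G), [/\ bounded_map V, bounded_map W, adjoint_pair V W,
    forall g, V (chi R g) = e g & forall y g, W y g = '[y, e g]].
Proof.
move=> [B B0 eB].
have /choice[W WE] y : exists f : l2G, forall g, f g = '[y, e g].
  have l2y : (fun g => '[y, e g]) \in @l2_pred R G.
    by apply/asboolP; apply: le_lt_trans (eB y) (ltry _).
  by exists (L2 l2y).
have bW : bounded_map W.
  split.
    move=> a x y; apply: l2P => g.
    by rewrite -[RHS]/(a * W x g + W y g) !WE hdotDl hdotZl.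
  (* [B + 1] replaces the square root of [B], since [B <= (B + 1)^2]. *)
  exists (B + 1) => y; apply: hnorm_le; first by rewrite mulr_ge0 ?hnorm_ge0 // addr_ge0 ?ltW.
  rewrite -sqr_hnorm exprMn; apply: (@le_trans _ _ (B * hnorm y ^+ 2)).
    rewrite -lee_fin -sqsum_hnorm; apply: le_trans (eB y).
    by rewrite (_ : l2_fun (W y) = fun g => '[y, e g]) //; apply/funext => g; rewrite WE.
  by rewrite ler_wpM2r ?sqr_ge0 //; nra.
have [V bV WV] := adjoint_exists bW.
exists V, W; split=> //; first exact: adjoint_pair_sym.
move=> g; apply: hdot_inj => y; rewrite hdotC -WV hdot_chi WE.
by rewrite -hdotC.
Qed.

Lemma hdot_suml (H : hilbertType R) (I : Type) (s : seq I) (F : I -> H) z :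
  '[\sum_(i <- s) F i, z] = \sum_(i <- s) '[F i, z].
Proof. by elim/big_rec2: _ => [|i a b _ <-]; rewrite ?hdot0l ?hdotDl. Qed.

Lemma fsumT_seq (V : nmodType) (s : seq G) (F : G -> V) : uniq s ->
  (forall i, i \notin s -> F i = 0) -> \sum_(i \in [set: G]) F i = \sum_(i <- s) F i.
Proof.
move=> us F0; rewrite (fsbig_seq _ _ us); apply/esym/fsbig_widen => //.
by move=> i /= [_ /negP/F0].
Qed.

Lemma riesz_finite (a b : R) : (forall c : G -> R[i], finite_set [set i | c i != 0] ->
      a * (\sum_(i \in [set: G]) normc (c i) ^+ 2)
        <= hnorm (\sum_(i \in [set: G]) c i *: e i) ^+ 2
        <= b * (\sum_(i \in [set: G]) normc (c i) ^+ 2)) ->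
  forall (s : seq G) (c : G -> R[i]), uniq s ->
    a * (\sum_(i <- s) normc (c i) ^+ 2)
        <= hnorm (\sum_(i <- s) c i *: e i) ^+ 2
        <= b * (\sum_(i <- s) normc (c i) ^+ 2).
Proof.
move=> rsz s c us; pose d i := if i \in s then c i else 0.
have ds i : i \notin s -> d i = 0 by rewrite /d => /negPf ->.
have /rsz : finite_set [set i | d i != 0].
  apply: sub_finite_set (finite_seq s) => i /=.
  by apply: contraNT => /ds ->.
have sumE (V : nmodType) (F F' : G -> V) : (forall i, i \notin s -> F i = 0) ->
    (forall i, i \in s -> F i = F' i) ->
    \sum_(i \in [set: G]) F i = \sum_(i <- s) F' i.
  by move=> F0 FF'; rewrite (fsumT_seq us F0); exact: eq_big_seq.
rewrite (sumE R _ (fun i => normc (c i) ^+ 2)); first last.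
- by move=> i si; rewrite /d si.
- by move=> i /ds ->; rewrite Normc.normc0 expr0n.
rewrite (sumE K _ (fun i => c i *: e i)) // => i.
  by move=> /ds ->; rewrite scale0r.
by move=> si; rewrite /d si.
Qed.

(** Duality on finite sets: with the coefficients [<y, e g>], the sum [S] of their squared moduli is
    the inner product of the combination with [y]. Cauchy-Schwarz and the upper Riesz bound give
    [S^2 <= b S |y|^2]. *)
Lemma riesz_bessel : is_riesz e -> is_bessel e.
Proof.
move=> [a [b [a0 ab rsz]]]; have b0 : 0 < b by exact: lt_le_trans ab.
exists b => // y; apply/sqsum_leP => s us.
pose c g := '[y, e g]; set S := \sum_(x <- s) _.
have S0 : 0 <= S by apply: sumr_ge0 => i _; exact: sqr_ge0.
have /andP[_] := riesz_finite rsz c us; rewrite -/S => up.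
have SE : rdot (\sum_(i <- s) c i *: e i) y = S.
  rewrite /rdot hdot_suml; rewrite /S; elim/big_rec2: _ => [//|i u v _ uv].
  rewrite ReD uv; congr (_ + _); rewrite hdotZl /c (hdotC (e i)) Defs.sqr_normc.
  by case: '[y, e i] => p q /=; ring.
have := rdot_le (\sum_(i <- s) c i *: e i) y; rewrite SE => le1.
have le2 : S ^+ 2 <= b * S * hnorm y ^+ 2.
  apply: (@le_trans _ _ ((hnorm (\sum_(i <- s) c i *: e i) * hnorm y) ^+ 2)).
    by rewrite ler_sqr ?nnegrE ?mulr_ge0 ?hnorm_ge0.
  by rewrite exprMn ler_wpM2r ?sqr_ge0.
have [->|Sn0] := eqVneq S 0; first by rewrite mulr_ge0 ?sqr_ge0 // ltW.
have Sp : 0 < S by rewrite lt_def Sn0.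
by rewrite -(ler_pM2l Sp) -expr2 mulrCA mulrA.
Qed.

(** The Riesz inequality covers finitely supported vectors; these are dense, and both sides are
    continuous. *)
Lemma riesz_lower_bound (V : l2G -> K) : is_riesz e -> bounded_map V ->
  (forall g, V (chi R g) = e g) ->
  exists2 a : R, 0 < a & forall f, a * rdot f f <= rdot (V f) (V f).
Proof.
move=> [a [b [a0 ab rsz]]] bV Ve; exists a => // f.
pose C : set l2G := [set f | finite_set [set g | f g != 0]].
have Cle x : C x -> a * rdot x x <= rdot (V x) (V x).
  move=> Cx; pose s := enum_fset (fset_set [set g | x g != 0]).
  have us : uniq s by exact: fset_uniq.
  have sx g : g \notin s -> x g = 0.
    apply: contraNeq => xg.
    by have : g \in fset_set [set g | x g != 0] by rewrite in_fset_set //; exact/mem_set.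
  have xE : x = \sum_(g <- s) x g *: chi R g.
    apply: l2P => h; rewrite -[RHS]hdot_chi hdot_suml.
    under eq_bigr => g _ do rewrite hdotZl hdot_chi /=.
    have [hs|hs] := boolP (h \in s).
      rewrite (bigD1_seq h) //= eqxx mulr1 big1 ?addr0 // => g gh.
      by rewrite eq_sym (negPf gh) mulr0.
    rewrite sx // big1_seq // => g /= gs; rewrite (_ : h == g = false) ?mulr0 //.
    by apply: contraNF hs => /eqP ->.
  have xx : rdot x x = \sum_(g <- s) normc (x g) ^+ 2.
    rewrite {1}xE /rdot hdot_suml; elim/big_rec2: _ => [//|g u v _ uv].
    rewrite ReD uv; congr (_ + _).
    rewrite hdotZl hdotC hdot_chi Defs.sqr_normc; case: (x g) => p q /=; ring.
  have VxE : V x = \sum_(g <- s) x g *: e g.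
    rewrite {1}xE (lin_sum bV.1); apply: eq_bigr => g _.
    by rewrite (linZ bV.1) Ve.
  rewrite xx -(sqr_hnorm (V x)) VxE.
  by have /andP[] := riesz_finite rsz x us.
have C_lin c x y : C x -> C y -> C (c *: x + y).
  move=> Cx Cy; apply: sub_finite_set (_ : finite_set ([set g | x g != 0] `|` [set g | y g != 0])).
    move=> g; suff : c * x g + y g != 0 -> x g != 0 \/ y g != 0 by [].
    have [->|] := eqVneq (x g) 0; last by left.
    by rewrite mulr0 add0r; right.
  by rewrite finite_setU.
have C0 : C 0.
  apply: sub_finite_set (finite_set0 G) => g.
  by have /negP : ~~ ((0 : R[i]) != 0) by rewrite eqxx.
have Cchi h : C (chi R h).
  apply: sub_finite_set (finite_set1 h) => g /=.
  by have [//|] := eqVneq g h; rewrite eqxx.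
have Cort x : (forall z, C z -> '[x, z] = 0) -> x = 0.
  move=> xC; apply: l2_orthogonal_chi => h; rewrite hdotC xC //.
  by rewrite rmorph0.
have [u Cu uf] := hcl_seq (hcl_dense C_lin C0 Cort f).
have Vu := bounded_map_cvg bV uf.
suff : Num.sqrt a * hnorm f <= hnorm (V f).
  move=> h; rewrite -!sqr_hnorm -(sqr_sqrtr (ltW a0)) -exprMn.
  by rewrite ler_sqr ?nnegrE ?mulr_ge0 ?hnorm_ge0 ?sqrtr_ge0.
have {}Cle x : C x -> Num.sqrt a * hnorm x <= hnorm (V x).
  move=> Cx; rewrite -ler_sqr ?nnegrE ?mulr_ge0 ?hnorm_ge0 ?sqrtr_ge0 //.
  by rewrite exprMn sqr_sqrtr ?(ltW a0) // !sqr_hnorm; exact: Cle.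
apply/ler_addgt0Pl => r r0; have r2 : 0 < r / 2 by rewrite divr_gt0.
have sa1 : 0 < Num.sqrt a + 1 by rewrite ltr_wpDl ?sqrtr_ge0.
have [N uN] := uf _ (divr_gt0 r2 sa1); have [n Vn] := Vu _ r2.
have := uN _ (leq_maxl N n); have := Vn _ (leq_maxr N n); set k := maxn N n => /= h1.
rewrite ltr_pdivlMr // => h2; have := Cle _ (Cu k).
have := ler_wpM2l (sqrtr_ge0 a) (ler_hnormB (u k) (u k - f)).
have := ler_hnormD (V (u k) - V f) (V f); rewrite subKr subrK mulrDr.
have := hnorm_ge0 (u k - f); lra.
Qed.

End synthesis.

Section intertwining.
Variables (R : realType) (G : groupType) (K : hilbertType R) (sigma : unirep G K).
Local Notation l2G := (l2 R G).
Local Notation rho := (rreg R G).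
Variables (x : K) (V : l2G -> K) (W : K -> l2G).
Hypothesis bV : bounded_map V.
Hypothesis VW : adjoint_pair V W.
Hypothesis Vchi : forall g, V (chi R g) = sigma g^-1%g x.

(** [rho h] sends [chi g] to [chi (g h^-1)]; this is why [Vchi] carries an inverse and why orbits
    are reindexed by inversion below. *)
Lemma synthesis_rreg h f : V (rho h f) = sigma h (V f).
Proof.
have brho : bounded_map (rho h) := rep_bounded (imageT rho h).
have bsig : bounded_map (sigma h) := rep_bounded (imageT sigma h).
apply: (@l2_ext _ _ _ (V \o rho h) (sigma h \o V)) => [||g].
- exact: bounded_map_comp bV brho.
- exact: bounded_map_comp bsig bV.
rewrite -[LHS]/(V (rho h (chi R g))) -[RHS]/(sigma h (V (chi R g))).
by rewrite rreg_chi !Vchi invgM invgK repMx.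
Qed.

Lemma analysis_rreg h y : W (sigma h y) = rho h (W y).
Proof.
apply: hdot_inj => f; rewrite (adjoint_pair_sym VW) [RHS]rep_adjoint (adjoint_pair_sym VW).
by rewrite synthesis_rreg -rep_adjoint.
Qed.

End intertwining.

Lemma riesz_inv (R : realType) (G : groupType) (K : hilbertType R) (e : G -> K) :
  is_riesz e -> is_riesz (fun g => e g^-1%g).
Proof.
move=> [a [b [a0 ab rsz]]]; exists a, b; split=> // c fc.
have sumE (V : nmodType) (F : G -> V) :
    \sum_(i \in [set: G]) F i = \sum_(i \in [set: G]) F i^-1%g.
  by apply: (reindex_fsbigT (fun i => i^-1)%g); exists (fun i => i^-1)%g => i; rewrite invgK.
have -> : \sum_(i \in [set: G]) c i *: e i^-1%g = \sum_(i \in [set: G]) c i^-1%g *: e i.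
  by rewrite sumE; apply: eq_fsbigr => i _; rewrite invgK.
rewrite (sumE R); apply: (rsz (fun i => c i^-1%g)).
apply: sub_finite_set (finite_image (fun i => i^-1)%g fc) => i ci.
by exists i^-1%g => //; rewrite invgK.
Qed.

(** * From an isomorphism to a dual pair *)

Section dual_pair_of_isomorphism.
Variables (R : realType) (G : groupType).
Hypothesis iccG : icc G.
Local Notation l2G := (l2 R G).
Local Notation lam := (lreg R G).
Local Notation rho := (rreg R G).
Local Notation M := (commutant (range lam)).
Local Notation chi1 := (chi R (1%g : G)).
Variables (K : hilbertType R) (pi : unirep G K) (xi : K).
Local Notation N := (commutant (range pi)).
Hypothesis xi_frame : complete_frame_vector pi xi.
Hypothesis xi_trace : forall S T, N S -> N T -> '[S (T xi), xi] = '[T (S xi), xi].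
Hypothesis xi_total : forall y, (forall g, '[y, pi g xi] = 0) -> y = 0.
Variable Phi : (l2G -> l2G) -> (K -> K).
Hypothesis Phi_bij : set_bij M N Phi.
Hypothesis Phi_lin : forall (a : R[i]) S T, M S -> M T ->
  Phi (a \*: S \+ T) = a \*: Phi S \+ Phi T.
Hypothesis Phi_mul : forall S T, M S -> M T -> Phi (S \o T) = Phi S \o Phi T.
Hypothesis Phi_adj : forall S T, M S -> M T -> is_adjoint S T ->
  is_adjoint (Phi S) (Phi T).

Let bl := rep_bounded (pi := lam).
Let bp := rep_bounded (pi := pi).
Let NPhi S (MS : M S) : N (Phi S) := iso_fun Phi_bij MS.
Let Mid : M id := commutant_id (range lam).
Let Mrho g : M (rho g) := rreg_commutant R g.
Let Phi_id : Phi id = id := iso_id Phi_bij Phi_mul.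

Let Phi_comp S T y : M S -> M T -> Phi (fun f => S (T f)) y = Phi S (Phi T y).
Proof. by move=> MS MT; rewrite -[LHS]/(Phi (S \o T) y) Phi_mul. Qed.

Let Phi_comb (a b : R[i]) S T y : M S -> M T ->
  Phi (fun f => a *: S f + b *: T f) y = a *: Phi S y + b *: Phi T y.
Proof.
move=> MS MT; pose Z (f : l2G) : l2G := 0.
have ZE : Z = -1 \*: S \+ S by apply/funext => f /=; rewrite scaleN1r addNr.
have MZ : M Z by rewrite ZE; exact (commutant_lin bl _ MS MS).
have PZ : Phi Z y = 0 by rewrite ZE Phi_lin //= scaleN1r addNr.
have -> : (fun f => a *: S f + b *: T f) = a \*: S \+ (b \*: T \+ Z).
  by apply/funext => f /=; rewrite addr0.
rewrite (Phi_lin _ MS (commutant_lin bl b MT MZ)) (Phi_lin _ MT MZ) /=.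
by rewrite PZ addr0.
Qed.

Let phi T := '[Phi T xi, xi].

(** The trace property at [xi] cancels the two factors [rho g] and [rho g^-1]. *)
Let phi_conj_hull T A : M T -> conj_hull T A -> phi A = phi T.
Proof.
move=> MT; elim=> [g|A1 A2 h1 e1 h2 e2].
  rewrite /phi (Phi_comp _ (Mrho g) (commutant_comp MT (Mrho g^-1))).
  rewrite (xi_trace (NPhi (Mrho g)) (NPhi (commutant_comp MT (Mrho g^-1)))).
  rewrite Phi_comp // -[X in '[Phi T X, _]](Phi_comp _ (Mrho g^-1) (Mrho g)).
  have -> : (fun f => rho g^-1%g (rho g f)) = id by apply/funext => f; rewrite repK.
  by rewrite Phi_id.
have MA1 := conj_hull_commutant MT h1; have MA2 := conj_hull_commutant MT h2.
by rewrite /phi Phi_comb // hdotDl !hdotZl -!/(phi _) e1 e2 half_plus_half.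
Qed.

(** Averages of conjugates of [T] tend to the scalar [tau T] in the trace norm;
    were [phi] to separate them from it, [phi] would not be normal. *)
Lemma trace_unique T : M T -> phi T = T chi1 1%g * '[xi, xi].
Proof.
move=> MT; apply: contrapT => /eqP; rewrite -subr_eq0; set z := _ - _ => z0.
pose t := T chi1 1%g.
have [m m0 Tm] := bounded_mapP MT.1.
have n0 (w : R[i]) : 0 <= normc w by case: w => ? ?; exact: sqrtr_ge0.
(* [k] bounds the norm of every [A n - t], so dividing by it makes [D n] a contraction. *)
pose k := m + normc t; have k0 : 0 < k by rewrite ltr_pwDl.
have kV : 0 < k^-1 by rewrite invr_gt0.
have e20 n : 0 < k * 2^-1 ^+ n by rewrite mulr_gt0 // exprn_gt0 // invr_gt0.
have /choice[A AP] n : exists A, conj_hull T A /\ hnorm (A chi1 - t *: chi1) < k * 2^-1 ^+ n.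
  by have [A hA An] := averaging iccG MT (e20 n); exists A.
have MA n : M (A n) by have [hA _] := AP n; exact: conj_hull_commutant hA.
pose D n f := k^-1%:C%C *: A n f + (- (k^-1%:C%C * t)) *: f.
have DE n f : D n f = k^-1%:C%C *: (A n f - t *: f).
  by rewrite /D scalerBr scalerA scaleNr.
have MD n : M (D n) by exact: (commutant_comb _ _ (MA n) Mid).
have /choice[E EP] n : exists E, M E /\ is_adjoint (D n) E.
  by have [E ME DEn] := rep_commutant_adjoint (MD n); exists E.
have ME n : M (E n) by have [] := EP n.
have aDE n : is_adjoint (D n) (E n) by have [] := EP n.
have BE n x : rdot (E n (D n x)) x = rdot (D n x) (D n x).
  by rewrite (rdot_adjoint (adjoint_pair_sym (aDE n))).
have phiD n : '[Phi (D n) xi, xi] = k^-1%:C%C * z.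
  rewrite /D (Phi_comb _ _ _ (MA n) Mid) Phi_id hdotDl !hdotZl -/(phi _).
  have [hA _] := AP n; rewrite (phi_conj_hull MT hA) /z -/t.
  by rewrite mulrBr mulrA mulNr.
have xi0 : 0 < hnorm xi.
  rewrite lt_def hnorm_ge0 andbT; apply: contra z0 => /eqP/hnorm_eq0 xi0.
  by rewrite /z /phi xi0 !hdot0r mulr0 subrr.
have z1 : 0 < normc z.
  by rewrite lt_def n0 andbT; apply: contra z0 => /eqP/Normc.eq0_normc ->.
(* By Cauchy-Schwarz this is a lower bound for [|Phi (D n) xi|^2], as [<Phi (D n) xi, xi> = k^-1 z]
   for every [n]. *)
pose e := (k^-1 * normc z / hnorm xi) ^+ 2.
have e0 : 0 < e by rewrite exprn_gt0 // divr_gt0 // mulr_gt0.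
apply: (@iso_normal _ _ _ _ _ bl bp (@rep_range_adjoint _ _ _ lam) _ Phi_bij Phi_lin
  Phi_mul Phi_adj chi1 (@commutant_separating R G) (fun n => E n \o D n) xi e e0).
- by move=> n; exact: commutant_comp.
- move=> n x y; exact: etrans (adjoint_pair_sym (aDE n) (D n x) y) (aDE n x (D n y)).
- by move=> n x; rewrite BE rdotxx_ge0.
- move=> n x; rewrite BE -!sqr_hnorm ler_sqr ?nnegrE ?hnorm_ge0 //.
  rewrite DE hnormZr ?(ltW kV) // ler_pdivrMl //.
  apply: le_trans (ler_hnormB _ _) _; rewrite hnormZ /k mulrDl lerD2r.
  by have [hA _] := AP n; exact: conj_hull_bound hA x.
- move=> n; rewrite BE -sqr_hnorm DE hnormZr ?(ltW kV) // exprMn.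
  have [_ /ltW An] := AP n; set q := 2^-1 ^+ n in An *.
  have q0 : 0 < q by rewrite exprn_gt0 // invr_gt0.
  have h : hnorm (A n chi1 - t *: chi1) ^+ 2 <= (k * q) ^+ 2.
    by rewrite ler_sqr ?nnegrE ?hnorm_ge0 // ltW // mulr_gt0.
  apply: (@le_trans _ _ (q ^+ 2)).
    have -> : q ^+ 2 = k^-1 ^+ 2 * (k * q) ^+ 2 by field; rewrite gt_eqF.
    by rewrite ler_pM2l ?exprn_gt0.
  rewrite expr2 ger_pMr //.
  by apply: exprn_ile1; rewrite ?invr_ge0 // invf_le1 // ler1n.
- move=> n; rewrite (Phi_comp _ (ME n) (MD n)).
  rewrite (rdot_adjoint (adjoint_pair_sym (Phi_adj (MD n) (ME n) (aDE n)))).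
  rewrite -sqr_hnorm /e ler_sqr ?nnegrE ?hnorm_ge0 //; last first.
    by rewrite divr_ge0 ?mulr_ge0 ?hnorm_ge0 ?n0 // ltW.
  rewrite ler_pdivrMr //; apply: le_trans (normc_hdot_le _ _).
  by rewrite phiD Normc.normcM [normc _%:C%C]/= expr0n addr0 sqrtr_sqr ger0_norm // ltW.
Qed.

Let sigma_isometry g x y : '[Phi (rho g) x, Phi (rho g) y] = '[x, y].
Proof.
rewrite (Phi_adj (Mrho g) (Mrho g^-1) (rep_adjoint rho g)).
rewrite -(Phi_comp _ (Mrho g^-1) (Mrho g)).
have -> : (fun f => rho g^-1%g (rho g f)) = id by apply/funext => f; rewrite repK.
by rewrite Phi_id.
Qed.

Let sigma1 : Phi (rho 1%g) = id.
Proof. by rewrite (rep1 rho). Qed.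

Let sigmaM g h : Phi (rho (g * h)%g) = Phi (rho g) \o Phi (rho h).
Proof. by rewrite repM Phi_mul. Qed.

Let sigma : unirep G K :=
  Unirep (fun g => (NPhi (Mrho g)).1.1) sigma_isometry sigma1 sigmaM.

Let c := rdot xi xi.

(** If [xi] were zero, totality of its orbit would make [K] zero, and injectivity of [Phi] would
    make [l2(G)] zero too. *)
Let c_gt0 : 0 < c.
Proof.
rewrite lt_def rdotxx_ge0 andbT; apply/eqP => /rdotxx_eq0 xi0.
have K0 (y : K) : y = 0.
  by apply: xi_total => g; rewrite xi0 (lin0 (rep_linear pi g)) hdot0r.
have Mz : M (fun f => 0 *: f + 0 *: f) := commutant_comb 0 0 Mid Mid.
have : id = (fun f : l2G => 0 *: f + 0 *: f).
  by apply: (iso_inj Phi_bij) => //; apply/funext => y; rewrite (K0 (Phi id y)) [RHS]K0.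
move=> /(congr1 (fun F : l2G -> l2G => F chi1 1%g)); rewrite /= !scale0r addr0.
by rewrite eqxx => /eqP; rewrite oner_eq0.
Qed.

(** The left side is [phi] of [rho g^-1] after [T], so [trace_unique] applies. *)
Let sigma_dot T g : M T -> '[Phi T xi, sigma g xi] = (T chi1 g^-1%g) * c%:C%C.
Proof.
move=> MT; rewrite -[in LHS](invgK g) -rep_adjoint -hdotxx.
rewrite -[sigma _ _]/(Phi (rho g^-1%g) (Phi T xi)) -(Phi_comp _ (Mrho g^-1) MT).
rewrite -[LHS]/(phi _) trace_unique; last exact: commutant_comp (Mrho g^-1) MT.
by rewrite /= mul1g.
Qed.

Let sigma_orth g h : '[sigma g xi, sigma h xi] = (g == h)%:R * c%:C%C.
Proof.
rewrite (sigma_dot h (Mrho g)) rreg_chi mul1g /=.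
by rewrite (can_eq (@invgK G)) eq_sym.
Qed.

Let sigma_sum_norm (s : seq G) (a : G -> R[i]) : uniq s ->
  hnorm (\sum_(i <- s) a i *: sigma i xi) ^+ 2 = c * \sum_(i <- s) normc (a i) ^+ 2.
Proof.
move=> us; rewrite sqr_hnorm.
have dotg g : g \in s -> '[sigma g xi, \sum_(i <- s) a i *: sigma i xi] = Num.conj (a g) * c%:C%C.
  move=> gs; rewrite hdotC hdot_suml (bigD1_seq g) //= big1 ?addr0.
    by rewrite hdotZl sigma_orth eqxx mul1r rmorphM; congr (_ * _); exact: conj_real.
  by move=> i ig; rewrite hdotZl sigma_orth (negPf ig) mul0r mulr0.
rewrite {1}/rdot hdot_suml.
rewrite (eq_big_seq (fun g => (c * normc (a g) ^+ 2)%:C%C)); last first.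
  move=> g gs /=; rewrite hdotZl dotg // mulrA Defs.sqr_normc.
  case: (a g) => p q; apply/eqP; rewrite eq_complex /=.
  by apply/andP; split; apply/eqP; ring.
by rewrite mulr_sumr; elim/big_rec2: _ => [//|i u v _ <-]; rewrite ReD.
Qed.

(** Bessel's inequality for an orthogonal family of squared norm [c]: expand the square of
    [y - c^-1 p]. *)
Let sigma_bessel : is_bessel (fun g => sigma g xi).
Proof.
exists c => // y; apply/sqsum_leP => s us; set S := \sum_(x <- s) _.
pose p := \sum_(i <- s) '[y, sigma i xi] *: sigma i xi.
have pp : rdot p p = c * S by rewrite -sqr_hnorm sigma_sum_norm.
have py : rdot y p = S.
  rewrite rdotC /rdot hdot_suml /S; elim/big_rec2: _ => [//|i u v _ uv].
  rewrite ReD uv; congr (_ + _); rewrite hdotZl (hdotC (sigma i xi)) Defs.sqr_normc.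
  by case: '[y, sigma i xi] => q r /=; ring.
have := rdotxx_ge0 (y - c^-1%:C%C *: p).
rewrite hnormB_sq !(rdotZl, rdotZr) pp py sqr_hnorm => h.
have -> : S = c * (c^-1 * S) by rewrite mulVKf // gt_eqF.
rewrite ler_pM2l // -subr_ge0; apply: le_trans h _; rewrite le_eqVlt; apply/orP; left.
by apply/eqP; field; rewrite gt_eqF.
Qed.

Let sigma_riesz : is_riesz (fun g => sigma g xi).
Proof.
exists c, c; split=> // a fa.
pose s := enum_fset (fset_set [set i | a i != 0]).
have us : uniq s by exact: fset_uniq.
have as0 i : i \notin s -> a i = 0.
  apply: contraNeq => ai.
  by have : i \in fset_set [set i | a i != 0] by rewrite in_fset_set //; exact/mem_set.
rewrite !(fsumT_seq us) => [||i /as0 ->]; last first.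
- by rewrite Normc.normc0 expr0n.
- by move=> i /as0 ->; rewrite scale0r.
by rewrite sigma_sum_norm // lexx.
Qed.

Let bessel_inv : is_bessel (fun g => sigma g^-1%g xi).
Proof.
have [B B0 sB] := sigma_bessel; exists B => // y; apply/sqsum_leP => s us.
have /sqsum_leP/(_ [seq x^-1%g | x <- s]) := sB y.
rewrite map_inj_uniq; last exact: (can_inj (@invgK G)).
by rewrite big_map; exact.
Qed.

Let eq_on_orbit (S T : K -> K) : bounded_operator S -> bounded_operator T ->
  (forall g, S (pi g xi) = T (pi g xi)) -> S = T.
Proof.
move=> bS bT ST; apply: (@total_ext _ _ _ (range (fun g => pi g xi))) => // [x xpi|_ [g _ <-] //].
by apply: xi_total => g; apply: xpi; exists g.
Qed.

(** For [y] commuting with [sigma], the coefficients of [y] between translates of the range of [V]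
    are operators on [l2(G)] commuting with [rho]. They commute with [X] by [commutation], and
    [V (X chi1) = Phi X xi] turns this into commutation of [y] with [Phi X]. *)
Let commutant_sigma T : N T -> commutant (commutant (range sigma)) T.
Proof.
move=> NT; split; first exact: NT.1.
have [X MX <-] := iso_surj Phi_bij NT.
have [X' MX' XX'] := rep_commutant_adjoint MX.
have aPX := Phi_adj MX MX' XX'.
have [V [W [bV bW VW Vchi WE]]] := bessel_synthesis bessel_inv.
have Vchi1 : V chi1 = xi by rewrite Vchi invg1 (rep1 sigma).
have Vrho := synthesis_rreg (sigma := sigma) bV Vchi.
have Wsigma := analysis_rreg bV VW (sigma := sigma) Vchi.
have WV f : W (V f) = c%:C%C *: f.
  have bc : bounded_map (fun f : l2G => c%:C%C *: f).
    split=> [a x y|]; first by rewrite scalerDr !scalerA mulrC.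
    by exists c => x; rewrite hnormZr // ltW.
  apply: (@l2_ext _ _ _ (W \o V) _ _ bc) => [|g]; first exact: bounded_map_comp bW bV.
  apply: l2P => h; rewrite /= Vchi WE sigma_orth -[RHS]/(c%:C%C * (h == g)%:R) mulrC.
  by rewrite (can_eq (@invgK G)) eq_sym.
(* Both vectors have squared norm [c |Y chi1|^2], and so does their inner product; hence their
   difference is zero. *)
have VX Y : M Y -> V (Y chi1) = Phi Y xi.
  move=> MY; have WPhi : W (Phi Y xi) = c%:C%C *: Y chi1.
    by apply: l2P => g; rewrite WE sigma_dot // invgK mulrC.
  have [Y' MY' YY'] := rep_commutant_adjoint MY.
  have n2 : '[Phi Y xi, Phi Y xi] = c%:C%C * '[Y chi1, Y chi1].
    rewrite -(adjoint_pair_sym (Phi_adj MY MY' YY')) -(Phi_comp _ MY' MY) -/(phi _).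
    rewrite trace_unique; last exact: commutant_comp MY' MY.
    by rewrite -hdot_chi (adjoint_pair_sym YY') mulrC (hdotxx xi).
  apply/eqP; rewrite -subr_eq0; apply/eqP/rdotxx_eq0; rewrite hnormB_sq.
  rewrite (rdot_adjoint VW) (rdot_adjoint VW) WV WPhi !rdotZr.
  by rewrite {3}/rdot n2 ReZ -/(rdot _ _); ring.
move=> y sy; apply/esym; apply: eq_on_orbit => [||g].
- exact: bounded_map_comp sy.1 (NPhi MX).1.
- exact: bounded_map_comp (NPhi MX).1 sy.1.
have Npi (T' : K -> K) h x : N T' -> T' (pi h x) = pi h (T' x) by exact: rep_commutantE.
have pisig h k x : pi h (sigma k x) = sigma k (pi h x).
  by rewrite -[RHS]/(Phi (rho k) (pi h x)) (rep_commutantE _ _ (NPhi (Mrho k))).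
apply/eqP; rewrite -subr_eq0; apply/eqP/xi_total => h; rewrite hdotBl.
pose B f := W (pi h^-1%g (y (pi g (V f)))).
have MB : commutant (range rho) B.
  apply: rep_commutantP => [|k f]; last first.
    by rewrite /B Vrho pisig rep_commutantE // pisig Wsigma.
  have bpi k : bounded_map (pi k) by apply: bp; exists k.
  apply: bounded_map_comp bW (bounded_map_comp (bpi _) _).
  exact: bounded_map_comp sy.1 (bounded_map_comp (bpi g) bV).
have BE f f' : '[B f, f'] = '[y (pi g (V f)), pi h (V f')].
  by rewrite (adjoint_pair_sym VW) rep_adjoint invgK.
rewrite /= (Npi _ _ _ (NPhi MX)) -VX // -{1}Vchi1 -BE -(commutation MX MB) XX' BE.
rewrite Vchi1 VX // -(Npi _ _ _ (NPhi MX')) -aPX.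
by rewrite subrr.
Qed.

Lemma dual_pair_of_isomorphism : exists sigma : unirep G K, dual_pair pi sigma.
Proof.
exists sigma; split.
- by exists xi.
- apply/seteqP; split=> T; first exact: commutant_sigma.
  move=> sT; apply: rep_commutantP => [|g x]; first exact: sT.1.
  have := sT.2 (pi g); move=> /(_ _)/(congr1 (@^~ x)); apply.
  apply: rep_commutantP => [|h y]; first by apply: bp; exists g.
  exact: esym (rep_commutantE g y (NPhi (Mrho h))).
- by exists xi; split; [exact: xi_frame|exact: sigma_bessel].
- by exists xi; exact: sigma_riesz.
Qed.

End dual_pair_of_isomorphism.

(** * From a dual pair to an isomorphism *)

(** Bernoulli's inequality for [u / q = 1 + h]. *)
Lemma expr_unbounded (R : realType) (u q n d : R) : 0 < q -> q < u -> 0 < n ->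
  (forall k : nat, u ^+ k * n <= d * q ^+ k) -> False.
Proof.
move=> q0 qu n0 ud; pose h := u / q - 1.
have h0 : 0 < h by rewrite subr_gt0 ltr_pdivlMr // mul1r.
have bern k : 1 + k%:R * h <= (u / q) ^+ k.
  elim: k => [|k IH]; first by rewrite mul0r addr0 expr0.
  have -> : u / q = 1 + h by rewrite /h addrC subrK.
  rewrite exprS; move: IH; have -> : u / q = 1 + h by rewrite /h addrC subrK.
  rewrite -natr1 => IH.
  have := ler_wpM2l (addr_ge0 ler01 (ltW h0)) IH.
  apply: le_trans; have : 0 <= k%:R * h * h by rewrite !mulr_ge0 // ltW.
  nra.
have bound k : (u / q) ^+ k * n <= d.
  by rewrite expr_div_n mulrAC ler_pdivrMr ?exprn_gt0.
have dn : 0 <= d / n / h.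
  have := bound 0%N; rewrite expr0 mul1r => nd.
  by rewrite !divr_ge0 ?ltW // (lt_le_trans n0).
have := archi_boundP dn; set k := Num.bound _.
rewrite !ltr_pdivrMr // => lt1.
have := le_trans (ler_wpM2r (ltW n0) (bern k)) (bound k).
by rewrite mulrDl mul1r; lra.
Qed.

Section isomorphism_of_dual_pair.
Variables (R : realType) (G : groupType).
Local Notation l2G := (l2 R G).
Local Notation lam := (lreg R G).
Local Notation rho := (rreg R G).
Local Notation M := (commutant (range lam)).
Local Notation M' := (commutant (range rho)).
Local Notation chi1 := (chi R (1%g : G)).
Variables (K : hilbertType R) (pi : unirep G K).
Local Notation N := (commutant (range pi)).
Hypothesis irreducible : forall v d : K,
  (forall n g, N n -> '[v, n (pi g d)] = 0) -> v = 0 \/ d = 0.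
Variable sigma : unirep G K.
Local Notation Sg := (commutant (range sigma)).
Hypothesis NE : N = commutant Sg.
Variables (V : l2G -> K) (W : K -> l2G) (a : R).
Hypothesis bV : bounded_map V.
Hypothesis bW : bounded_map W.
Hypothesis VW : adjoint_pair V W.
Hypothesis Vrho : forall h f, V (rho h f) = sigma h (V f).
Hypothesis Wsigma : forall h y, W (sigma h y) = rho h (W y).
Hypothesis a0 : 0 < a.
Hypothesis V_ge : forall f, a * rdot f f <= rdot (V f) (V f).

Let WVadj : adjoint_pair W V := adjoint_pair_sym VW.
Let bs := rep_bounded (pi := sigma).

(** [L] is [(W V)^-1 W]; the inverse exists by the lower bound on [V] and commutes with [rho]
    because [W V] does. *)
Lemma synthesis_left_inverse : exists L : K -> l2G, [/\ bounded_map L, forall f, L (V f) = f &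
  forall h y, L (sigma h y) = rho h (L y)].
Proof.
pose X f := W (V f).
have bX : bounded_operator X := bounded_map_comp bW bV.
have aX : is_adjoint X X by move=> f f'; rewrite WVadj VW.
have [f|Q [bQ XQ QX]] := self_adjoint_inverse a0 bX aX.
  by rewrite (rdot_adjoint WVadj); exact: V_ge.
have MX : M' X by apply: rep_commutantP => // h f; rewrite /X Vrho Wsigma.
have MQ : M' Q := commutant_inverse MX bQ XQ QX.
exists (Q \o W); split; first exact: bounded_map_comp bQ bW.
- by move=> f; have /(congr1 (@^~ f)) := QX.
- by move=> h y; rewrite /= Wsigma (rep_commutantE _ _ MQ).
Qed.

Let D : set K := [set z | exists y f, Sg y /\ z = y (V f)].

Let Sg_id : Sg id := commutant_id (range sigma).

Let NSg n y x : N n -> Sg y -> n (y x) = y (n x).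
Proof. by rewrite NE => Nn Sy; exact: (commutantE Nn Sy). Qed.

(** [sigma(G)] lies in its bicommutant, which is [N] by [NE]. *)
Let Sgpi g : Sg (pi g).
Proof.
apply: rep_commutantP => [|h y]; first by apply: (rep_bounded (pi := pi)); exists g.
have Nh : N (sigma h).
  rewrite NE; split=> [|y' Sy']; first by apply: bs; exists h.
  by apply/funext => z; rewrite /= (rep_commutantE _ _ Sy').
by rewrite (rep_commutantE _ _ Nh).
Qed.

Variable L : K -> l2G.
Hypothesis bL : bounded_map L.
Hypothesis LV : forall f, L (V f) = f.
Hypothesis Lsigma : forall h y, L (sigma h y) = rho h (L y).

Let Sg_lift B : M' B -> Sg (fun y => V (B (L y))).
Proof.
move=> MB; apply: rep_commutantP => [|h y].
  exact: bounded_map_comp bV (bounded_map_comp MB.1 bL).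
by rewrite Lsigma (rep_commutantE _ _ MB) Vrho.
Qed.

Let compress n := fun f => L (n (V f)).

(** The idempotent [V L] commutes with [sigma], hence with [n]: the range of [V] is invariant under
    [N]. *)
Let VcompressE n f : N n -> V (compress n f) = n (V f).
Proof.
move=> Nn; have := NSg (V f) Nn (Sg_lift (commutant_id (range rho))).
by rewrite LV.
Qed.

Let compress_commutant n : N n -> M (compress n).
Proof.
move=> Nn; apply: rep_commutantP => [|g f].
  exact: bounded_map_comp bL (bounded_map_comp Nn.1 bV).
rewrite -[RHS]LV; congr (L _).
have := NSg (V f) Nn (Sg_lift (lreg_commutant R g)); rewrite LV => ->.
by [].
Qed.

Let V1_neq0 : V chi1 <> 0.
Proof.
move=> V0; have := V_ge chi1; rewrite V0 rdot0l /rdot hdot_chi /= eqxx /= mulr1.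
by rewrite leNgt a0.
Qed.

(** For [n] in [N], [n (pi g (V chi1))] equals [pi g (V (compress n chi1))], which lies in [D];
    irreducibility applies to [v] and the nonzero vector [V chi1]. *)
Let D_total v : (forall z, D z -> '[v, z] = 0) -> v = 0.
Proof.
move=> vD; have [//|/V1_neq0[]] : v = 0 \/ V chi1 = 0.
apply: irreducible => n g Nn; rewrite (rep_commutantE _ _ Nn) -(VcompressE _ Nn).
by apply: vD; exists (pi g), (compress n chi1).
Qed.

(** The operator [C = W y'^* y V] commutes with [rho], so [commutation] moves [B'] past it. *)
Let hdot_term y y' (A B B' : l2G -> l2G) f f' : Sg y -> Sg y' -> is_adjoint B B' -> M B' ->
  '[y (V (A f)), y' (V (B f'))] = '[y (V (B' (A f))), y' (V f')].
Proof.
move=> Sy Sy' BB' MB'.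
have [y2 Sy2 yy2] := rep_commutant_adjoint Sy'.
pose C u := W (y2 (y (V u))).
have MC : M' C.
  apply: rep_commutantP => [|h u].
    exact: bounded_map_comp bW (bounded_map_comp Sy2.1 (bounded_map_comp Sy.1 bV)).
  by rewrite /C Vrho (rep_commutantE _ _ Sy) (rep_commutantE _ _ Sy2) Wsigma.
have CE u w : '[y (V u), y' (V w)] = '[C u, w].
  by rewrite (adjoint_pair_sym VW) (adjoint_pair_sym yy2).
by rewrite !CE -(commutation MB' MC) (adjoint_pair_sym BB').
Qed.

Definition extends T x := bounded_operator x /\
  forall y f, Sg y -> x (y (V f)) = y (V (T f)).

Let extends_unique T x x' : extends T x -> extends T x' -> x = x'.
Proof.
move=> [bx xT] [bx' xT']; apply: total_ext D_total bx bx' _ => _ [y [f [Sy ->]]].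
by rewrite xT // xT'.
Qed.

Let extends_commutant T x : extends T x -> N x.
Proof.
move=> [bx xT]; rewrite NE; split=> // y Sy.
apply: total_ext D_total _ _ _ => [||_ [y' [f [Sy' ->]]]].
- exact: bounded_map_comp bx Sy.1.
- exact: bounded_map_comp Sy.1 bx.
have Syy' : Sg (y \o y') by exact: commutant_comp.
by rewrite /= (xT y' f Sy') -[y (y' _)]/((y \o y') _) xT.
Qed.

Let compress_extends n : N n -> extends (compress n) n.
Proof. by move=> Nn; split=> [|y f Sy]; [exact: Nn.1|rewrite VcompressE // NSg]. Qed.

Let term := ({y : K -> K | Sg y} * l2G)%type.

(** [X s id] runs through the span of [D], and [X s T] is the image prescribed for it by
    [extends]. *)
Let X (s : seq term) (A : l2G -> l2G) : K := \sum_(p <- s) sval p.1 (V (A p.2)).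

Let hdot_X s r A B B' : is_adjoint B B' -> M B' ->
  '[X s A, X r B] = '[X s (B' \o A), X r id].
Proof.
move=> BB' MB'; rewrite /X !hdot_suml; apply: eq_bigr => p _.
rewrite hdotC [RHS]hdotC !hdot_suml; congr Num.conj; apply: eq_bigr => q _.
rewrite hdotC [RHS]hdotC; congr Num.conj.
exact: hdot_term (svalP p.1) (svalP q.1) BB' MB'.
Qed.

(** With [S = T^* T], the moments [<X s S^k, X s>] are log-convex in [k] and grow
    at most like [t^(2k)], which bounds their ratio at [k = 0]. *)
Let X_bound (T : l2G -> l2G) (t : R) : M T -> 0 < t -> (forall f, hnorm (T f) <= t * hnorm f) ->
  forall s, hnorm (X s T) <= t * hnorm (X s id).
Proof.
move=> MT t0 Tt s; have [T' MT' TT'] := rep_commutant_adjoint MT.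
pose S f := T' (T f).
have MS : M S by exact: (commutant_comp MT' MT).
have aS : is_adjoint S S by move=> f f'; rewrite (adjoint_pair_sym TT') TT'.
have T't f : hnorm (T' f) <= t * hnorm f.
  apply: hnorm_bound (ltW t0) _; rewrite (rdot_adjoint (adjoint_pair_sym TT')).
  rewrite rdotC; apply: le_trans (rdot_le _ _) _.
  rewrite mulrA; apply: ler_wpM2r; rewrite ?hnorm_ge0 //; exact: Tt.
pose q := t * t; have q0 : 0 < q by rewrite mulr_gt0.
have Sq f : hnorm (S f) <= q * hnorm f.
  by apply: le_trans (T't _) _; rewrite -mulrA ler_pM2l.
pose Sk k f := iter k S f.
have MSk k : M (Sk k).
  elim: k => [|k IH]; first exact: commutant_id.
  exact: (commutant_comp MS IH).
have aSk k : is_adjoint (Sk k) (Sk k).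
  elim: k => [//|k IH] f f'.
  by rewrite /Sk [in LHS]iterS aS IH /Sk -iterSr.
have Skq k f : hnorm (Sk k f) <= q ^+ k * hnorm f.
  elim: k => [|k IH]; first by rewrite mul1r.
  by apply: le_trans (Sq _) _; rewrite exprS -mulrA ler_pM2l.
pose n k := hnorm (X s (Sk k)).
have dotS i j : rdot (X s (Sk i)) (X s (Sk j)) = rdot (X s (Sk (j + i)%N)) (X s id).
  rewrite /rdot (hdot_X _ _ _ (aSk j) (MSk j)); congr (Re '[X s _, _]).
  by apply/funext => f; rewrite /= /Sk iterD.
have logconvex k : n k.+1 ^+ 2 <= n k * n k.+2.
  rewrite /n sqr_hnorm (dotS k.+1 k.+1) addSnnS -(dotS k.+2 k) rdotC.
  exact: rdot_le.
(* The constant [d] depends on the expression [s] and is useless as a norm bound; only the rate [q]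
   is exploited. *)
have [d nd] : exists d, forall k, n k <= d * q ^+ k.
  rewrite /n /X; elim: s {n dotS logconvex} => [|p r [d IH]].
    by exists 0 => k; rewrite big_nil hnorm0 mul0r.
  have [c c0 yc] := bounded_mapP (svalP p.1).1; have [v v0 Vv] := bounded_mapP bV.
  exists (c * v * hnorm p.2 + d) => k; rewrite big_cons mulrDl.
  apply: le_trans (ler_hnormD _ _) _; rewrite lerD //.
  apply: le_trans (yc _) _; rewrite -!mulrA ler_pM2l //.
  apply: le_trans (Vv _) _; rewrite ler_pM2l // [hnorm _ * _]mulrC; exact: Skq.
have TT : rdot (X s T) (X s T) = rdot (X s (Sk 1)) (X s id).
  by rewrite /rdot (hdot_X _ _ _ TT' MT').
suff n1 : n 1%N <= q * n 0%N.
  apply: hnorm_le; first by rewrite mulr_ge0 ?hnorm_ge0 ?ltW.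
  rewrite TT; apply: le_trans (rdot_le _ _) _.
  have -> : (t * hnorm (X s id)) ^+ 2 = q * n 0%N * n 0%N.
    by rewrite /q /n -[Sk 0]/(id : l2G -> l2G); ring.
  by rewrite ler_wpM2r ?hnorm_ge0.
have [n00|n00] := eqVneq (n 0%N) 0.
  have : n 1%N ^+ 2 <= 0 by apply: le_trans (logconvex 0%N) _; rewrite n00 mul0r.
  rewrite n00 mulr0 => h.
  have /eqP : n 1%N ^+ 2 == 0 by rewrite eq_le h sqr_ge0.
  by move=> /eqP; rewrite sqrf_eq0 => /eqP ->.
have n0 : 0 < n 0%N by rewrite lt_def n00 hnorm_ge0.
(* By log-convexity the ratios of successive terms never fall below the first one, [u]; if [u > q],
   the growth [u^k] defeats [d q^k]. *)
rewrite leNgt; apply/negP => qn; pose u := n 1%N / n 0%N.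
have qu : q < u by rewrite ltr_pdivlMr.
have u0 : 0 < u by exact: lt_trans qu.
have grow k : 0 < n k /\ u * n k <= n k.+1.
  elim: k => [|k [nk IH]]; first by rewrite /u mulfVK.
  have nk1 : 0 < n k.+1 by apply: lt_le_trans IH; rewrite mulr_gt0.
  split=> //; rewrite -(ler_pM2l nk); apply: le_trans (logconvex k).
  by rewrite mulrCA mulrA expr2 ler_pM2r.
have un k : u ^+ k * n 0%N <= n k.
  elim: k => [|k IH]; first by rewrite mul1r.
  apply: le_trans (grow k).2; rewrite exprS -mulrA ler_pM2l //.
by apply: (expr_unbounded q0 qu n0 (d := d)) => k; exact: le_trans (un k) (nd k).
Qed.

Let extends_exists T : M T -> exists x, extends T x.
Proof.
move=> MT; have [t t0 Tt] := bounded_mapP MT.1.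
pose Gr x z := exists s, x = X s id /\ z = X s T.
have Gr_lin c x z x' z' : Gr x z -> Gr x' z' -> Gr (c *: x + x') (c *: z + z').
  move=> [s [-> ->]] [r [-> ->]]; exists ([seq (p.1, c *: p.2) | p <- s] ++ r).
  by split; rewrite /X big_cat big_map scaler_sumr; congr (_ + _); apply: eq_bigr => p _;
    rewrite ?(linZ MT.1.1) (linZ bV.1) (linZ (svalP p.1).1.1).
have Gr_bound x z : Gr x z -> hnorm z <= t * hnorm x.
  by move=> [s [-> ->]]; exact: X_bound.
have Gr_dense x : hcl [set x | exists z, Gr x z] x.
  move: x; apply: hcl_dense => [c x z [x' Gx] [z' Gz]||x xG].
  - by exists (c *: x' + z'); exact: Gr_lin.
  - by exists 0, [::]; rewrite /X !big_nil.
  apply: D_total => _ [y [f [Sy ->]]]; apply: xG.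
  exists (X [:: (exist _ y Sy, f)] T), [:: (exist _ y Sy, f)].
  by rewrite /X big_seq1.
have [x bx xG] := graph_extension (ltW t0) Gr_lin Gr_bound Gr_dense.
exists x; split=> // y f Sy; apply: xG; exists [:: (exist _ y Sy, f)].
by rewrite /X !big_seq1.
Qed.

Lemma isomorphism_of_left_inverse : star_isomorphic M N.
Proof.
have /choice[Phi PhiP] T : exists x, M T -> extends T x.
  (* Outside [M] the value is arbitrary. *)
  have [MT|nMT] := pselect (M T); last by exists id.
  by have [x Tx] := extends_exists MT; exists x.
have bl := rep_bounded (pi := lam); have bp := rep_bounded (pi := pi).
have NPhi T : M T -> N (Phi T) by move=> /PhiP/extends_commutant.
have PhiE T y f : M T -> Sg y -> Phi T (y (V f)) = y (V (T f)) by move=> /PhiP[_]; exact.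
exists Phi; split; first split.
- by move=> T MT; exact: NPhi.
- move=> S T /set_mem MS /set_mem MT ST; apply/funext => f.
  by rewrite -[LHS]LV -[RHS]LV -(PhiE S id) // -(PhiE T id) // ST.
- move=> n Nn; exists (compress n); first exact: compress_commutant.
  exact: extends_unique (PhiP _ (compress_commutant Nn)) (compress_extends Nn).
- move=> c S T MS MT; have MST : M (c \*: S \+ T) := commutant_lin bl c MS MT.
  apply: extends_unique (PhiP _ MST) _; split.
    exact: (commutant_lin bp c (NPhi _ MS) (NPhi _ MT)).1.
  move=> y f Sy; rewrite /= !PhiE // (linD bV.1) (linZ bV.1).
  by rewrite (linD Sy.1.1) (linZ Sy.1.1).
- move=> S T MS MT; have MST : M (S \o T) := commutant_comp MS MT.
  apply: extends_unique (PhiP _ MST) _; split.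
    exact: (commutant_comp (NPhi _ MS) (NPhi _ MT)).1.
  by move=> y f Sy; rewrite /= !PhiE.
- move=> S T MS MT ST.
  (* The true adjoint of [Phi S] and [Phi T] are compared through their matrix coefficients on the
     total set [D]. *)
  have [x Nx Sx] := rep_commutant_adjoint (NPhi _ MS).
  suff <- : x = Phi T by [].
  apply: total_ext D_total Nx.1 (NPhi _ MT).1 _ => _ [y [f [Sy ->]]].
  apply/eqP; rewrite -subr_eq0; apply/eqP/D_total => _ [y' [f' [Sy' ->]]].
  rewrite hdotC hdotBr -Sx !PhiE //.
  by rewrite -(hdot_term id f' f Sy' Sy (adjoint_pair_sym ST) MS) subrr rmorph0.
Qed.

End isomorphism_of_dual_pair.

(** * The corner algebra on the range of [P] and the orbit of [P chi1] *)

Section corner.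
Variables (R : realType) (G : groupType) (P : projection (l2 R G)).
Local Notation l2G := (l2 R G).
Local Notation lam := (lreg R G).
Local Notation M := (commutant (range lam)).
Local Notation chi1 := (chi R (1%g : G)).
Hypothesis hP : M P.
Local Notation pi := (subrep hP).
Local Notation N := (commutant (range pi)).

Definition to_ran (f : l2G) : ran P := Ran (proj_ranP P f).

Lemma to_ranK (y : ran P) : to_ran (ran_val y) = y.
Proof. by apply: ran_val_inj; rewrite /= proj_ran. Qed.

Lemma hdot_ran (x y : ran P) : '[x, y] = '[ran_val x, ran_val y].
Proof. by []. Qed.

Lemma hnorm_ran (x : ran P) : hnorm x = hnorm (ran_val x).
Proof. by []. Qed.

Lemma bounded_ran_val : bounded_map (@ran_val _ _ P).
Proof. by split=> //; exists 1 => x; rewrite mul1r hnorm_ran. Qed.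

Lemma bounded_to_ran : bounded_map to_ran.
Proof.
split; first by move=> a x y; apply: ran_val_inj; exact: proj_linear.
by exists 1 => f; rewrite mul1r hnorm_ran; exact: proj_contraction.
Qed.

Lemma to_ran_adjoint : adjoint_pair to_ran (@ran_val _ _ P).
Proof. by move=> f y; rewrite hdot_ran proj_self_adjoint proj_ran. Qed.

Definition extend_ran (S : ran P -> ran P) (f : l2G) : l2G := ran_val (S (to_ran f)).

Lemma subrepE g y : ran_val (pi g y) = lam g (ran_val y).
Proof. by []. Qed.

Lemma to_ran_lreg g f : to_ran (lam g f) = pi g (to_ran f).
Proof. by apply: ran_val_inj; rewrite subrepE -(rep_commutantE g f hP). Qed.

Lemma extend_ran_commutant S : N S -> M (extend_ran S).
Proof.
move=> NS; apply: rep_commutantP => [|g f].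
  exact: bounded_map_comp bounded_ran_val (bounded_map_comp NS.1 bounded_to_ran).
by rewrite /extend_ran to_ran_lreg (rep_commutantE _ _ NS) subrepE.
Qed.

Lemma compress_ran_commutant T : M T -> N (fun y => to_ran (T (ran_val y))).
Proof.
move=> MT; apply: rep_commutantP => [|g y].
  exact: bounded_map_comp bounded_to_ran (bounded_map_comp MT.1 bounded_ran_val).
by rewrite subrepE (rep_commutantE _ _ MT) to_ran_lreg.
Qed.

Lemma corner_commutant : corner P M = N.
Proof.
apply/seteqP; split=> [S [T MT ST]|S NS].
  have -> : S = fun y => to_ran (T (ran_val y)).
    by apply/funext => y; apply: ran_val_inj; rewrite ST proj_ran.
  exact: compress_ran_commutant.
exists (extend_ran S); first exact: extend_ran_commutant.
by move=> y; rewrite /extend_ran proj_ran proj_ran to_ranK.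
Qed.

Let xi := to_ran chi1.

(** Pairing with the orbit returns the coordinates of [y] in [l2(G)], so the orbit is a Parseval
    frame and is total. *)
Lemma hdot_orbit y g : '[y, pi g xi] = ran_val y g.
Proof.
rewrite -to_ran_lreg -chi_lreg -(adjoint_pair_sym to_ran_adjoint).
exact: hdot_chi.
Qed.

Lemma orbit_total y : (forall g, '[y, pi g xi] = 0) -> y = 0.
Proof. by move=> y0; apply: ran_val_inj; apply: l2P => g; rewrite -hdot_orbit y0. Qed.

Lemma orbit_frame : complete_frame_vector pi xi.
Proof.
exists 1, 1; split=> // y; rewrite mul1r hnorm_ran -sqsum_hnorm.
rewrite [X in (_ <= X <= _)%E](_ : _ = sqsum (ran_val y)) ?lexx //.
by apply: eq_esum => g _; rewrite hdot_orbit.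
Qed.

(** Extending by zero on the kernel of [P] turns the vector state of [xi] into the trace of [M]. *)
Lemma corner_trace S T : N S -> N T -> '[S (T xi), xi] = '[T (S xi), xi].
Proof.
have E X Y : '[X (Y xi), xi] = '[extend_ran X (extend_ran Y chi1), chi1].
  by rewrite -(adjoint_pair_sym to_ran_adjoint) /extend_ran to_ranK.
by move=> NS NT; rewrite (E S T) (E T S); apply: l2_trace; exact: extend_ran_commutant.
Qed.

Hypothesis iccG : icc G.

(** Taking for [n] the compressions of the right translations reduces this to
    [regular_irreducible]. *)
Lemma corner_irreducible v d : (forall n g, N n -> '[v, n (pi g d)] = 0) -> v = 0 \/ d = 0.
Proof.
move=> vd; have [|v0|d0] := @regular_irreducible R G iccG (ran_val v) (ran_val d).
- move=> g h; rewrite rep_adjoint rep_adjoint -subrepE.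
  have := vd _ g^-1%g (compress_ran_commutant (rreg_commutant R h^-1)).
  by rewrite -(adjoint_pair_sym to_ran_adjoint).
- by left; exact: ran_val_inj.
- by right; exact: ran_val_inj.
Qed.

Lemma isomorphism_of_dual_pair (sigma : unirep G (ran P)) :
  dual_pair pi sigma -> star_isomorphic M N.
Proof.
move=> [_ NE _ [psi /riesz_inv rsz]].
have [V [W [bV bW VW Vchi _]]] := bessel_synthesis (riesz_bessel rsz).
have [a a0 V_ge] := riesz_lower_bound rsz bV Vchi.
have Vrho := synthesis_rreg bV Vchi; have Wsigma := analysis_rreg bV VW Vchi.
have [L [bL LV Lsigma]] := synthesis_left_inverse bV bW VW Vrho Wsigma a0 V_ge.
by apply: (isomorphism_of_left_inverse (@corner_irreducible) NE bV bW VW Vrho Wsigma a0 V_ge bL).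
Qed.

End corner.

Theorem theorem1p3 (R : realType) (G : groupType)
    (countG : countable [set: G]) (iccG : icc G)
    (P : projection (l2 R G)) (hP : commutant (range (lreg R G)) P) :
  star_isomorphic (commutant (range (lreg R G)))
                  (corner P (commutant (range (lreg R G))))
  <->
  exists sigma : unirep G (ran P), dual_pair (subrep hP) sigma.
Proof.
rewrite (corner_commutant hP); split=> [[Phi [bij lin mul adj]]|[sigma]].
  exact: (dual_pair_of_isomorphism iccG (orbit_frame hP) (corner_trace (hP := hP))
    (orbit_total (hP := hP)) bij lin mul adj).
exact: isomorphism_of_dual_pair.
Qed.
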